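(* Let $\lambda>0$. The solution to the Cauchy problem $$\begin{cases}\dfrac{\partial^{2/3}u}{\partial t^{2/3}}=-\dfrac{\lambda^2}{2^2}\dfrac{\partial^4u}{\partial x^4}, & x\in\mathbb{R},\ t>0,\\ u(x,0)=\delta(x)\end{cases}$$ is $$u_{2/3}(x,t)=\int_0^\infty\frac{1}{\sqrt{2\pi s}}\cos\left(\frac{x^2}{2s}-\frac{\pi}{4}\right)\frac{3}{\lambda}\frac{1}{\sqrt[3]{3t}}\,Ai\left(\frac{s}{\lambda\sqrt[3]{3t}}\right)ds.$$
   Context: $Ai(x)=\frac1\pi\int_0^\infty\cos\left(\alpha x+\frac{\alpha^3}{3}\right)d\alpha$ is the Airy function. The fractional time derivative is in the sense of Dzhrbashyan–Caputo: for $0<\alpha<1$, $$\frac{\partial^\alpha u}{\partial t^\alpha}(x,t)=\frac{1}{\Gamma(1-\alpha)}\int_0^t\frac{\frac{\partial u}{\partial t}(x,s)}{(t-s)^{\alpha}}\,ds.$$ $\delta$ is the Dirac delta; the problem and its initial datum are understood in the sense of tempered distributions in $x$. *)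

(* Defs.v *)
(* Built on MathComp and MathComp-Analysis. *)
From HB Require Import structures.
From mathcomp Require Import all_boot all_order all_algebra.
From mathcomp Require Import all_classical all_reals all_analysis.

Set Implicit Arguments.
Unset Strict Implicit.
Unset Printing Implicit Defensive.

Import Order.TTheory GRing.Theory Num.Theory.
Import numFieldNormedType.Exports.

Local Open Scope classical_set_scope.
Local Open Scope ring_scope.

(* The integral defining Ai converges only conditionally, so it is a limit of
   integrals over [0, A] and not a Lebesgue integral over the half-line. *)
Definition airy (R : realType) (x : R) : R :=
  pi^-1 * lim ((\int[@lebesgue_measure R]_(a in `[0%R, A])
                  cos (a * x + a ^+ 3 / 3)) @[A --> +oo]).

Definition Gamma (R : realType) (z : R) : R :=
  \int[@lebesgue_measure R]_(x in `]0%R, +oo[) (x `^ (z - 1) * expR (- x)).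

Definition caputo_integrand (R : realType) (alpha : R) (g : R -> R) (t s : R)
    : R :=
  derive1 g s / (t - s) `^ alpha.

(* Meaningful for 0 < alpha < 1 when caputo_integrand alpha g t is integrable
   on ]0, t[ . *)
Definition caputo (R : realType) (alpha : R) (g : R -> R) (t : R) : R :=
  (Gamma (1 - alpha))^-1 *
  \int[@lebesgue_measure R]_(s in `]0%R, t[) caputo_integrand alpha g t s.

(* Real-valued test functions and distributions: the equation and the datum
   are real. *)
Definition schwartz (R : realType) (phi : R -> R) : Prop :=
  (forall (n : nat) (x : R), derivable (derive1n n phi) x 1) /\
  (forall m n : nat, exists C : R,
     forall x : R, `|x ^+ m * derive1n n phi x| <= C).

Definition schwartz_seminorm (R : realType) (m n : nat) (phi : R -> R) : R :=
  sup [set `|x ^+ m * derive1n n phi x| | x in [set: R]].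

(* A distribution is a functional on R -> R of which only the values at
   Schwartz functions matter. *)
Definition tempered (R : realType) (T : (R -> R) -> R) : Prop :=
  (forall (a : R) (phi psi : R -> R), schwartz phi -> schwartz psi ->
     T (fun x => a * phi x + psi x) = a * T phi + T psi) /\
  (exists (C : R) (N : nat), forall phi : R -> R, schwartz phi ->
     `|T phi| <=
       C * \sum_(m < N.+1) \sum_(n < N.+1) schwartz_seminorm m n phi).

Definition dist_derive (R : realType) (n : nat) (T : (R -> R) -> R) :
    (R -> R) -> R :=
  fun phi => (-1) ^+ n * T (derive1n n phi).

Definition dirac_delta (R : realType) : (R -> R) -> R := fun phi => phi 0.

Definition function_dist (R : realType) (v : R -> R) : (R -> R) -> R :=
  fun phi => \int[@lebesgue_measure R]_x (v x * phi x).

(* T t is the distribution u(., t) in the variable x. Derivatives and integrals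
   in t are the weak ones, taken after pairing with a test function: t |-> T t
   is weakly C^1 on ]0, +oo[ , the Caputo integral converges absolutely, and
   the initial datum is the weak limit as t -> 0+ . Values of T at t <= 0 play
   no role. *)
Definition cauchy_solution (R : realType) (lambda : R)
    (T : R -> (R -> R) -> R) : Prop :=
  (forall t : R, 0 < t -> tempered (T t)) /\
  (forall phi : R -> R, schwartz phi ->
    let g := fun t : R => T t phi in
    [/\ (forall t : R, 0 < t ->
           derivable g t 1 /\ {for t, continuous (derive1 g)}),
        g t @[t --> 0^'+] --> dirac_delta phi,
        (forall t : R, 0 < t ->
           (@lebesgue_measure R).-integrable `]0%R, t[
             (EFin \o caputo_integrand (2 / 3) g t)) &
        (forall t : R, 0 < t ->
           caputo (2 / 3) g t
           = - (lambda ^+ 2 / 2 ^+ 2) * dist_derive 4 (T t) phi)]).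

Definition u_integrand (R : realType) (lambda x t s : R) : R :=
  (Num.sqrt (2 * pi * s))^-1 * cos (x ^+ 2 / (2 * s) - pi / 4) *
  (3 / lambda) * ((3 * t) `^ 3^-1)^-1 *
  airy (s / (lambda * (3 * t) `^ 3^-1)).

Definition u_sol (R : realType) (lambda x t : R) : R :=
  \int[@lebesgue_measure R]_(s in `]0%R, +oo[) u_integrand lambda x t s.

(* Main.v *)
Require Import Defs.
From HB Require Import structures.
From mathcomp Require Import all_boot all_order all_algebra.
From mathcomp Require Import all_classical all_reals all_analysis.
From mathcomp Require Import measurable_realfun ring lra.

Set Implicit Arguments.
Unset Strict Implicit.
Unset Printing Implicit Defensive.

Import Order.TTheory GRing.Theory Num.Theory.
Import numFieldNormedType.Exports.

Local Open Scope classical_set_scope.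
Local Open Scope ring_scope.

(** The solution is a superposition of two explicit kernels. Write
    p(s,t) = (3/c) Ai(s/c) with c = lambda (3t)^(1/3), and
    K(s,x) = (2 pi s)^(-1/2) cos(x^2/(2s) - pi/4), so that the function of the
    theorem is u(x,t) = int_0^oo p(s,t) K(s,x) ds.  Two facts are used.

    - In s, K solves d_s^2 K = - (1/4) d_x^4 K: it is the real part of the
      Schroedinger kernel, up to a constant phase, and each s-derivative costs
      two x-derivatives and a phase -pi/2 (GG_dvs).  Paired with a test function
      phi it tends to phi(0) as s -> 0+, while its s-derivative tends to 0
      (GG_lim).
    - In t, integration against p(.,t) intertwines the second derivative with
      the Caputo derivative of order 2/3: if G is C^2 with polynomial growth
      and G' -> 0 at 0+, then g(t) = int p(s,t) G(s) ds satisfies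
      D^(2/3) g = lambda^2 int p(s,t) G''(s) ds (UU_caputo) and g -> G(0+)
      (UU_lim), because int_0^oo Ai = 1/3.

    Together they give existence (u_cauchy), as
    lambda^2 d_s^2 K = - (lambda^2/4) d_x^4 K.

    The intertwining property is a statement about the Airy function alone.
    The substitution s = t v^3 in the Caputo integral reduces it to the identity
    int_0^1 (1 - v^3)^(-2/3) Ai'(x/v) dv = - I3 Ai(x), where
    I3 = int_0^oo exp(-r^3/3) dr = 3^(-2/3) Gamma(1/3) (YY_airy).  The left side
    is a bounded solution of y'' = x y, hence a multiple of Ai, and integrating
    in x gives the factor.  All this is done on the absolutely convergent
    integral AA k for the k-th derivative of Ai, obtained by rotating the
    contour by pi/6 (airyE); the rotation is an integration over the slope of the
    ray (arc_rotation).

    Uniqueness is a duality argument.  Given a solution T, let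
    k(t,s) = T_t(K(s,.) * phi) and h(t,tau) = int p(s,tau) k(t,s) ds.  Both the
    equation for T and the intertwining property say that the order-2/3
    derivatives of h in t and in tau are the same function
    Q = lambda^2 int p(s,tau) d_s^2 k(t,s) ds; moreover h(t,0+) = T_t phi and
    h(0+,tau) = <u(.,tau), phi>.  Abel inversion (abel_inversion) in each
    variable, integrated over the segment t + tau = X, produces twice the same
    double integral of Q, whence int_0^X T_t phi dt = int_0^X <u(.,t), phi> dt
    for all X (ints_eq).  The dominations that these exchanges require follow
    from the uniform boundedness principle on the Schwartz space
    (uniform_bound), proved by a gliding hump. *)


(** * Derivatives *)

Section derivative_relation.
Variable R : realType.
Implicit Types (f g h F : R -> R) (x y a b : R) (D : set R).
Notation mu := (@lebesgue_measure R).
Notation igr D f := (mu.-integrable D (EFin \o f)).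

(** A relation rather than an operator: derivatives then compose by
    unification, and the tactic dvs below computes the derivative of an
    explicit expression, leaving only its side conditions and the comparison
    with the expected value. *)
Definition dv f x d := is_derive x (1 : R) f d.

Lemma dv_eq f x d d' : dv f x d -> d = d' -> dv f x d'.
Proof. by move=> ? <-. Qed.
Lemma dv_cst (c x : R) : dv (fun=> c) x 0.
Proof. exact: is_derive_cst. Qed.
Lemma dv_id x : dv (fun y => y) x 1.
Proof. exact: is_derive_id. Qed.
Lemma dvD f g x a b : dv f x a -> dv g x b -> dv (fun y => f y + g y) x (a + b).
Proof. exact: is_deriveD. Qed.
Lemma dvB f g x a b : dv f x a -> dv g x b -> dv (fun y => f y - g y) x (a - b).
Proof. exact: is_deriveB. Qed.
Lemma dvN f x a : dv f x a -> dv (fun y => - f y) x (- a).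
Proof. exact: is_deriveN. Qed.
Lemma dvM f g x a b : dv f x a -> dv g x b ->
  dv (fun y => f y * g y) x (a * g x + f x * b).
Proof.
move=> fa gb; apply: dv_eq (is_deriveM fa gb) _.
by rewrite addrC; congr (_ + _); rewrite mulrC.
Qed.
Lemma dvX f x a n : dv f x a -> dv (fun y => f y ^+ n) x (n%:R * f x ^+ n.-1 * a).
Proof.
move=> fa; rewrite /dv (_ : (fun y => f y ^+ n) = f ^+ n).
  exact: dv_eq (@is_deriveX _ _ _ n _ _ _ fa) _.
by apply/funext => y; rewrite exprfctE.
Qed.
Lemma dv_comp f g x a b : dv f (g x) a -> dv g x b -> dv (fun y => f (g y)) x (a * b).
Proof. exact: is_derive1_comp. Qed.
Lemma dvV f x a : f x != 0 -> dv f x a -> dv (fun y => (f y)^-1) x (- a / f x ^+ 2).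
Proof.
move=> f0 fa; apply: dv_eq (is_deriveV f0 fa) _.
by rewrite /GRing.scale/= !mulNr mulrC.
Qed.
Lemma dv_exp f x a : dv f x a -> dv (fun y => expR (f y)) x (expR (f x) * a).
Proof. by move=> fa; apply: dv_comp fa; exact: is_derive_expR. Qed.
Lemma dv_cos f x a : dv f x a -> dv (fun y => cos (f y)) x (- sin (f x) * a).
Proof. by move=> fa; apply: dv_comp fa; exact: is_derive_cos. Qed.
Lemma dv_sin f x a : dv f x a -> dv (fun y => sin (f y)) x (cos (f x) * a).
Proof. by move=> fa; apply: dv_comp fa; exact: is_derive_sin. Qed.
Lemma dv_powR f x a (p : R) : 0 < f x -> dv f x a ->
  dv (fun y => f y `^ p) x (p * f x `^ (p - 1) * a).
Proof.
by move=> f0 fa; apply: (@dv_comp (fun z => z `^ p) f) fa; exact: is_derive1_powR.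
Qed.
Lemma dv_ln f x a : 0 < f x -> dv f x a -> dv (fun y => ln (f y)) x ((f x)^-1 * a).
Proof. by move=> f0 fa; apply: (@dv_comp (@ln R) f) fa; exact: is_derive1_ln. Qed.
Lemma dv_atan f x a : dv f x a -> dv (fun y => atan (f y)) x ((1 + f x ^+ 2)^-1 * a).
Proof. by move=> fa; apply: dv_comp fa; exact: is_derive1_atan. Qed.
Lemma dv_sqrt f x a : 0 < f x -> dv f x a ->
  dv (fun y => Num.sqrt (f y)) x ((2 * Num.sqrt (f x))^-1 * a).
Proof. by move=> f0 fa; apply: (@dv_comp Num.sqrt f) fa; exact: is_derive1_sqrt. Qed.

Lemma dv_ct f x a : dv f x a -> {for x, continuous f}.
Proof.
move=> fa; apply: differentiable_continuous; apply/derivable1_diffP.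
exact: (@ex_derive _ _ _ _ _ _ _ fa).
Qed.
Lemma dv_near f g x a : (\near x, f x = g x) -> dv f x a -> dv g x a.
Proof. by move=> fg; apply: near_eq_is_derive fg. Qed.
Lemma dv_derive1 f x a : dv f x a -> derivable f x 1 /\ derive1 f x = a.
Proof. by move=> fa; split; [exact: (@ex_derive _ _ _ _ _ _ _ fa) | rewrite derive1E; exact: (@derive_val _ _ _ _ _ _ _ fa)]. Qed.

End derivative_relation.
Ltac dv_step := lazymatch goal with
 | |- dv (fun _ => ?c) _ _ => simple eapply dv_cst
 | |- dv (fun y => y) _ _ => simple eapply dv_id
 | |- dv ( *%R _) _ _ => eapply (dvM (dv_cst _ _) (dv_id _))
 | |- dv ( +%R _) _ _ => eapply (dvD (dv_cst _ _) (dv_id _))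
 | |- dv (@GRing.opp _) _ _ => eapply (dvN (dv_id _))
 | |- dv (@GRing.inv _) _ _ => eapply (@dvV _ (fun y => y))
 | |- dv expR _ _ => eapply (dv_exp (dv_id _))
 | |- dv cos _ _ => eapply (dv_cos (dv_id _))
 | |- dv sin _ _ => eapply (dv_sin (dv_id _))
 | |- dv (@ln _) _ _ => eapply (@dv_ln _ (fun y => y))
 | |- dv (fun y => _ - _) _ _ => eapply dvB
 | |- dv (fun y => _ + _) _ _ => eapply dvD
 | |- dv (fun y => - _) _ _ => eapply dvN
 | |- dv (fun y => _ * _) _ _ => eapply dvM
 | |- dv (fun y => _ ^+ _) _ _ => eapply dvX
 | |- dv (fun y => _ ^-1) _ _ => eapply dvV
 | |- dv (fun y => expR _) _ _ => eapply dv_exp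
 | |- dv (fun y => cos _) _ _ => eapply dv_cos
 | |- dv (fun y => sin _) _ _ => eapply dv_sin
 | |- dv (fun y => ln _) _ _ => eapply dv_ln
 | |- dv (fun y => atan _) _ _ => eapply dv_atan
 | |- dv (fun y => Num.sqrt _) _ _ => eapply dv_sqrt
 | |- dv (fun y => _ `^ _) _ _ => eapply dv_powR
 end.
Ltac dvs := eapply dv_eq; [repeat dv_step|].



(** * Integrals of real functions *)

Section integrals_on_sets.
Variable R : realType.
Implicit Types (f g h F : R -> R) (x y a b : R) (D : set R).
Notation mu := (@lebesgue_measure R).
Notation igr D f := (mu.-integrable D (EFin \o f)).

Lemma igr_meas D f : igr D f -> measurable_fun D f.
Proof. by move=> /integrableP[/measurable_EFinP]. Qed.

Lemma meas_cont D f : open D -> (forall x, D x -> {for x, continuous f}) ->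
  measurable_fun D f.
Proof.
move=> oD cf; apply: open_continuous_measurable_fun => // x /set_mem Dx.
exact: cf.
Qed.

Lemma igr_le D f g : measurable D -> measurable_fun D f -> igr D g ->
  (forall x, D x -> `|f x| <= g x) -> igr D f.
Proof.
move=> mD mf ig fg; apply: (@le_integrable _ _ _ mu D mD _ (EFin \o g)) => //.
  exact/measurable_EFinP.
by move=> x Dx /=; rewrite lee_fin (le_trans (fg x Dx))// ler_norm.
Qed.

Lemma igr_eq D f g : measurable D -> (forall x, D x -> f x = g x) ->
  igr D f -> igr D g.
Proof.
move=> mD fg; apply: (@eq_integrable _ _ _ mu D mD) => x /set_mem Dx /=.
by rewrite fg.
Qed.

Lemma Rint_eq D f g : (forall x, D x -> f x = g x) ->
  \int[mu]_(x in D) f x = \int[mu]_(x in D) g x.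
Proof. by move=> fg; apply: eq_Rintegral => x /set_mem; exact: fg. Qed.

Lemma igrZ D f k : measurable D -> igr D f -> igr D (fun x => k * f x).
Proof. by move=> mD h; exact: (@integrableZl _ _ _ mu D mD k _ h). Qed.

Lemma igrD D f g : measurable D -> igr D f -> igr D g -> igr D (fun x => f x + g x).
Proof. by move=> mD h ig; exact: (@integrableD _ _ _ mu D mD _ _ h ig). Qed.

Lemma igrB D f g : measurable D -> igr D f -> igr D g -> igr D (fun x => f x - g x).
Proof. by move=> mD h ig; exact: (@integrableB _ _ _ mu D mD _ _ h ig). Qed.

Lemma igr_norm D f : measurable D -> igr D f -> igr D (fun x => `|f x|).
Proof. by move=> mD h; exact: (@integrable_norm _ _ _ mu D _ h). Qed.

Lemma igrS D E f : measurable D -> measurable E -> E `<=` D -> igr D f -> igr E f.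
Proof. by move=> mD mE ED; exact: (@integrableS _ _ _ mu). Qed.

Lemma RintZ D f k : measurable D -> igr D f ->
  \int[mu]_(x in D) (k * f x) = k * \int[mu]_(x in D) f x.
Proof. by move=> mD h; exact: (@RintegralZl _ _ _ mu D f k mD h). Qed.

Lemma RintD D f g : measurable D -> igr D f -> igr D g ->
  \int[mu]_(x in D) (f x + g x) = \int[mu]_(x in D) f x + \int[mu]_(x in D) g x.
Proof. by move=> mD h ig; exact: (@RintegralD _ _ _ mu D _ _ mD h ig). Qed.

Lemma RintB D f g : measurable D -> igr D f -> igr D g ->
  \int[mu]_(x in D) (f x - g x) = \int[mu]_(x in D) f x - \int[mu]_(x in D) g x.
Proof. by move=> mD h ig; exact: (@RintegralB _ _ _ mu D _ _ mD h ig). Qed.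

Lemma Rint_le D f g : measurable D -> igr D f -> igr D g ->
  (forall x, D x -> f x <= g x) ->
  \int[mu]_(x in D) f x <= \int[mu]_(x in D) g x.
Proof. by move=> mD h ig fg; exact: (@le_Rintegral _ _ _ mu D _ _ mD h ig fg). Qed.

Lemma Rint_le_norm D f g : measurable D -> measurable_fun D f -> igr D g ->
  (forall x, D x -> `|f x| <= g x) ->
  `|\int[mu]_(x in D) f x| <= \int[mu]_(x in D) g x.
Proof.
move=> mD mf ig fg; have h : igr D f by exact: igr_le fg.
apply: le_trans (@le_normr_Rintegral _ _ _ mu D _ mD h) _.
by apply: Rint_le => //; exact: igr_norm.
Qed.

Lemma igr_fin D f : measurable D -> igr D f ->
  (\int[mu]_(x in D) (f x)%:E)%E = (\int[mu]_(x in D) f x)%:E.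
Proof.
move=> mD h; rewrite /Rintegral fineK//.
exact: (@integrable_fin_num _ _ _ mu D mD _ h).
Qed.

Lemma Rdct D (fn : nat -> R -> R) f g : measurable D ->
  (forall n, measurable_fun D (fn n)) ->
  (forall x, D x -> fn n x @[n --> \oo] --> f x) -> igr D g ->
  (\forall n \near \oo, forall x, D x -> `|fn n x| <= g x) ->
  igr D f /\ (\int[mu]_(x in D) fn n x @[n --> \oo] --> \int[mu]_(x in D) f x).
Proof.
move=> mD mf fnf ig [N _ bd].
have mff : measurable_fun D f.
  by apply: (measurable_fun_cvg mf) => x Dx; exact: fnf.
have [|||||igf _ cv] := @dominated_convergence _ _ _ mu D mD
  (fun n => EFin \o fn (n + N)%N) (EFin \o f) (EFin \o g).
- by move=> n; apply/measurable_EFinP; exact: mf.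
- exact/measurable_EFinP.
- apply: aeW => x Dx; apply: cvg_EFin; first exact: nearW.
  by have := fnf x Dx; rewrite -(cvg_shiftn N).
- exact: ig.
- by apply: aeW => x n Dx /=; rewrite lee_fin bd//= leq_addl.
split=> //; rewrite -(cvg_shiftn N).
apply: fine_cvg => /=; rewrite -igr_fin//.
Qed.

(** Lebesgue integrals over D are limits of integrals over the intervals [a n,
    b n], on which the classical fundamental theorem applies. *)
Definition exh D (a b : nat -> R) := [/\ (forall n, a n < b n),
  (forall n x, a n <= x <= b n -> D x) &
  (forall x, D x -> \forall n \near \oo, a n <= x <= b n)].

Lemma ftc_compact f F a b : a < b ->
  (forall x, a <= x <= b -> dv F x (f x)) ->
  (forall x, a <= x <= b -> {for x, continuous f}) ->
  igr `[a, b] f /\ \int[mu]_(x in `[a, b]) f x = F b - F a.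
Proof.
move=> ab dF cf.
have cfw : {within `[a, b], continuous f}.
  by apply: continuous_in_subspaceT => x; rewrite inE/= in_itv/=; exact: cf.
split; first by apply: (@continuous_compact_integrable R f) => //; exact: segment_compact.
rewrite /Rintegral (continuous_FTC2 (F := F) ab cfw) -?EFinB//.
- split=> [x||].
  + rewrite in_itv/= => /andP[ax xb].
    by have /dv_derive1[] := dF x (introT andP (conj (ltW ax) (ltW xb))).
  + by apply: cvg_at_right_filter; apply: dv_ct (dF _ _); rewrite lexx ltW.
  + by apply: cvg_at_left_filter; apply: dv_ct (dF _ _); rewrite lexx ltW.
- move=> x; rewrite in_itv/= => /andP[ax xb].
  by have /dv_derive1[] := dF x (introT andP (conj (ltW ax) (ltW xb))).
Qed.

End integrals_on_sets.


(** * Exhaustion by compact intervals *)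

Section exhaustion.
Variable R : realType.
Implicit Types (f g h F : R -> R) (x y a b : R) (D : set R).
Notation mu := (@lebesgue_measure R).
Notation igr D f := (mu.-integrable D (EFin \o f)).

Lemma Rint_patch D E f : E `<=` D ->
  \int[mu]_(x in D) (f \_ E) x = \int[mu]_(x in E) f x.
Proof. by move=> ED; rewrite -(Rintegral_mkcondr mu) (setIidr ED). Qed.

Lemma itv_cc_mem a b x : `[a, b]%classic x = (a <= x <= b) :> Prop.
Proof. by rewrite /= in_itv. Qed.

Lemma exh_sub D u v n : exh D u v -> `[u n, v n] `<=` D.
Proof. by case=> _ uvD _ x; rewrite itv_cc_mem; exact: uvD. Qed.

Lemma patchE0 f (E : set R) x : E x -> (f \_ E) x = f x.
Proof. by move=> Ex; rewrite patchE mem_set. Qed.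
Lemma patchE1 f (E : set R) x : ~ E x -> (f \_ E) x = 0.
Proof. by move=> Ex; rewrite patchE memNset. Qed.

Lemma exh_patch D u v f x : exh D u v -> D x ->
  (f \_ `[u n, v n]) x @[n --> \oo] --> f x.
Proof.
move=> [_ _ ex] Dx; apply: cvg_near_cst; near=> n.
apply/eqP; rewrite patchE0// itv_cc_mem; near: n; exact: ex.
Unshelve. all: by end_near. Qed.

Lemma exh_meas D u v f n : measurable D -> measurable_fun D f -> exh D u v ->
  measurable_fun D (f \_ `[u n, v n]).
Proof.
move=> mD mf ex; apply/(measurable_restrict _ (measurable_itv _) mD).
by apply: measurable_funS mf => //; apply: subIsetl.
Qed.

Lemma exh_cvg D u v f : measurable D -> exh D u v -> igr D f ->
  \int[mu]_(x in `[u n, v n]) f x @[n --> \oo] --> \int[mu]_(x in D) f x.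
Proof.
move=> mD ex h.
rewrite (_ : (fun n => \int[mu]_(x in `[u n, v n]) f x)
  = (fun n => \int[mu]_(x in D) (f \_ `[u n, v n]) x)); last first.
  by apply/funext => n; rewrite Rint_patch//; exact: exh_sub ex.
have [] := @Rdct R D (fun n => f \_ `[u n, v n]) f (fun x => `|f x|) => //.
- by move=> n; apply: exh_meas ex => //; exact: igr_meas.
- by move=> x Dx; exact: exh_patch ex Dx.
- exact: igr_norm.
apply: nearW => n x Dx; have [xi|xi] := pselect (`[u n, v n]%classic x).
  by rewrite patchE0.
by rewrite patchE1// normr0.
Qed.

(** Integrability from a bound on the integrals over the exhausting intervals,
    by Fatou. *)
Lemma exh_fatou D u v f M : measurable D -> exh D u v -> measurable_fun D f ->
  (forall n, igr `[u n, v n] f) ->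
  (\forall n \near \oo, \int[mu]_(x in `[u n, v n]) `|f x| <= M) ->
  igr D f.
Proof.
move=> mD ex mf iuv bd; apply/integrableP; split; first exact/measurable_EFinP.
pose k n x := ((fun x => `|f x|) \_ `[u n, v n]) x.
have k0 n x : 0 <= k n x.
  have [xi|xi] := pselect (`[u n, v n]%classic x).
    by rewrite /k patchE0.
  by rewrite /k patchE1.
have := @fatou _ _ _ mu D mD (fun n x => (k n x)%:E) _ _.
have mk n : measurable_fun D (k n).
  by apply: exh_meas ex => //; exact: measurableT_comp.
move=> /(_ (fun n => proj2 (measurable_EFinP _ _) (mk n))) H.
have {}H := H (fun n x _ => k0 n x).
have E : (\int[mu]_(x in D) limn_einf (fun n => (k n x)%:E) =
   \int[mu]_(x in D) `|(EFin \o f) x|)%E.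
  apply: eq_integral => x /set_mem Dx.
  have : (k n x)%:E @[n --> \oo] --> `|f x|%:E.
    apply: cvg_EFin; first exact: nearW.
    exact: (@exh_patch D u v (fun x => `|f x|)).
  by move=> /cvg_limn_einf_sup[-> _].
rewrite E in H; apply: le_lt_trans H _.
apply: (@le_lt_trans _ _ M%:E); last exact: ltry.
rewrite limn_einf_lim; apply: lime_le; first exact: is_cvg_einfs.
near=> n; apply: (@le_trans _ _ (\int[mu]_(x in D) (k n x)%:E)%E).
  by apply: ereal_inf_lbound; exists n => /=.
have -> : (\int[mu]_(x in D) (k n x)%:E = \int[mu]_(x in `[u n, v n]) `|f x|%:E)%E.
  rewrite -[in RHS](setIidr (exh_sub (n := n) ex)) [in RHS]integral_mkcondr.
  by apply: eq_integral => x _; rewrite /k !patchE; case: ifP.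
rewrite igr_fin//; last exact: igr_norm.
rewrite lee_fin; near: n; exact: bd.
Unshelve. all: by end_near. Qed.

(** Here integrability is a hypothesis, as an improper integral may exist
    without it; for nonnegative integrands it is a conclusion, see ftc_ge0. *)
Lemma ftc_igr D u v f F l0 l1 : measurable D -> exh D u v ->
  (forall x, D x -> dv F x (f x)) ->
  (forall x, D x -> {for x, continuous f}) ->
  F (u n) @[n --> \oo] --> l0 -> F (v n) @[n --> \oo] --> l1 ->
  igr D f -> \int[mu]_(x in D) f x = l1 - l0.
Proof.
move=> mD ex dF cf Fu Fv h.
have /cvg_lim <- // := exh_cvg mD ex h; apply/cvg_lim => //.
rewrite (_ : (fun n => _) = (fun n => F (v n) - F (u n))); first exact: cvgB.
apply/funext => n; have [uv uvD _] := ex.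
by have [] := @ftc_compact R f F _ _ (uv n) (fun x xD => dF x (uvD n x xD))
  (fun x xD => cf x (uvD n x xD)).
Qed.

Lemma ftc_ge0 D u v f F l0 l1 : measurable D -> exh D u v ->
  (forall x, D x -> dv F x (f x)) -> measurable_fun D f ->
  (forall x, D x -> {for x, continuous f}) -> (forall x, D x -> 0 <= f x) ->
  F (u n) @[n --> \oo] --> l0 -> F (v n) @[n --> \oo] --> l1 ->
  igr D f /\ \int[mu]_(x in D) f x = l1 - l0.
Proof.
move=> mD ex dF mf cf f0 Fu Fv.
suff h : igr D f by split=> //; exact: (ftc_igr mD ex dF cf Fu Fv).
have [uv uvD _] := ex.
have C n := @ftc_compact R f F _ _ (uv n) (fun x xD => dF x (uvD n x xD))
  (fun x xD => cf x (uvD n x xD)).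
apply: (@exh_fatou D u v f (l1 - l0 + 1)) => // [n|]; first by have [] := C n.
have : F (v n) - F (u n) @[n --> \oo] --> l1 - l0 by exact: cvgB.
move=> /cvgrPdist_le/(_ 1 ltr01) P; near=> n.
rewrite (_ : Rintegral _ _ _ = F (v n) - F (u n)).
  rewrite -lerBlDl; apply: le_trans (ler_norm _) _; rewrite distrC.
  near: n; exact: P.
have [_ <-] := C n; apply: Rint_eq => x; rewrite itv_cc_mem => xi.
by rewrite ger0_norm// f0//; exact: uvD xi.
Unshelve. all: by end_near. Qed.

End exhaustion.


(** * Mean value inequalities and substitution *)

Section mean_value.
Variable R : realType.
Implicit Types (f g h F : R -> R) (x y a b : R) (D : set R).
Notation mu := (@lebesgue_measure R).
Notation igr D f := (mu.-integrable D (EFin \o f)).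

Lemma mvt F f a b : a < b -> (forall x, a <= x <= b -> dv F x (f x)) ->
  exists2 c, a < c < b & F b - F a = f c * (b - a).
Proof.
move=> ab dF; have [||c] := @MVT R F f a b ab.
- move=> x; rewrite in_itv/= => /andP[ax xb]; apply: dF; by rewrite !ltW.
- apply: continuous_in_subspaceT => x; rewrite inE/= in_itv/= => xab.
  exact: dv_ct (dF x xab).
- by rewrite in_itv/= => cab E; exists c.
Qed.

Lemma dv_gt0_lt F f a b : a < b -> (forall x, a <= x <= b -> dv F x (f x)) ->
  (forall x, a <= x <= b -> 0 < f x) -> F a < F b.
Proof.
move=> ab dF f0; have [c /andP[ac cb] E] := mvt ab dF.
by rewrite -subr_gt0 E mulr_gt0 ?subr_gt0// f0// !ltW.
Qed.

Lemma dv_ge0_le F f a b : a <= b -> (forall x, a <= x <= b -> dv F x (f x)) ->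
  (forall x, a <= x <= b -> 0 <= f x) -> F a <= F b.
Proof.
rewrite le_eqVlt => /predU1P[->//|ab] dF f0.
have [c /andP[ac cb] E] := mvt ab dF.
by rewrite -subr_ge0 E mulr_ge0 ?subr_ge0 ?(ltW ab)// f0// !ltW.
Qed.

Lemma mvt_le F f a b M : a <= b -> (forall x, a <= x <= b -> dv F x (f x)) ->
  (forall x, a <= x <= b -> `|f x| <= M) -> `|F b - F a| <= M * (b - a).
Proof.
rewrite le_eqVlt => /predU1P[->//|ab] dF fM; first by rewrite !subrr normr0 mulr0.
have [c /andP[ac cb] ->] := mvt ab dF.
rewrite normrM (ger0_norm (_ : 0 <= b - a)) ?subr_ge0 ?(ltW ab)//.
by rewrite ler_wpM2r ?subr_ge0 ?(ltW ab)// fM// !ltW.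
Qed.

Section subst.
Variables (D1 D2 : set R) (u v : nat -> R) (phi dphi f : R -> R).
Hypotheses (oD1 : open D1) (oD2 : open D2) (ex : exh D1 u v).
Hypotheses (dphiE : forall x, D1 x -> dv phi x (dphi x))
  (cphi : forall x, D1 x -> {for x, continuous dphi})
  (phi0 : forall x, D1 x -> 0 < dphi x)
  (phiD : forall x, D1 x -> D2 (phi x))
  (phiS : forall y, D2 y -> exists2 x, D1 x & phi x = y)
  (cf : forall y, D2 y -> {for y, continuous f}).

Let mD1 : measurable D1. Proof. exact: open_measurable. Qed.
Let mD2 : measurable D2. Proof. exact: open_measurable. Qed.

Let phi_le n x y : u n <= x -> x <= y -> y <= v n -> phi x <= phi y.
Proof.
move=> ux xy yv; have [_ uvD _] := ex.
have H z : x <= z <= y -> D1 z.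
  by move=> /andP[xz zy]; apply: (uvD n); rewrite (le_trans ux)//= (le_trans zy).
apply: (@dv_ge0_le phi dphi) => // z /H Dz; first exact: dphiE.
exact/ltW/phi0.
Qed.

Let phi_lt n x y : u n <= x -> x < y -> y <= v n -> phi x < phi y.
Proof.
move=> ux xy yv; have [_ uvD _] := ex.
have H z : x <= z <= y -> D1 z.
  by move=> /andP[xz zy]; apply: (uvD n); rewrite (le_trans ux)//= (le_trans zy).
by apply: (@dv_gt0_lt phi dphi) => // z /H Dz; [exact: dphiE|exact: phi0].
Qed.

Let phi_ivt n y : phi (u n) <= y <= phi (v n) -> exists2 x, u n <= x <= v n & phi x = y.
Proof.
move=> yi; have [uv uvD _] := ex.
have [||x] := @IVT R phi (u n) (v n) y (ltW (uv n)).
- apply: continuous_in_subspaceT => x; rewrite inE/= in_itv/= => xab.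
  exact/dv_ct/dphiE/(uvD n).
- have le : phi (u n) <= phi (v n) by apply: (@phi_le n) => //; exact: ltW.
  by rewrite (min_idPl le) (max_idPr le).
- by rewrite in_itv/= => xi <-; exists x.
Qed.

Lemma exh_subst : exh D2 (phi \o u) (phi \o v).
Proof.
have [uv uvD ev] := ex; split.
- by move=> n /=; apply: (@phi_lt n).
- move=> n x /= /phi_ivt[y yi <-]; exact/phiD/uvD/yi.
- move=> y /phiS[x Dx <-]; near=> n => /=.
  have /andP[ux xv] : u n <= x <= v n by near: n; exact: ev.
  by rewrite (@phi_le n)//= (@phi_le n).
Unshelve. all: by end_near. Qed.

Let subst_compact (g : R -> R) n : (forall y, D2 y -> {for y, continuous g}) ->
  [/\ igr `[phi (u n), phi (v n)] g, igr `[u n, v n] (fun x => g (phi x) * dphi x)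
  & \int[mu]_(x in `[phi (u n), phi (v n)]) g x =
    \int[mu]_(x in `[u n, v n]) (g (phi x) * dphi x)].
Proof.
move=> cg; have [uv uvD ev] := ex; have [uv2 uvD2 ev2] := exh_subst.
have d1E x : D1 x -> derive1 phi x = dphi x.
  by move=> Dx; have /dv_derive1[] := dphiE Dx.
have cgp x : D1 x -> {for x, continuous (fun x => g (phi x) * dphi x)}.
  move=> Dx; apply: cvgM; last exact: cphi.
  apply: (@continuous_comp _ _ _ phi g); first exact: dv_ct (dphiE Dx).
  exact/cg/phiD.
have i1 : igr `[phi (u n), phi (v n)] g.
  apply: (@continuous_compact_integrable R g); first exact: segment_compact.
  apply: continuous_in_subspaceT => x; rewrite inE/= in_itv/= => xab.
  exact/cg/(uvD2 n).
have i2 : igr `[u n, v n] (fun x => g (phi x) * dphi x).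
  apply: (@continuous_compact_integrable R (fun x => g (phi x) * dphi x)).
    exact: segment_compact.
  apply: continuous_in_subspaceT => x; rewrite inE/= in_itv/= => xab.
  exact/cgp/(uvD n).
split=> //; rewrite /Rintegral; congr fine.
have uD : D1 (u n) by apply: (uvD n); rewrite lexx ltW.
have vD : D1 (v n) by apply: (uvD n); rewrite lexx ltW.
have nD x : D1 x -> \forall y \near x, derive1 phi y = dphi y.
  move=> Dx; near=> y; apply: d1E; near: y; exact: open_nbhs_nbhs.
have c1 x : D1 x -> derive1 phi y @[y --> x] --> dphi x.
  move=> Dx; apply: cvg_trans (cphi Dx); apply: near_eq_cvg.
  by near do apply/esym; exact: nD.
rewrite (@integration_by_substitution_increasing R phi g _ _ (ltW (uv n))).
- apply: eq_integral => x; rewrite inE/= in_itv/= => xi.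
  by rewrite fctE/= d1E//; apply: (uvD n).
- move=> x y; rewrite !in_itv/= => /andP[ux xv] /andP[uy yv] xy.
  exact: (@phi_lt n).
- move=> x; rewrite in_itv/= => /andP[ux xv].
  have Dx : D1 x by apply: (uvD n); rewrite !ltW.
  by rewrite /continuous_at d1E//; exact: c1.
- by apply/cvg_ex; exists (dphi (u n)); apply: cvg_at_right_filter; exact: c1.
- by apply/cvg_ex; exists (dphi (v n)); apply: cvg_at_left_filter; exact: c1.
- split.
  + move=> x; rewrite in_itv/= => /andP[ux xv].
    have Dx : D1 x by apply: (uvD n); rewrite !ltW.
    by have /dv_derive1[] := dphiE Dx.
  + by apply: cvg_at_right_filter; apply: dv_ct (dphiE uD).
  + by apply: cvg_at_left_filter; apply: dv_ct (dphiE vD).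
- apply: continuous_in_subspaceT => x; rewrite inE/= in_itv/= => xab.
  exact/cg/(uvD2 n).
Unshelve. all: by end_near. Qed.

(** The integrals of |f| over corresponding exhausting intervals agree, so a
    bound on them, and with it integrability, passes in both directions. *)
Lemma subst_igr : igr D1 (fun x => f (phi x) * dphi x) <-> igr D2 f.
Proof.
have cnf y : D2 y -> {for y, continuous (fun z => `|f z|)}.
  by move=> Dy; apply: cvg_norm; exact: cf.
have cgp x : D1 x -> {for x, continuous (fun x => f (phi x) * dphi x)}.
  move=> Dx; apply: cvgM; last exact: cphi.
  apply: (@continuous_comp _ _ _ phi f); first exact: dv_ct (dphiE Dx).
  exact/cf/phiD.
have E n : \int[mu]_(x in `[phi (u n), phi (v n)]) `|f x| =
    \int[mu]_(x in `[u n, v n]) `|f (phi x) * dphi x|.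
  have [_ _ ->] := subst_compact n cnf; apply: Rint_eq => x; rewrite itv_cc_mem => xi.
  have [_ uvD _] := ex.
  by rewrite normrM (gtr0_norm (phi0 (uvD n x xi))).
split=> h.
- apply: (exh_fatou (M := \int[mu]_(x in D1) `|f (phi x) * dphi x| + 1) mD2 exh_subst).
  + exact: meas_cont.
  + by move=> n; have [] := subst_compact n cf.
  + have /cvgrPdist_le/(_ 1 ltr01) := exh_cvg mD1 ex (igr_norm mD1 h).
    apply: filterS => n; rewrite -E -lerBlDl; apply: le_trans.
    by rewrite distrC ler_norm.
- apply: (exh_fatou (M := \int[mu]_(x in D2) `|f x| + 1) mD1 ex).
  + exact: meas_cont.
  + by move=> n; have [] := subst_compact n cf.
  + have /cvgrPdist_le/(_ 1 ltr01) := exh_cvg mD2 exh_subst (igr_norm mD2 h).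
    apply: filterS => n; rewrite E -lerBlDl; apply: le_trans.
    by rewrite distrC ler_norm.
Qed.

Lemma subst_int : igr D2 f ->
  \int[mu]_(x in D1) (f (phi x) * dphi x) = \int[mu]_(x in D2) f x.
Proof.
move=> h2; have h1 := proj2 subst_igr h2.
have /cvg_lim <- // := exh_cvg mD1 ex h1.
have /cvg_lim <- // := exh_cvg mD2 exh_subst h2.
rewrite (_ : (fun n => \int[mu]_(x in `[u n, v n]) (f (phi x) * dphi x)) =
  (fun n => \int[mu]_(x in `[(phi \o u) n, (phi \o v) n]) f x))//.
by apply/funext => n; have [_ _ ->] := subst_compact n cf.
Qed.

End subst.
End mean_value.


(** * Integrals depending on a parameter; Fubini *)

Section parameter_integrals.
Variable R : realType.
Implicit Types (g h F : R -> R) (x y a b : R) (D : set R).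
Notation mu := (@lebesgue_measure R).
Notation igr D f := (mu.-integrable D (EFin \o f)).

Lemma int_ct D (f : R -> R -> R) g u v a : measurable D -> u < a < v ->
  (forall x, u < x < v -> measurable_fun D (f x)) ->
  (forall x y, u < x < v -> D y -> {for x, continuous (f ^~ y)}) ->
  igr D g -> (forall x y, u < x < v -> D y -> `|f x y| <= g y) ->
  {for a, continuous (fun x => \int[mu]_(y in D) f x y)}.
Proof.
move=> mD ua mf cf ig fg.
apply: (@continuity_under_integral R _ _ mu f D mD u v _ _ g ig) => //.
- move=> x; rewrite /= in_itv/= => xuv; apply: igr_le ig _ => //; first exact: mf.
  by move=> y Dy; exact: fg.
- by apply: aeW => y Dy x /set_mem; rewrite /= in_itv/= => xuv; exact: cf.
- by move=> x; rewrite /= in_itv/= => xuv; apply: aeW => y Dy; exact: fg.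
- by rewrite inE/= in_itv.
Qed.

Lemma int_dv D (f df : R -> R -> R) G u v a : measurable D -> u < a < v ->
  (forall x, u < x < v -> igr D (f x)) ->
  (forall x y, u < x < v -> D y -> dv (f ^~ y) x (df x y)) ->
  igr D G -> (forall x y, u < x < v -> D y -> `|df x y| <= G y) ->
  dv (fun x => \int[mu]_(y in D) f x y) a (\int[mu]_(y in D) df a y).
Proof.
move=> mD ua mf cf ig fg.
have Ia : `]u, v[%classic a by rewrite /= in_itv.
have I1 x : `]u, v[%classic x -> igr D (f x) by rewrite /= in_itv/=; exact: mf.
have I2 x y : `]u, v[%classic x -> D y -> derivable (f ^~ y) x 1.
  by rewrite /= in_itv/= => xuv Dy; have /dv_derive1[] := cf _ _ xuv Dy.
have I3 x y : `]u, v[%classic x -> D y -> `|partial1of2 f x y| <= `|G y|.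
  rewrite /= in_itv/= => xuv Dy; rewrite /partial1of2.
  have /dv_derive1[_ ->] := cf _ _ xuv Dy.
  exact: le_trans (fg _ _ xuv Dy) (ler_norm _).
have iG := igr_norm mD ig.
have d := @derivable_under_integral R _ _ mu f D mD a u v Ia I1 I2 _ (fun y => normr_ge0 (G y)) iG I3.
have e := @differentiation_under_integral R _ _ mu f D mD a u v Ia I1 I2 _ (fun y => normr_ge0 (G y)) iG I3.
apply: DeriveDef => //; rewrite -derive1E e.
apply: Rint_eq => y Dy; rewrite /partial1of2.
by have /dv_derive1[_ ->] := cf _ _ ua Dy.
Qed.

Lemma int_cvg_right D (f : R -> R -> R) l g a b : measurable D -> a < b ->
  (forall x, a < x < b -> measurable_fun D (f x)) ->
  (forall y, D y -> f x y @[x --> a^'+] --> l y) ->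
  igr D g -> (forall x y, a < x < b -> D y -> `|f x y| <= g y) ->
  \int[mu]_(y in D) f x y @[x --> a^'+] --> \int[mu]_(y in D) l y.
Proof.
move=> mD ab mf fl ig fg; apply/cvg_at_rightP => u [ua uca].
have nu : \forall n \near \oo, u n < b by exact: (cvgr_lt a).
have [N _ HN] := nu.
rewrite -(cvg_shiftn N).
apply: (proj2 (@Rdct R D (fun n => f (u (n + N)%N)) l g mD _ _ ig _)).
- by move=> n; apply: mf; rewrite ua HN//= leq_addl.
- move=> y Dy; rewrite (cvg_shiftn N (fun n => f (u n) y)).
  by have /cvg_at_rightP := fl y Dy; apply.
- by apply: nearW => n y Dy; apply: fg => //; rewrite ua HN//= leq_addl.
Qed.

Lemma int_cvg_pinfty D (f : R -> R -> R) l g a : measurable D ->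
  (forall x, a < x -> measurable_fun D (f x)) ->
  (forall y, D y -> f x y @[x --> +oo] --> l y) ->
  igr D g -> (forall x y, a < x -> D y -> `|f x y| <= g y) ->
  \int[mu]_(y in D) f x y @[x --> +oo] --> \int[mu]_(y in D) l y.
Proof.
move=> mD mf fl ig fg; apply/cvg_pinftyP => u uy.
have nu : \forall n \near \oo, a < u n by move/cvgryPgt : uy; apply.
have [N _ HN] := nu.
rewrite -(cvg_shiftn N).
apply: (proj2 (@Rdct R D (fun n => f (u (n + N)%N)) l g mD _ _ ig _)).
- by move=> n; apply: mf; rewrite HN//= leq_addl.
- move=> y Dy; rewrite (cvg_shiftn N (fun n => f (u n) y)).
  by have /cvg_pinftyP := fl y Dy; apply.
- by apply: nearW => n y Dy; apply: fg => //; rewrite HN//= leq_addl.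
Qed.

(** The two-variable integrand extended by 0, so that measurability is asked
    of a function on the whole plane. *)
Definition patch2 D1 D2 (f : R -> R -> R) : R * R -> R :=
  (fun z => f z.1 z.2) \_ (D1 `*` D2).

Lemma patch2E0 D1 D2 f x y : D1 x -> D2 y -> patch2 D1 D2 f (x, y) = f x y.
Proof. by move=> Dx Dy; rewrite /patch2 patchE mem_set. Qed.

Lemma patch2E1 D1 D2 f x y : ~ D1 x -> patch2 D1 D2 f (x, y) = 0.
Proof. by move=> Dx; rewrite /patch2 patchE memNset//= => -[]. Qed.

Lemma patch2E2 D1 D2 f x y : ~ D2 y -> patch2 D1 D2 f (x, y) = 0.
Proof. by move=> Dx; rewrite /patch2 patchE memNset//= => -[]. Qed.

Lemma fubini_R D1 D2 (f : R -> R -> R) g : measurable D1 -> measurable D2 ->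
  measurable_fun setT (patch2 D1 D2 f) ->
  (forall x, D1 x -> igr D2 (f x)) -> (forall y, D2 y -> igr D1 (f ^~ y)) ->
  igr D1 g -> (forall x, D1 x -> \int[mu]_(y in D2) `|f x y| <= g x) ->
  [/\ igr D1 (fun x => \int[mu]_(y in D2) f x y),
      igr D2 (fun y => \int[mu]_(x in D1) f x y) &
   \int[mu]_(x in D1) \int[mu]_(y in D2) f x y =
   \int[mu]_(y in D2) \int[mu]_(x in D1) f x y].
Proof.
move=> mD1 mD2 mf i2 i1 ig fg.
pose F : measurableTypeR R * measurableTypeR R -> \bar R := EFin \o patch2 D1 D2 f.
have mF : measurable_fun setT F by apply/measurable_EFinP.
have mT : measurable [set: R] by exact: measurableT.
pose H1 x := \int[mu]_(y in D2) f x y.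
pose H2 y := \int[mu]_(x in D1) f x y.
have E1 x : (\int[mu]_y F (x, y))%E = ((H1 \_ D1) x)%:E.
  have [Dx|Dx] := pselect (D1 x); last first.
    rewrite patchE1//; apply: integral0_eq => y _.
    by rewrite /F /= patch2E1.
  rewrite patchE0// /H1 -igr_fin//; last exact: i2.
  rewrite [RHS]integral_mkcond; apply: eq_integral => y _; rewrite /F/= patchE.
  case: ifPn => [/set_mem|/negP] Dy; first by rewrite patch2E0.
  by rewrite patch2E2// => /mem_set.
have E2 y : (\int[mu]_x F (x, y))%E = ((H2 \_ D2) y)%:E.
  have [Dy|Dy] := pselect (D2 y); last first.
    rewrite patchE1//; apply: integral0_eq => x _.
    by rewrite /F /= patch2E2.
  rewrite patchE0// /H2 -igr_fin//; last exact: i1.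
  rewrite [RHS]integral_mkcond; apply: eq_integral => x _; rewrite /F/= patchE.
  case: ifPn => [/set_mem|/negP] Dx; first by rewrite patch2E0.
  by rewrite patch2E1// => /mem_set.
have iF : (mu \x mu)%E.-integrable setT F.
  apply/(integrable12ltyP mu mu mF).
  have [mg glt] := integrableP _ _ _ ig.
  apply: le_lt_trans glt.
  rewrite [leRHS]integral_mkcond; apply: ge0_le_integral => //.
  - by move=> x _; apply: integral_ge0.
  - have mF' : measurable_fun setT (abse \o F) by exact: measurableT_comp.
    have F0 z : (0%R <= (abse \o F) z)%E by exact: abse_ge0.
    exact: (@measurable_fun_fubini_tonelli_F _ _ _ _ _ mu (abse \o F) mF' F0).
  - apply/(measurable_restrictT _ mD1); exact: measurableT_comp.
  move=> x _; have [Dx|Dx] := pselect (D1 x); last first.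
    rewrite [leLHS]integral0_eq; first by rewrite patchE; case: ifP.
    by move=> y _; rewrite /F /= patch2E1// normr0.
  rewrite patchE mem_set//=.
  apply: (@le_trans _ _ (\int[mu]_(y in D2) `|f x y|)%R%:E).
    rewrite -igr_fin//; last by apply: igr_norm => //; exact: i2.
    rewrite [leRHS]integral_mkcond le_eqVlt; apply/orP; left; apply/eqP.
    apply: eq_integral => y _; rewrite /F/= patchE.
    case: ifPn => [/set_mem|/negP] Dy; first by rewrite patch2E0.
    by rewrite patch2E2// ?normr0// => /mem_set.
  by rewrite lee_fin; apply: le_trans (fg x Dx) (ler_norm _).
have J1 : igr D1 (fun x => \int[mu]_(y in D2) f x y).
  have := integrable_fubini_F iF.
  rewrite /fubini_F (_ : (fun x => _) = EFin \o (H1 \_ D1)).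
    by rewrite -restrict_EFin => /(proj2 (@integrable_mkcond _ _ _ mu D1 (EFin \o H1) mD1)).
  by apply/funext => x; rewrite E1.
have J2 : igr D2 (fun y => \int[mu]_(x in D1) f x y).
  apply: (proj2 (@integrable_mkcond _ _ _ mu D2 (EFin \o H2) mD2)).
  rewrite restrict_EFin.
  have -> : EFin \o (H2 \_ D2) = fubini_G mu F by apply/funext => y; rewrite /fubini_G E2.
  apply/integrableP; split; first exact: (measurable_fubini_G iF).
  apply: le_lt_trans (proj1 (integrable21ltyP mu mu mF) iF).
  apply: ge0_le_integral => //.
  - apply: measurableT_comp => //; exact: (measurable_fubini_G iF).
  - have mF' : measurable_fun setT (abse \o F) by exact: measurableT_comp.
    have F0 z : (0%R <= (abse \o F) z)%E by exact: abse_ge0.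
    exact: (@measurable_fun_fubini_tonelli_G _ _ _ _ _ mu (abse \o F) mF' F0).
  - move=> y _; apply: le_abse_integral => //.
    exact: (measurableT_comp mF (measurable_pair2 y)).
split=> //.
have := Fubini iF.
under eq_integral do rewrite E1; under [in X in _ = X]eq_integral do rewrite E2.
move=> /(congr1 fine) E.
change (\int[mu]_(x in D1) H1 x = \int[mu]_(x in D2) H2 x).
by rewrite (Rintegral_mkcond mu D1 H1) (Rintegral_mkcond mu D2 H2); exact: E.
Qed.


End parameter_integrals.


(** * The fundamental theorem of calculus on intervals *)

Section ftc_intervals.
Variable R : realType.
Implicit Types (g h F : R -> R) (x y a b : R) (D : set R).
Notation mu := (@lebesgue_measure R).
Notation igr D f := (mu.-integrable D (EFin \o f)).

(** A separately continuous function is the limit of functions that are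
    piecewise constant in one variable (Caratheodory), hence jointly
    measurable; joint continuity would be tedious to check in the uses below.
    *)
Lemma sepcont_meas D1 D2 (f : R -> R -> R) : open D1 -> open D2 ->
  (forall x y, D1 x -> D2 y -> {for y, continuous (f x)}) ->
  (forall x y, D1 x -> D2 y -> {for x, continuous (f ^~ y)}) ->
  measurable_fun setT (patch2 D1 D2 f).
Proof.
move=> oD1 oD2 c2 c1.
have mD1 : measurable D1 by exact: open_measurable.
have mD2 : measurable D2 by exact: open_measurable.
have mT : measurable [set: R] by exact: measurableT.
pose G := patch2 D1 D2 f.
have mG x : measurable_fun setT (fun y => G (x, y)).
  have [Dx|Dx] := pselect (D1 x); last first.
    rewrite (_ : (fun y => _) = cst 0); first exact: measurable_cst.
    by apply/funext => y; rewrite /G patch2E1.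
  rewrite (_ : (fun y => _) = (f x) \_ D2).
    apply/(measurable_restrictT _ mD2); apply: meas_cont => // y Dy.
    exact: c2.
  apply/funext => y; have [Dy|Dy] := pselect (D2 y).
    by rewrite /G patch2E0// patchE0.
  by rewrite /G patch2E2// patchE1.
pose q (n : nat) (x : R) : R := (Num.floor (n.+1%:R * x))%:~R / n.+1%:R.
have qcvg x : q n x @[n --> \oo] --> x.
  apply/cvgrPdist_le => e e0; near=> n.
  have n0 : 0 < n.+1%:R :> R by rewrite ltr0n.
  have /andP[fl fu] := floor_itv (n.+1%:R * x).
  have -> : x - q n x = (n.+1%:R * x - (Num.floor (n.+1%:R * x))%:~R) / n.+1%:R.
    by rewrite /q mulrBl mulrAC divff ?mul1r// pnatr_eq0.
  rewrite ger0_norm; last by rewrite divr_ge0// subr_ge0.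
  rewrite ler_pdivrMr//; apply: (@le_trans _ _ 1).
    by rewrite lerBlDr addrC; move: fu; rewrite intrD => /ltW.
  rewrite -ler_pdivrMl// mulr1; apply: ltW.
  near: n; exists (Num.truncn e^-1) => // n /= hn.
  by rewrite (lt_le_trans (truncnS_gt _))// ler_nat ltnS.
pose H n (z : R * R) := (\1_D1 z.1 : R) * G (q n z.1, z.2).
have mH n : measurable_fun setT (H n).
  apply: measurable_funM.
    have mi : measurable_fun setT (\1_D1 : R -> R) by exact: measurable_indic.
    exact: (measurableT_comp mi measurable_fst).
  move=> _ B mB; rewrite setTI.
  rewrite (_ : _ @^-1` B = \bigcup_(k : int)
    ([set x | Num.floor (n.+1%:R * x) = k] `*` ((fun y => G (k%:~R / n.+1%:R, y)) @^-1` B))).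
    apply: countable_bigcupT_measurable; first exact: countableP.
    move=> k; apply: measurableX.
      rewrite (_ : [set x | _] = `[k%:~R / n.+1%:R, (k + 1)%:~R / n.+1%:R[%classic).
        exact: measurable_itv.
      apply/seteqP; split=> x /=; rewrite in_itv/= ler_pdivrMr ?ltr0n// ltr_pdivlMr ?ltr0n//.
        by move=> <-; rewrite mulrC floor_itv.
      by rewrite mulrC => /floor_def.
    by rewrite -[_ @^-1` _]setTI; exact: mG.
  apply/seteqP; split=> [[x y] /= Bxy|[x y] [k _ [/= <- ]]] //.
  by exists (Num.floor (n.+1%:R * x)).
apply: (measurable_fun_cvg mH) => -[x y] _.
have [Dx|Dx] := pselect (D1 x); last first.
  apply: cvg_near_cst; apply: nearW => n; apply/eqP.
  by rewrite /H/= /patch2 !patchE indicE !memNset ?mul0r// => -[].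
rewrite /H/= indicE mem_set// (_ : (1 : nat)%:R = 1 :> R)//.
under eq_fun do rewrite mul1r.
have [Dy|Dy] := pselect (D2 y); last first.
  by under eq_fun do rewrite /G patch2E2//; rewrite patch2E2//; exact: cvg_cst.
rewrite patch2E0//.
have nD : \forall n \near \oo, D1 (q n x) by apply: (qcvg x); exact: open_nbhs_nbhs.
apply: (@cvg_trans _ (f (q n x) y @[n --> \oo])).
  by apply: near_eq_cvg; near=> n; rewrite /G patch2E0//; near: n; exact: nD.
exact: (cvg_comp (fun n => q n x) (f ^~ y) (qcvg x) (c1 _ _ Dx Dy)).
Unshelve. all: by end_near. Qed.

Lemma in_posE x : `]0, +oo[%classic x = (0 < x) :> Prop.
Proof. by rewrite /= in_itv/= andbT. Qed.
Lemma ooE a b x : `]a, b[%classic x = (a < x < b) :> Prop.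
Proof. by rewrite /= in_itv/=. Qed.

Lemma open_pos : open (`]0, +oo[%classic : set R).
Proof. exact: interval_open. Qed.
Lemma open_oo a b : open (`]a, b[%classic : set R).
Proof. exact: interval_open. Qed.

Lemma cvg_natSr k : ((n + k).+1%:R : R) @[n --> \oo] --> +oo.
Proof.
apply/cvgryPge => A; exists (Num.truncn A) => // n /= hn.
apply: ltW; apply: (lt_le_trans (truncnS_gt A)).
by rewrite ler_nat ltnS (leq_trans hn)// leq_addr.
Qed.

Lemma cvg_invSr k : ((n + k).+1%:R^-1 : R) @[n --> \oo] --> 0.
Proof.
by apply/gtr0_cvgV0; [by apply: nearW => n; rewrite ltr0n | exact: cvg_natSr].
Qed.

Lemma exh_pos : exh `]0, +oo[ (fun n => (n + 1).+1%:R^-1 : R) (fun n => (n + 1).+1%:R).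
Proof.
split.
- move=> n; apply: (@lt_trans _ _ 1); last by rewrite ltr1n addn1.
  by rewrite invf_lt1 ?ltr0n// ltr1n addn1.
- by move=> n x /andP[nx _]; rewrite in_posE; apply: lt_le_trans nx; rewrite invr_gt0 ltr0n.
- move=> x; rewrite in_posE => x0; near=> n; apply/andP; split; near: n.
  + exact: (cvgr_le 0 (cvg_invSr 1)).
  + by have /cvgryPge := @cvg_natSr 1; apply.
Unshelve. all: by end_near. Qed.

Lemma exh_T : exh setT (fun n => - (n + 0).+1%:R : R) (fun n => (n + 0).+1%:R).
Proof.
split=> // [n|x _].
- by apply: (@lt_trans _ _ 0); rewrite ?oppr_lt0 ltr0n.
- near=> n; apply/andP; split; [rewrite lerNl|]; near: n.
  + by have /cvgryPge := @cvg_natSr 0; apply.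
  + by have /cvgryPge := @cvg_natSr 0; apply.
Unshelve. all: by end_near. Qed.

Lemma cvg_to_left a b : (a + (b - a) * (n + 2).+1%:R^-1) @[n --> \oo] --> a.
Proof.
rewrite -[X in _ --> X]addr0 -(mulr0 (b - a)).
by apply: cvgD; [exact: cvg_cst|apply: cvgMr; exact: cvg_invSr].
Qed.

Lemma cvg_to_right a b : (b - (b - a) * (n + 2).+1%:R^-1) @[n --> \oo] --> b.
Proof.
rewrite -[X in _ --> X]subr0 -(mulr0 (b - a)).
by apply: cvgB; [exact: cvg_cst|apply: cvgMr; exact: cvg_invSr].
Qed.

Lemma exh_oo a b : a < b -> exh `]a, b[ (fun n => a + (b - a) * (n + 2).+1%:R^-1)
   (fun n => b - (b - a) * (n + 2).+1%:R^-1).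
Proof.
move=> ab; have ba : 0 < b - a by rewrite subr_gt0.
have e0 n : 0 < (n + 2).+1%:R^-1 :> R by rewrite invr_gt0 ltr0n.
have e1 n : (n + 2).+1%:R^-1 < 2^-1 :> R.
  by rewrite ltf_pV2 ?posrE ?ltr0n// ltr_nat addn2.
split.
- by move=> n; have := e1 n; have := e0 n; set e := _^-1; nra.
- move=> n x /andP[h1 h2]; rewrite ooE; have := e1 n; have := e0 n.
  move: h1 h2; set e := _^-1 => h1 h2 e0' e1'.
  apply/andP; split.
    by apply: lt_le_trans h1; rewrite ltrDl mulr_gt0.
  by apply: le_lt_trans h2 _; rewrite ltrBlDr ltrDl mulr_gt0.
- move=> x; rewrite ooE => /andP[ax xb]; near=> n; apply/andP; split; near: n.
  + exact: (cvgr_le a (@cvg_to_left a b) x ax).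
  + exact: (cvgr_ge b (@cvg_to_right a b) x xb).
Unshelve. all: by end_near. Qed.

Lemma ftc_pos f F l0 l1 : (forall x, 0 < x -> dv F x (f x)) ->
  (forall x, 0 < x -> {for x, continuous f}) ->
  F x @[x --> 0^'+] --> l0 -> F x @[x --> +oo] --> l1 ->
  igr `]0, +oo[ f -> \int[mu]_(x in `]0, +oo[) f x = l1 - l0.
Proof.
move=> dF cf F0 F1 h.
apply: (ftc_igr (measurable_itv _) exh_pos (F := F)) => //.
- by move=> x; rewrite in_posE; exact: dF.
- by move=> x; rewrite in_posE; exact: cf.
- move/cvg_at_rightP : F0; apply; split; last exact: cvg_invSr.
  by move=> n; rewrite invr_gt0 ltr0n.
- by move/cvg_pinftyP : F1; apply; exact: cvg_natSr.
Qed.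

Lemma ftc_pos_ge0 f F l0 l1 : (forall x, 0 < x -> dv F x (f x)) ->
  (forall x, 0 < x -> {for x, continuous f}) -> (forall x, 0 < x -> 0 <= f x) ->
  F x @[x --> 0^'+] --> l0 -> F x @[x --> +oo] --> l1 ->
  igr `]0, +oo[ f /\ \int[mu]_(x in `]0, +oo[) f x = l1 - l0.
Proof.
move=> dF cf f0 F0 F1.
apply: (ftc_ge0 (measurable_itv _) exh_pos (F := F)) => //.
- by move=> x; rewrite in_posE; exact: dF.
- by apply: meas_cont; [exact: open_pos|move=> x; rewrite in_posE; exact: cf].
- by move=> x; rewrite in_posE; exact: cf.
- by move=> x; rewrite in_posE; exact: f0.
- move/cvg_at_rightP : F0; apply; split; last exact: cvg_invSr.
  by move=> n; rewrite invr_gt0 ltr0n.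
- by move/cvg_pinftyP : F1; apply; exact: cvg_natSr.
Qed.

Lemma ftc_oo f F a b l0 l1 : a < b -> (forall x, a < x < b -> dv F x (f x)) ->
  (forall x, a < x < b -> {for x, continuous f}) ->
  F x @[x --> a^'+] --> l0 -> F x @[x --> b^'-] --> l1 ->
  igr `]a, b[ f -> \int[mu]_(x in `]a, b[) f x = l1 - l0.
Proof.
move=> ab dF cf F0 F1 h.
apply: (ftc_igr (measurable_itv _) (exh_oo ab) (F := F)) => //.
- move/cvg_at_rightP : F0; apply; split; last exact: cvg_to_left.
  by move=> n; rewrite ltrDl mulr_gt0 ?subr_gt0// invr_gt0 ltr0n.
- move/cvg_at_leftP : F1; apply; split; last exact: cvg_to_right.
  by move=> n; rewrite ltrBlDr ltrDl mulr_gt0 ?subr_gt0// invr_gt0 ltr0n.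
Qed.

Lemma ftc_oo_ge0 f F a b l0 l1 : a < b -> (forall x, a < x < b -> dv F x (f x)) ->
  (forall x, a < x < b -> {for x, continuous f}) ->
  (forall x, a < x < b -> 0 <= f x) ->
  F x @[x --> a^'+] --> l0 -> F x @[x --> b^'-] --> l1 ->
  igr `]a, b[ f /\ \int[mu]_(x in `]a, b[) f x = l1 - l0.
Proof.
move=> ab dF cf f0 F0 F1.
apply: (ftc_ge0 (measurable_itv _) (exh_oo ab) (F := F)) => //.
- by apply: meas_cont; [exact: open_oo|exact: cf].
- move/cvg_at_rightP : F0; apply; split; last exact: cvg_to_left.
  by move=> n; rewrite ltrDl mulr_gt0 ?subr_gt0// invr_gt0 ltr0n.
- move/cvg_at_leftP : F1; apply; split; last exact: cvg_to_right.
  by move=> n; rewrite ltrBlDr ltrDl mulr_gt0 ?subr_gt0// invr_gt0 ltr0n.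
Qed.

Lemma ftc_T f F l0 l1 : (forall x, dv F x (f x)) ->
  (forall x, {for x, continuous f}) ->
  F x @[x --> -oo] --> l0 -> F x @[x --> +oo] --> l1 ->
  igr setT f -> \int[mu]_x f x = l1 - l0.
Proof.
move=> dF cf F0 F1 h.
apply: (ftc_igr measurableT exh_T (F := F)) => //.
- by move/cvg_ninftyP : F0; apply; apply/(cvgNrNy (fun n => (n + 0).+1%:R)); exact: cvg_natSr.
- by move/cvg_pinftyP : F1; apply; exact: cvg_natSr.
Qed.

Lemma ftc_T_ge0 f F l0 l1 : (forall x, dv F x (f x)) ->
  (forall x, {for x, continuous f}) -> (forall x, 0 <= f x) ->
  F x @[x --> -oo] --> l0 -> F x @[x --> +oo] --> l1 ->
  igr setT f /\ \int[mu]_x f x = l1 - l0.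
Proof.
move=> dF cf f0 F0 F1.
apply: (ftc_ge0 measurableT exh_T (F := F)) => //.
- by apply: meas_cont => //; exact: openT.
- by move/cvg_ninftyP : F0; apply; apply/(cvgNrNy (fun n => (n + 0).+1%:R)); exact: cvg_natSr.
- by move/cvg_pinftyP : F1; apply; exact: cvg_natSr.
Qed.

End ftc_intervals.


(** * The derivatives of the Airy function on a rotated ray *)

Section airy_ray.
Variable R : realType.
Implicit Types (g h F : R -> R) (x y a b r : R) (D : set R).
Notation mu := (@lebesgue_measure R).
Notation igr D f := (mu.-integrable D (EFin \o f)).
Notation pos := (`]0, +oo[%classic : set R).

Lemma mpos : measurable pos. Proof. exact: measurable_itv. Qed.

Lemma le_cvg0 (T : Type) (FF : set_system T) {FFF : Filter FF} (f g : T -> R) :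
  (\forall x \near FF, `|f x| <= g x) -> g x @[x --> FF] --> 0 -> f x @[x --> FF] --> 0.
Proof.
move=> fg g0; apply/cvgr0Pnorm_le => e e0.
have /cvgr0Pnorm_le/(_ e e0) := g0; apply: filterS2 fg => x fx gx.
exact: (le_trans fx (le_trans (ler_norm _) gx)).
Qed.

Lemma pow_le_exp k r : 0 <= r -> r ^+ k <= k`!%:R * expR r.
Proof.
move=> r0; case: k => [|k]; first by rewrite expr0 fact0 mul1r -[leLHS]expR0 ler_expR.
have := expR_ge1Dxn k r0; set z := k.+1`!%:R => H.
have z0 : 0 < z by rewrite /z ltr0n fact_gt0.
have : r ^+ k.+1 / z <= expR r by apply: le_trans H; rewrite lerDr.
by rewrite ler_pdivrMr// mulrC.
Qed.

Lemma pow_exp_bound k x : exists2 M, 0 <= M &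
  forall r, 0 <= r -> r ^+ k * expR (- r ^+ 3 / 3 + x * r) <= M * expR (- r).
Proof.
pose X := `|x| + 2; exists (k`!%:R * expR (3 * X ^+ 2)); first by rewrite mulr_ge0 ?ler0n ?expR_ge0.
move=> r r0; apply: (@le_trans _ _ (k`!%:R * expR r * expR (- r ^+ 3 / 3 + x * r))).
  by rewrite ler_wpM2r ?expR_ge0// pow_le_exp.
rewrite -!mulrA ler_wpM2l ?ler0n// -!expRD ler_expR.
have X2 : 2 <= X by rewrite /X lerDr.
have xX : x * r <= (X - 2) * r by rewrite ler_wpM2r// /X addrK ler_norm.
have [h|h] := leP r (3 * X).
  have : 0 <= X * (3 * X - r) by apply: mulr_ge0; lra.
  have : 0 <= r ^+ 3 by rewrite exprn_ge0.
  move: xX X2; nra.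
have : 3 * X * (3 * X) * r <= r ^+ 3.
  have -> : r ^+ 3 = r * r * r by ring.
  apply: ler_wpM2r => //; apply: ler_pM => //; lra.
nra.
Qed.

Lemma cvg_expN : expR (- x) @[x --> +oo] --> (0 : R).
Proof. exact: cvgr_expR. Qed.

Lemma ct_right F a : {for a, continuous F} -> F x @[x --> a^'+] --> F a.
Proof. by move=> ?; apply: cvg_at_right_filter. Qed.

Lemma igr_expN : igr pos (fun r => expR (- r)) /\ \int[mu]_(r in pos) expR (- r) = 1.
Proof.
have [|||||] := @ftc_pos_ge0 R (fun r => expR (- r)) (fun r => - expR (- r)) (-1) 0.
- by move=> x _; dvs; ring.
- move=> x _; apply: dv_ct; dvs; reflexivity.
- by move=> x _; exact: expR_ge0.
- rewrite -[X in - X]expR0 -{2}oppr0; apply: ct_right; apply: dv_ct; dvs; reflexivity.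
- by rewrite -oppr0; apply: cvgN; exact: cvg_expN.
- by move=> -> ->; split => //; ring.
Qed.

Lemma igr_dom M : igr pos (fun r => M * expR (- r)).
Proof. by apply: igrZ; [exact: mpos|exact: (proj1 igr_expN)]. Qed.

Lemma cos_pi3 : cos (pi / 3) = 2^-1 :> R.
Proof.
have pi0 := pi_gt0 R.
have c0 : 0 < cos (pi / 3 : R) by apply: cos_gt0_pihalf; apply/andP; split; lra.
have E : cos (pi / 3 + (pi / 3 + pi / 3)) = -1 :> R by rewrite -cospi; congr cos; lra.
rewrite cosD (cosD (pi / 3) (pi / 3)) (sinD (pi / 3) (pi / 3)) in E.
have := @cos2Dsin2 R (pi / 3); move: E c0.
set c := cos _; set s := sin _ => E c0 S.
have : (c + 1) * (2 * c - 1) ^+ 2 = 0.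
  have s2 : s ^+ 2 = 1 - c ^+ 2 by lra.
  have : c * (c * c - s ^+ 2) - 2 * c * s ^+ 2 = -1 by rewrite -E; ring.
  rewrite s2 => H.
  have -> : (c + 1) * (2 * c - 1) ^+ 2 = c * (c * c - (1 - c ^+ 2)) - 2 * c * (1 - c ^+ 2) + 1 by ring.
  by rewrite H; ring.
move=> /eqP; rewrite mulf_eq0 expf_eq0/= => /orP[/eqP|/eqP]; lra.
Qed.

Definition bb : R := Num.sqrt 3 / 2.

Lemma bb_sq : bb ^+ 2 = 3 / 4.
Proof. by rewrite /bb exprMn sqr_sqrtr ?ler0n//; field. Qed.
Lemma bb_gt0 : 0 < bb.
Proof. by rewrite /bb divr_gt0 ?sqrtr_gt0 ?ltr0n. Qed.

Lemma sin_pi3 : sin (pi / 3) = bb.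
Proof.
have pi0 := pi_gt0 R.
have s0 : 0 < sin (pi / 3 : R) by apply: sin_gt0_pihalf; apply/andP; split; lra.
have := @cos2Dsin2 R (pi / 3); rewrite cos_pi3 => H.
have := bb_sq; have := bb_gt0 => b0 b2.
have : (sin (pi / 3) - bb) * (sin (pi / 3) + bb) = 0.
  have -> : (sin (pi / 3) - bb) * (sin (pi / 3) + bb) = sin (pi / 3) ^+ 2 - bb ^+ 2 by ring.
  by rewrite b2; lra.
by move=> /eqP; rewrite mulf_eq0 => /orP[/eqP|/eqP]; lra.
Qed.

Lemma cosD2pi3 y : cos (y + 2 * pi / 3) = - 2^-1 * cos y - bb * sin y.
Proof.
have -> : y + 2 * pi / 3 = (y - pi / 3) + pi by field.
rewrite cosDpi cosB cos_pi3 sin_pi3; ring.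
Qed.

Definition ph (k : nat) : R := pi / 6 + k%:R * (2 * pi / 3).

Definition Aint (k : nat) x r : R :=
  r ^+ k * expR (- r ^+ 3 / 3 - x * r / 2) * cos (bb * x * r + ph k).

(** The k-th derivative of Ai, from the contour integral along the ray of
    argument pi/6, where the cubic phase becomes the decay exp(-r^3/3). *)
Definition AA (k : nat) x : R := pi^-1 * \int[mu]_(r in pos) Aint k x r.

Lemma Aint_le k x r : 0 <= r -> `|Aint k x r| <= r ^+ k * expR (- r ^+ 3 / 3 - x * r / 2).
Proof.
move=> r0; have e0 : 0 <= r ^+ k * expR (- r ^+ 3 / 3 - x * r / 2).
  by rewrite mulr_ge0 ?expR_ge0// exprn_ge0.
by rewrite /Aint normrM (ger0_norm e0) ler_piMr ?cos_max.
Qed.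

Lemma Aint_ct k x r : {for r, continuous (Aint k x)}.
Proof. by apply: dv_ct; rewrite /Aint; dvs; reflexivity. Qed.

Lemma Aint_meas k x : measurable_fun pos (Aint k x).
Proof. by apply: meas_cont; [exact: open_pos|move=> r _; exact: Aint_ct]. Qed.

Lemma Aint_dom k X : exists M, forall x r, `|x| <= X -> 0 <= r ->
  `|Aint k x r| <= M * expR (- r).
Proof.
have [M M0 HM] := pow_exp_bound k (X / 2); exists M => x r xX r0.
apply: le_trans (Aint_le k x r0) (le_trans _ (HM r r0)).
rewrite ler_wpM2l ?exprn_ge0// ler_expR lerD2l.
by move: xX; rewrite ler_norml => /andP[h1 h2]; nra.
Qed.

Lemma Aint_igr k x : igr pos (Aint k x).
Proof.
have [M HM] := Aint_dom k `|x|.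
apply: (igr_le mpos (Aint_meas k x) (igr_dom M)) => r; rewrite in_posE => r0.
by apply: HM => //; exact: ltW.
Qed.

Lemma AA_dv k x : dv (AA k) x (AA k.+1 x).
Proof.
have [M HM] := Aint_dom k.+1 (`|x| + 1).
apply: (dv_eq (dvM (dv_cst pi^-1 x) (_ : dv _ x (\int[mu]_(r in pos) Aint k.+1 x r)))).
  apply: (@int_dv R pos (fun x => Aint k x) (fun x => Aint k.+1 x) (fun r => M * expR (- r)) (x - 1) (x + 1)).
  - exact: mpos.
  - by apply/andP; split; lra.
  - by move=> z _; exact: Aint_igr.
  - move=> z r _ _; rewrite /Aint; dvs.
    rewrite (_ : bb * z * r + ph k.+1 = bb * z * r + ph k + 2 * pi / 3); last first.
      by rewrite /ph -natr1; ring.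
    by rewrite cosD2pi3 /= (exprSr _ k); field.
  - exact: igr_dom.
  - move=> z r /andP[z1 z2]; rewrite in_posE => r0; apply: HM; last exact: ltW.
    have : `|z - x| <= 1 by rewrite ler_norml; apply/andP; split; lra.
    have := ler_normD (z - x) x; rewrite subrK; lra.
by rewrite /AA; ring.
Qed.

End airy_ray.


(** * The Airy equation and decay *)

Section airy_equation.
Variable R : realType.
Implicit Types (g h F : R -> R) (x y a b r : R) (D : set R).
Notation mu := (@lebesgue_measure R).
Notation igr D f := (mu.-integrable D (EFin \o f)).
Notation pos := (`]0, +oo[%classic : set R).
Notation b3 := (bb R).

Lemma ctM g h x : {for x, continuous g} -> {for x, continuous h} ->
  {for x, continuous (fun y => g y * h y)}.
Proof. by move=> cg ch; exact: cvgM. Qed.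
Lemma ctD g h x : {for x, continuous g} -> {for x, continuous h} ->
  {for x, continuous (fun y => g y + h y)}.
Proof. by move=> cg ch; exact: cvgD. Qed.
Lemma ct_cst (c : R) x : {for x, continuous (fun=> c : R)}.
Proof. exact: cvg_cst. Qed.
Lemma ct_norm g x : {for x, continuous g} -> {for x, continuous (fun y => `|g y|)}.
Proof. by move=> cg; exact: cvg_norm. Qed.
Lemma ct_comp g h x : {for h x, continuous g} -> {for x, continuous h} ->
  {for x, continuous (fun y => g (h y))}.
Proof. by move=> cg ch; exact: continuous_comp. Qed.

Lemma dv_uniq F x a b : dv F x a -> dv F x b -> a = b.
Proof. by move=> /dv_derive1[_ <-] /dv_derive1[_ <-]. Qed.

Lemma AA_ct k x : {for x, continuous (AA k)}.
Proof. exact: dv_ct (AA_dv k x). Qed.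

(** The Airy equation: the integrand of x * AA 0 x - AA 2 x is the derivative
    of an explicit function that vanishes at both ends of the ray. *)
Lemma AA2 x : AA 2 x = x * AA 0 x.
Proof.
pose F r := expR (- r ^+ 3 / 3 - x * r / 2) * sin (b3 * x * r).
have pi0 := pi_gt0 R.
have dF r : dv F r (x * Aint 0 x r - Aint 2 x r).
  rewrite /F /Aint; dvs.
  have -> : b3 * x * r + ph R 2 = (b3 * x * r + pi / 2) + pi by rewrite /ph; field.
  have -> : b3 * x * r + ph R 0 = pi / 2 + (b3 * x * r - pi / 3) by rewrite /ph mul0r; field.
  rewrite (addrC (pi / 2)) cosDpi !cosDpihalf sinB cos_pi3 sin_pi3 expr0.
  by field.
have ctd r : {for r, continuous (fun r => x * Aint 0 x r - Aint 2 x r)}.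
  by apply: cvgB; [apply: cvgM; [exact: cvg_cst|exact: Aint_ct]|exact: Aint_ct].
have : \int[mu]_(r in pos) (x * Aint 0 x r - Aint 2 x r) = 0 - 0.
  apply: (@ftc_pos R _ F) => //.
  - rewrite [X in _ --> X](_ : _ = F 0); last by rewrite /F !mulr0 sin0 mulr0.
    by apply: ct_right; exact: dv_ct (dF 0).
  - have [M M0 HM] := pow_exp_bound 0 (- x / 2).
    apply: (@le_cvg0 _ _ _ _ _ (fun r => M * expR (- r))); last first.
      by rewrite -(mulr0 M); apply: cvgM; [exact: cvg_cst|exact: cvg_expN].
    near=> r; have r0 : 0 <= r by near: r; exact: nbhs_pinfty_ge.
    rewrite /F normrM ger0_norm ?expR_ge0//.
    apply: (@le_trans _ _ (expR (- r ^+ 3 / 3 - x * r / 2))).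
      by rewrite ler_piMr ?expR_ge0// sin_max.
    have := HM r r0; rewrite expr0 mul1r; apply: le_trans.
    by rewrite ler_expR; lra.
  - by apply: igrB; [exact: mpos|apply: igrZ; [exact: mpos|]|]; exact: Aint_igr.
rewrite RintB; [|exact: mpos|by apply: igrZ; [exact: mpos|exact: Aint_igr]|exact: Aint_igr].
rewrite RintZ; [|exact: mpos|exact: Aint_igr].
rewrite subr0 => /eqP; rewrite subr_eq0 => /eqP E.
by rewrite /AA -E; ring.
Unshelve. all: by end_near. Qed.

(** The Airy equation differentiated k times. *)
Lemma AA_rec k x : AA k.+2 x = x * AA k x + k%:R * AA k.-1 x.
Proof.
elim: k x => [|k IH] x; first by rewrite AA2 mul0r addr0.
apply: (@dv_uniq (AA k.+2) x); first exact: AA_dv.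
rewrite (_ : AA k.+2 = fun x => x * AA k x + k%:R * AA k.-1 x); last exact/funext.
apply: (dv_eq (dvD (dvM (dv_id x) (AA_dv k x)) (dvM (dv_cst _ x) (AA_dv _ x)))).
by case: k {IH} => [|k] /=; rewrite -?natr1; ring.
Qed.

Lemma AA_bound k : exists2 C, 0 <= C & forall x, 0 <= x -> `|AA k x| <= C.
Proof.
have [M M0 HM] := @pow_exp_bound R k 0.
have pi0 := pi_gt0 R.
exists (pi^-1 * M); first by rewrite mulr_ge0// invr_ge0 ltW.
move=> x x0; rewrite /AA normrM ger0_norm ?invr_ge0 ?(ltW pi0)//.
rewrite ler_wpM2l ?invr_ge0 ?(ltW pi0)//.
have [i1 i2] := @igr_expN R.
rewrite -[leRHS]mulr1 -i2 -RintZ; [|exact: mpos|exact: i1].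
apply: Rint_le_norm; [exact: mpos|exact: Aint_meas|exact: (igr_dom M)|].
move=> r; rewrite in_posE => /ltW r0.
apply: le_trans (Aint_le k x r0) (le_trans _ (HM r r0)).
rewrite ler_wpM2l ?exprn_ge0// ler_expR mul0r addr0.
by rewrite gerDl oppr_le0; apply: divr_ge0 => //; exact: mulr_ge0.
Qed.

(** By AA_rec, multiplication by x turns AA k into a combination of AA k.+2
    and AA k.-1; iterate down to the boundedness of the AA k. *)
Lemma AA_pow N k : exists2 C, 0 <= C & forall x, 0 <= x -> x ^+ N * `|AA k x| <= C.
Proof.
elim: N k => [|N IH] k.
  have [C C0 HC] := AA_bound k; exists C => // x x0; rewrite expr0 mul1r; exact: HC.
have [C1 C10 H1] := IH k.+2; have [C2 C20 H2] := IH k.-1.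
exists (C1 + k%:R * C2); first by rewrite addr_ge0// mulr_ge0.
move=> x x0; rewrite exprSr -mulrA -{2}(ger0_norm x0) -normrM.
have -> : x * AA k x = AA k.+2 x - k%:R * AA k.-1 x by rewrite AA_rec; ring.
have xN : 0 <= x ^+ N by rewrite exprn_ge0.
apply: (@le_trans _ _ (x ^+ N * (`|AA k.+2 x| + k%:R * `|AA k.-1 x|))).
  rewrite ler_wpM2l//; apply: le_trans (ler_normB _ _) _.
  by rewrite lerD2l (normrM k%:R) normr_nat.
rewrite mulrDr lerD ?H1// mulrCA ler_wpM2l// H2//.
Qed.

Lemma AA_decay N k : exists2 C, 0 <= C & forall x, 0 <= x -> (1 + x) ^+ N * `|AA k x| <= C.
Proof.
have [C1 C10 H1] := AA_pow 0 k; have [C2 C20 H2] := AA_pow N k.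
exists (2 ^+ N * (C1 + C2)); first by rewrite mulr_ge0 ?exprn_ge0 ?addr_ge0.
move=> x x0; apply: (@le_trans _ _ (2 ^+ N * (1 + x ^+ N) * `|AA k x|)).
  rewrite ler_wpM2r//; have [x1|x1] := leP x 1.
    apply: (@le_trans _ _ (2 ^+ N)).
      by rewrite lerXn2r ?nnegrE//; lra.
    by rewrite ler_peMr ?exprn_ge0// lerDl exprn_ge0.
  apply: (@le_trans _ _ ((2 * x) ^+ N)).
    by rewrite lerXn2r ?nnegrE//; lra.
  by rewrite exprMn ler_wpM2l ?exprn_ge0// lerDr.
rewrite -mulrA ler_wpM2l ?exprn_ge0// mulrDl lerD ?H2//.
by have := H1 x x0; rewrite expr0.
Qed.

Lemma igr_inv2 : igr pos (fun x => ((1 + x) ^+ 2)^-1).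
Proof.
have nz x : 0 <= x -> 1 + x != 0 by move=> x0; rewrite gt_eqF//; lra.
have [|||||//] := @ftc_pos_ge0 R (fun x => ((1 + x) ^+ 2)^-1) (fun x => - (1 + x)^-1) (- (1 + 0)^-1) 0.
- move=> x x0; dvs; first exact/nz/ltW.
  by field; exact/nz/ltW.
- move=> x x0; apply: dv_ct; dvs; last reflexivity.
  by rewrite expf_neq0// nz// ltW.
- by move=> x x0; rewrite invr_ge0 exprn_ge0//; lra.
- apply: ct_right; apply: (@dv_ct R _ _ _ (_ : dv _ 0 _)); dvs; [exact: nz|reflexivity].
- rewrite -oppr0; apply: cvgN; apply/gtr0_cvgV0.
    by near=> x; have : 0 <= x by []; lra.
  apply/cvgryPge => M; near=> x; have : M <= x by []; lra.
Unshelve. all: by end_near. Qed.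

Lemma AA_igr N k : igr pos (fun x => (1 + x) ^+ N * `|AA k x|).
Proof.
have [C C0 HC] := AA_decay N.+2 k.
apply: (@igr_le _ _ _ (fun x => C * ((1 + x) ^+ 2)^-1)); [exact: mpos| |by apply: igrZ igr_inv2; exact: mpos|].
  apply: meas_cont => [|x _]; first exact: open_pos.
  by apply: ctM; [apply: dv_ct; dvs; reflexivity|apply: ct_norm; exact: AA_ct].
move=> x; rewrite in_posE => x0; have x1 : 0 < (1 + x) ^+ 2 by rewrite exprn_gt0//; lra.
rewrite ler_pdivlMr// ger0_norm; last by rewrite mulr_ge0// exprn_ge0//; lra.
by have := HC x (ltW x0); rewrite -addn2 exprD; apply: le_trans; rewrite le_eqVlt; apply/orP; left; apply/eqP; ring.
Qed.

Lemma AA_meas k : measurable_fun pos (AA k).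
Proof. by apply: meas_cont => [|x _]; [exact: open_pos|exact: AA_ct]. Qed.

Lemma AA_igr0 k : igr pos (AA k).
Proof.
have H := AA_igr 0 k; apply: (@igr_le R pos (AA k) _ (@mpos R) (AA_meas k) H) => x _.
by rewrite expr0 mul1r.
Qed.

Lemma AA_cvg0 k : AA k x @[x --> +oo] --> (0 : R).
Proof.
have [C C0 HC] := AA_decay 1 k.
apply: (@le_cvg0 _ _ _ _ _ (fun x => C * (1 + x)^-1)).
  near=> x; have x0 : 0 <= x by [].
  rewrite ler_pdivlMr; last lra.
  by rewrite mulrC -[1 + x]expr1; exact: HC.
rewrite -(mulr0 C); apply: cvgM; first exact: cvg_cst.
apply/gtr0_cvgV0; first by near=> x; have : 0 <= x by []; lra.
by apply/cvgryPge => M; near=> x; have : M <= x by []; lra.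
Unshelve. all: by end_near. Qed.

(** AA k.+1 is a derivative of AA k, which vanishes at infinity. *)
Lemma int_AA k : \int[mu]_(x in pos) AA k.+1 x = - AA k 0.
Proof.
rewrite -[RHS]add0r; apply: (@ftc_pos R _ (AA k)).
- by move=> x _; exact: AA_dv.
- by move=> x _; exact: AA_ct.
- by apply: ct_right; exact: AA_ct.
- exact: AA_cvg0.
- exact: AA_igr0.
Qed.

End airy_equation.


(** * Rotation of oscillatory integrals *)

Section arc.
Variable R : realType.
Implicit Types (g h F : R -> R) (x y a b r : R) (D : set R).
Notation mu := (@lebesgue_measure R).
Notation igr D f := (mu.-integrable D (EFin \o f)).
Notation pos := (`]0, +oo[%classic : set R).
Notation b3 := (bb R).

Definition bd x M := `|x| <= M.
Lemma bdD x y M N : bd x M -> bd y N -> bd (x + y) (M + N).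
Proof. by move=> h k; apply: le_trans (ler_normD _ _) _; exact: lerD. Qed.
Lemma bdN x M : bd x M -> bd (- x) M.
Proof. by rewrite /bd normrN. Qed.
Lemma bdM x y M N : bd x M -> bd y N -> bd (x * y) (M * N).
Proof. by move=> h k; rewrite /bd normrM; exact: ler_pM. Qed.
Lemma bdX x M n : bd x M -> bd (x ^+ n) (M ^+ n).
Proof. by move=> h; rewrite /bd normrX lerXn2r ?nnegrE// (le_trans _ h). Qed.
Lemma bd_cos x : bd (cos x) 1. Proof. exact: cos_max. Qed.
Lemma bd_sin x : bd (sin x) 1. Proof. exact: sin_max. Qed.
Lemma bd_exp x M : bd x M -> bd (expR x) (expR M).
Proof. by move=> h; rewrite /bd ger0_norm ?expR_ge0// ler_expR (le_trans (ler_norm _) h). Qed.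
Lemma bd_refl x : bd x `|x|. Proof. exact: lexx. Qed.

Lemma igr_cst_oo M a b : igr `]a, b[ (fun=> M).
Proof.
apply: (@igrS R `[a, b] `]a, b[ (fun=> M)); try exact: measurable_itv.
  by move=> x; rewrite ooE itv_cc_mem => /andP[ax xb]; rewrite !ltW.
apply: (@continuous_compact_integrable R (fun=> M)); first exact: segment_compact.
by apply: continuous_in_subspaceT => x _; exact: cvg_cst.
Qed.

Section arc1.
Variables (x e c d : R).
(** The real part of the exponent i (x z + e z^2 / 2 + c z^3 / 3 + d) at z = r
    (1 + i n); aQ is the imaginary part. The Airy phase is e = 0, c = 1 and
    the Fresnel phase is e = 1, c = 0. *)
Definition aP (r n : R) := - (x * r * n + e * r ^+ 2 * n + c * r ^+ 3 * (3 * n - n ^+ 3) / 3).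
Definition aQ (r n : R) := x * r + e * r ^+ 2 * (1 - n ^+ 2) / 2
   + c * r ^+ 3 * (1 - 3 * n ^+ 2) / 3 + d.
(** The real part of exp(i phase) dz along the ray z = r (1 + i n); arc_v is
    the real part of exp(i phase) dz/dn. The form exp(i phase) dz is closed,
    which reads d_n arc_u = d_r arc_v. *)
Definition arc_u (r n : R) := expR (aP r n) * (cos (aQ r n) - n * sin (aQ r n)).
Definition arc_v (r n : R) := - r * expR (aP r n) * sin (aQ r n).
Definition arc_w (r n : R) := expR (aP r n) *
  (- sin (aQ r n) + r * (x * n + 2 * e * r * n + c * r ^+ 2 * (3 * n - n ^+ 3)) * sin (aQ r n)
   - r * (x + e * r * (1 - n ^+ 2) + c * r ^+ 2 * (1 - 3 * n ^+ 2)) * cos (aQ r n)).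

Lemma arc_u_dv r n : dv (arc_u r) n (arc_w r n).
Proof. by rewrite /arc_u /arc_w /aP /aQ; dvs; rewrite /=; field. Qed.

Lemma arc_v_dv r n : dv (arc_v ^~ n) r (arc_w r n).
Proof. by rewrite /arc_v /arc_w /aP /aQ; dvs; rewrite /=; field. Qed.

Lemma arc_u_ct r n : {for r, continuous (arc_u ^~ n)}.
Proof. by apply: dv_ct; rewrite /arc_u /aP /aQ; dvs; reflexivity. Qed.
Lemma arc_w_ct r n : {for r, continuous (arc_w ^~ n)}.
Proof. by apply: dv_ct; rewrite /arc_w /aP /aQ; dvs; reflexivity. Qed.

Ltac bds := repeat first
 [ eassumption | eapply bdD | eapply bdN | eapply bdM | eapply bdX | eapply bd_cos
 | eapply bd_sin | eapply bd_exp | eapply bd_refl ].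

Lemma arc_w_bd A : exists M, forall r n, bd r A -> bd n 2 -> bd (arc_w r n) M.
Proof. by eexists=> r n hr hn; rewrite /arc_w /aP /aQ; bds. Qed.
Lemma arc_u_bd A : exists M, forall r n, bd r A -> bd n 2 -> bd (arc_u r n) M.
Proof. by eexists=> r n hr hn; rewrite /arc_u /aP /aQ; bds. Qed.

Lemma arc_u_igr A n : bd n 2 -> igr `]0, A[ (arc_u ^~ n).
Proof.
move=> hn; have [M HM] := arc_u_bd `|A|.
apply: (@igr_le R `]0, A[ (arc_u ^~ n) (fun=> M)); [exact: measurable_itv| |exact: igr_cst_oo|].
  by apply: meas_cont => [|r _]; [exact: open_oo|exact: arc_u_ct].
move=> r; rewrite ooE => /andP[r0 rA]; apply: HM => //.
by rewrite /bd ger0_norm ?(ltW r0)// (le_trans (ltW rA))// ler_norm.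
Qed.

Lemma arc_int_dv A n : 0 < A -> -1 < n < 2 ->
  dv (fun n => \int[mu]_(r in `]0, A[) arc_u r n) n (arc_v A n).
Proof.
move=> A0 hn; have [M HM] := arc_w_bd A.
have bA r : 0 < r < A -> bd r A.
  by move=> /andP[r0 rA]; rewrite /bd ger0_norm ?ltW.
have bn z : -1 < z < 2 -> bd z 2.
  by move=> /andP[z1 z2]; rewrite /bd ler_norml; apply/andP; split; lra.
apply: (dv_eq (d := \int[mu]_(r in `]0, A[) arc_w r n)).
  apply: (@int_dv R _ (fun n r => arc_u r n) (fun n r => arc_w r n) (fun=> M) (-1) 2) => //.
  - by move=> z hz; apply: arc_u_igr; exact: bn.
  - by move=> z r _ _; exact: arc_u_dv.
  - exact: igr_cst_oo.
  - by move=> z r hz; rewrite ooE => hr; apply: HM; [exact: bA|exact: bn].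
rewrite (@ftc_oo R (arc_w ^~ n) (arc_v ^~ n) 0 A 0 (arc_v A n)) ?subr0//.
- by move=> r _; exact: arc_v_dv.
- by move=> r _; exact: arc_w_ct.
- rewrite [X in _ --> X](_ : _ = arc_v 0 n); last by rewrite /arc_v oppr0 !mul0r.
  by apply: ct_right; exact: dv_ct (arc_v_dv 0 n).
- by apply: cvg_at_left_filter; exact: dv_ct (arc_v_dv A n).
- apply: (@igr_le R _ _ (fun=> M)); [exact: measurable_itv| |exact: igr_cst_oo|].
    by apply: meas_cont => [|r _]; [exact: open_oo|exact: arc_w_ct].
  by move=> r; rewrite ooE => hr; apply: HM; [exact: bA|exact: bn].
Qed.

(** As the form is closed, the derivative in the slope n of the integral over
    ]0, A[ is the boundary term arc_v A n, of size at most A exp(- n A^2 / 2),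
    and its integral over n is at most 2 / A. *)
Lemma arc_rotation (A n0 : R) : 1 <= A -> 0 <= n0 <= 1 ->
  (forall n : R, 0 <= n <= n0 -> aP A n <= - n * A ^+ 2 / 2) ->
  `|\int[mu]_(r in `]0, A[) arc_u r 0 - \int[mu]_(r in `]0, A[) arc_u r n0| <= 2 / A.
Proof.
move=> A1 /andP[n00 n01] HP.
pose J (n : R) := \int[mu]_(r in `]0, A[) arc_u r n.
pose E (n : R) := 2 / A * expR (- n * A ^+ 2 / 2).
have A0 : 0 < A by lra.
have dE n : dv E n (- (A * expR (- n * A ^+ 2 / 2))).
  by rewrite /E; dvs; rewrite /=; field; rewrite gt_eqF.
have dJ n : 0 <= n <= n0 -> dv J n (arc_v A n).
  by move=> /andP[h1 h2]; apply: arc_int_dv => //; apply/andP; split; lra.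
have vle n : 0 <= n <= n0 -> `|arc_v A n| <= A * expR (- n * A ^+ 2 / 2).
  move=> hn; rewrite /arc_v !normrM normrN (gtr0_norm A0) -mulrA ler_wpM2l ?(ltW A0)//.
  rewrite (ger0_norm (expR_ge0 _)) (le_trans (_ : _ <= expR (aP A n)))//.
    by rewrite ler_piMr ?expR_ge0// sin_max.
  by rewrite ler_expR; exact: HP.
have E0 : E 0 = 2 / A by rewrite /E oppr0 !mul0r expR0 mulr1.
have En : 0 <= E n0 by rewrite /E mulr_ge0 ?expR_ge0// divr_ge0 ?ltW.
rewrite ler_norml; apply/andP; split.
- have : - J 0 - E 0 <= - J n0 - E n0.
    apply: (@dv_ge0_le R (fun n => - J n - E n) (fun n => - arc_v A n - - (A * expR (- n * A ^+ 2 / 2)))) => // n hn.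
      by apply: dvB; [apply: dvN; exact: dJ|exact: dE].
    have := vle n hn; rewrite ler_norml => /andP[h1 h2]; lra.
  rewrite -/(J 0) -/(J n0); lra.
- have : J 0 - E 0 <= J n0 - E n0.
    apply: (@dv_ge0_le R (fun n => J n - E n) (fun n => arc_v A n - - (A * expR (- n * A ^+ 2 / 2)))) => // n hn.
      by apply: dvB; [exact: dJ|exact: dE].
    have := vle n hn; rewrite ler_norml => /andP[h1 h2]; lra.
  rewrite -/(J 0) -/(J n0); lra.
Qed.
End arc1.

End arc.


(** * The Airy integral after rotation *)

Section airy_rotated.
Variable R : realType.
Implicit Types (f g h F : R -> R) (x y a b r : R) (D : set R).
Notation mu := (@lebesgue_measure R).
Notation igr D f := (mu.-integrable D (EFin \o f)).
Notation pos := (`]0, +oo[%classic : set R).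
Notation b3 := (bb R).

Lemma trunc_cvg f : igr pos f ->
  \int[mu]_(r in `]0, x[) f r @[x --> +oo] --> \int[mu]_(r in pos) f r.
Proof.
move=> h; have mp := @mpos R.
have sub x : `]0, x[ `<=` pos by move=> r; rewrite ooE in_posE => /andP[].
rewrite (_ : (fun x => _) = (fun x => \int[mu]_(r in pos) (f \_ `]0, x[) r)); last first.
  by apply/funext => x; rewrite Rint_patch//.
apply: (@int_cvg_pinfty R pos (fun x => f \_ `]0, x[) f (fun r => `|f r|) 0) => //.
- move=> x _; apply/(measurable_restrict _ (measurable_itv _) mp).
  by apply: measurable_funS (igr_meas h) => //; apply: subIsetl.
- move=> r; rewrite in_posE => r0; apply: cvg_near_cst; near=> x.
  apply/eqP; rewrite patchE0// ooE r0/=.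
  by near: x; apply: nbhs_pinfty_gt; rewrite num_real.
- exact: igr_norm.
- move=> x r _ _; have [xi|xi] := pselect (`]0, x[%classic r).
    by rewrite patchE0.
  by rewrite patchE1// normr0.
Unshelve. all: by end_near. Qed.

Lemma scale_igr f (k : R) : 0 < k -> (forall x, 0 < x -> {for x, continuous f}) ->
  igr pos (fun r => f (k * r)) <-> igr pos f.
Proof.
move=> k0 cf; have mp := @mpos R.
have kne : k != 0 by rewrite gt_eqF.
have H := @subst_igr R pos pos _ _ (fun r => k * r) (fun=> k) f (@open_pos R) (@open_pos R) (@exh_pos R).
rewrite -{1}H.
- split=> h.
    by apply: (@igr_eq R pos (fun r => k * f (k * r))) => //; [move=> r _; rewrite mulrC|exact: igrZ].
  apply: (@igr_eq R pos (fun r => k^-1 * (f (k * r) * k))) => //; last exact: igrZ.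
  by move=> r _; rewrite mulrCA mulVf// mulr1.
- by move=> r _; dvs; rewrite /=; ring.
- by move=> r _; exact: ct_cst.
- by [].
- by move=> r; rewrite !in_posE => r0; rewrite mulr_gt0.
- move=> r; rewrite in_posE => r0; exists (k^-1 * r); last by rewrite mulVKf.
  by rewrite in_posE mulr_gt0 ?invr_gt0.
- by move=> r; rewrite in_posE; exact: cf.
Qed.

Lemma scale_int f (k : R) : 0 < k -> (forall x, 0 < x -> {for x, continuous f}) -> igr pos f ->
  \int[mu]_(r in pos) f (k * r) = k^-1 * \int[mu]_(r in pos) f r.
Proof.
move=> k0 cf h; have mp := @mpos R.
have kne : k != 0 by rewrite gt_eqF.
rewrite -(@subst_int R pos pos _ _ (fun r => k * r) (fun=> k) f (@open_pos R) (@open_pos R) (@exh_pos R)) => //.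
- have h2 := proj2 (scale_igr k0 cf) h.
  rewrite (@Rint_eq R pos (fun r => f (k * r) * k) (fun r => k * f (k * r))); last by move=> r _; rewrite mulrC.
  by rewrite RintZ// mulKf.
- by move=> r _; dvs; rewrite /=; ring.
- by move=> r _; exact: ct_cst.
- by move=> r; rewrite !in_posE => r0; rewrite mulr_gt0.
- move=> r; rewrite in_posE => r0; exists (k^-1 * r); last by rewrite mulVKf.
  by rewrite in_posE mulr_gt0 ?invr_gt0.
- by move=> r; rewrite in_posE; exact: cf.
Qed.

Lemma igr_expc (k : R) : 0 < k -> igr pos (fun r => expR (- (k * r))).
Proof.
move=> k0; apply/(scale_igr (f := fun r => expR (- r)) k0); last exact: (proj1 (@igr_expN R)).
by move=> x _; apply: dv_ct; dvs; reflexivity.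
Qed.

(** Letting A tend to infinity in arc_rotation: the oscillatory integral
    exists as an improper integral and equals the absolutely convergent one.
    *)
Lemma arc_cvg (x e c d n0 : R) : 0 <= n0 <= 1 ->
  (forall A n : R, 1 <= A -> 0 <= n <= n0 -> aP x e c A n <= - n * A ^+ 2 / 2) ->
  igr pos (fun r => arc_u x e c d r n0) ->
  \int[mu]_(r in `]0, A[) arc_u x e c d r 0 @[A --> +oo] -->
    \int[mu]_(r in pos) arc_u x e c d r n0.
Proof.
move=> hn HP /trunc_cvg h.
rewrite -[X in _ --> X]add0r.
rewrite (_ : (fun A => _) = (fun A => (\int[mu]_(r in `]0, A[) arc_u x e c d r 0 -
  \int[mu]_(r in `]0, A[) arc_u x e c d r n0) + \int[mu]_(r in `]0, A[) arc_u x e c d r n0)); last first.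
  by apply/funext => A; rewrite subrK.
apply: cvgD => //.
apply: (@le_cvg0 _ _ _ _ _ (fun A => 2 * A^-1)).
  near=> A; have A1 : 1 <= A by near: A; apply: nbhs_pinfty_ge; rewrite num_real.
  exact: (@arc_rotation R x e c d A n0 A1 hn (fun n => HP A n A1)).
rewrite -(mulr0 2); apply: cvgM; first exact: cvg_cst.
by apply/gtr0_cvgV0; [near=> A|exact: cvg_id].
Unshelve. all: by end_near. Qed.

(** The rotation to slope 1 / sqrt 3, that is, to argument pi / 6; x >= 0
    makes the real part of the exponent negative along the way. Rescaling the
    ray to unit speed gives AA 0. *)
Lemma airyE x : 0 <= x -> airy x = AA 0 x.
Proof.
move=> x0; rewrite /airy /AA; congr (_ * _); apply/cvg_lim => //.
have b2 := bb_sq R; have b0 := bb_gt0 R.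
(* the slope 1 / sqrt 3 of the ray of argument pi/6; b3 is its unit-speed factor *)
pose n0 := 2 * b3 / 3.
have n2 : n0 ^+ 2 = 3^-1.
  rewrite /n0 (_ : _ ^+ 2 = 4 / 9 * b3 ^+ 2); first by rewrite b2; field.
  by field.
have bn : b3 * n0 = 2^-1.
  by rewrite /n0 (_ : _ * _ = 2 / 3 * b3 ^+ 2); [rewrite b2; field|field].
have n00 : 0 <= n0 by rewrite /n0; lra.
have n01 : n0 <= 1 by nra.
have uE r : b3 * arc_u x 0 1 0 (b3 * r) n0 = Aint 0 x r.
  rewrite /arc_u /Aint.
  have -> : aP x 0 1 (b3 * r) n0 = - r ^+ 3 / 3 - x * r / 2.
    rewrite /aP.
    have -> : x * (b3 * r) * n0 = x * r * (b3 * n0) by ring.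
    have -> : 1 * (b3 * r) ^+ 3 * (3 * n0 - n0 ^+ 3) / 3 =
      r ^+ 3 * (3 * b3 ^+ 2 * (b3 * n0) - (b3 * n0) ^+ 3) / 3 by field.
    by rewrite bn b2; field.
  have -> : aQ x 0 1 0 (b3 * r) n0 = b3 * x * r.
    by rewrite /aQ n2; field.
  have -> : b3 * x * r + ph R 0 = pi / 2 + (b3 * x * r - pi / 3) by rewrite /ph mul0r; field.
  rewrite (addrC (pi / 2)) cosDpihalf sinB cos_pi3 sin_pi3 expr0.
  rewrite (_ : b3 * (_ * _) = expR (- r ^+ 3 / 3 - x * r / 2) * (b3 * cos (b3 * x * r) - (b3 * n0) * sin (b3 * x * r))).
    by rewrite bn; ring.
  by ring.
have cu r : 0 < r -> {for r, continuous (fun r => arc_u x 0 1 0 r n0)}.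
  by move=> _; exact: arc_u_ct.
have iu : igr pos (fun r => arc_u x 0 1 0 r n0).
  apply/(scale_igr b0 cu).
  apply: (@igr_eq R pos (fun r => b3^-1 * Aint 0 x r)); first exact: mpos.
    by move=> r _; rewrite -uE mulKf// gt_eqF.
  by apply: igrZ; [exact: mpos|exact: Aint_igr].
have -> : \int[mu]_(r in pos) Aint 0 x r = \int[mu]_(r in pos) arc_u x 0 1 0 r n0.
  rewrite (@Rint_eq R pos (Aint 0 x) (fun r => b3 * arc_u x 0 1 0 (b3 * r) n0)); last by move=> r _; rewrite uE.
  rewrite RintZ; [|exact: mpos|exact/(scale_igr b0 cu)].
  by rewrite (scale_int b0 cu iu) mulVKf// gt_eqF.
rewrite (_ : (fun A => _) = (fun A => \int[mu]_(r in `]0, A[) arc_u x 0 1 0 r 0)).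
  apply: arc_cvg => //; first by apply/andP.
  move=> A n A1 /andP[n0' n1]; rewrite /aP.
  have n2' : n ^+ 2 <= 3^-1 by rewrite -n2 lerXn2r// nnegrE.
  have xAn : 0 <= x * A * n by rewrite !mulr_ge0//; lra.
  have A3 : A ^+ 2 <= A ^+ 3 by rewrite (exprSr A 2) ler_peMr// exprn_ge0//; lra.
  have : n / 2 * A ^+ 2 <= n / 2 * A ^+ 3 by rewrite ler_wpM2l//; lra.
  have : 0 <= A ^+ 3 * n * (3^-1 - n ^+ 2).
    by rewrite !mulr_ge0// ?exprn_ge0//; lra.
  have : 0 <= A ^+ 3 * n by rewrite !mulr_ge0// ?exprn_ge0//; lra.
  have -> : n ^+ 3 = n * n ^+ 2 by ring.
  move: (A ^+ 3) (A ^+ 2) (n ^+ 2) => A3' A2' n2''; nra.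
apply/funext => A.
have i1 : igr `]0, A[ (fun r => arc_u x 0 1 0 r 0).
  by apply: arc_u_igr; rewrite /bd normr0.
have i2 : igr `]0, A] (fun r => arc_u x 0 1 0 r 0).
  apply: (@igrS R `[0, A]); try exact: measurable_itv.
    by move=> r; rewrite /= !in_itv/= => /andP[r0 ->]; rewrite ltW.
  apply: (@continuous_compact_integrable R (fun r => arc_u x 0 1 0 r 0)).
    exact: segment_compact.
  by apply: continuous_in_subspaceT => r _; exact: arc_u_ct.
rewrite (Rintegral_itv_bndo_bndc i1) (Rintegral_itv_obnd_cbnd i2).
apply: Rint_eq => r _; rewrite /arc_u /aP /aQ.
by rewrite !(mulr0, mul0r, expr0n, subr0, addr0, oppr0, expR0, mul1r, mulr1)/= (mulrC r).
Qed.

End airy_rotated.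


(** * The integral of the Airy function *)

Section airy_mass.
Variable R : realType.
Implicit Types (f g h F : R -> R) (x y a b r : R) (D : set R).
Notation mu := (@lebesgue_measure R).
Notation igr D f := (mu.-integrable D (EFin \o f)).
Notation pos := (`]0, +oo[%classic : set R).
Notation b3 := (bb R).

Lemma sin_norm_le x : `|sin x| <= `|x|.
Proof.
wlog x0 : x / 0 <= x => [H|].
  have [/H//|x0] := leP 0 x.
  by rewrite -normrN -(normrN x) -sinN; apply: H; lra.
have := @mvt_le R sin cos 0 x 1 x0; rewrite sin0 !subr0 mul1r (ger0_norm x0); apply.
- by move=> y _; apply: dv_eq (dv_sin (dv_id y)) _; rewrite mulr1.
- by move=> y _; exact: cos_max.
Qed.

Lemma sinc_le (k r : R) : 0 < r -> `|sin (k * r) / r| <= `|k|.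
Proof.
move=> r0; rewrite normf_div ler_pdivrMr ?normr_gt0 ?gt_eqF//.
by apply: le_trans (sin_norm_le _) _; rewrite normrM.
Qed.

(** Both sides vanish at k = 0 and have the same derivative in k, the Laplace
    transform of the cosine at 1/2. *)
Lemma dirichlet_laplace (k : R) :
  \int[mu]_(u in pos) (expR (- (2^-1 * u)) * (sin (k * u) / u)) = atan (2 * k).
Proof.
have mp := @mpos R.
pose f (k u : R) := expR (- (2^-1 * u)) * (sin (k * u) / u).
pose df (k u : R) := expR (- (2^-1 * u)) * cos (k * u).
have ie : igr pos (fun u => expR (- (2^-1 * u))) by apply: igr_expc; lra.
have nz (u : R) : 0 < u -> u != 0 by move=> ?; rewrite gt_eqF.
have mf c : measurable_fun pos (f c).
  apply: meas_cont => [|u]; first exact: open_pos.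
  by rewrite in_posE => u0; apply: dv_ct; rewrite /f; dvs; [by apply: nz|reflexivity].
have fi c : igr pos (f c).
  apply: (@igr_le R pos (f c) (fun u => `|c| * expR (- (2^-1 * u)))) => //; first exact: igrZ.
  move=> u; rewrite in_posE => u0; rewrite /f normrM mulrC (ger0_norm (expR_ge0 _)).
  by rewrite ler_wpM2r ?expR_ge0// sinc_le.
have ctdf c u : {for u, continuous (df c)} by apply: dv_ct; rewrite /df; dvs; reflexivity.
have dfle c u : `|df c u| <= expR (- (2^-1 * u)).
  by rewrite /df normrM ger0_norm ?expR_ge0// ler_piMr ?expR_ge0// cos_max.
have idf c : igr pos (df c).
  apply: (@igr_le R pos (df c) (fun u => expR (- (2^-1 * u)))) => //.
  by apply: meas_cont => [|u _] //; exact: open_pos.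
have dI c : dv (fun c => \int[mu]_(u in pos) f c u) c (\int[mu]_(u in pos) df c u).
  apply: (@int_dv R pos f df (fun u => expR (- (2^-1 * u))) (c - 1) (c + 1)) => //.
  - by apply/andP; split; lra.
  - move=> z u _; rewrite in_posE => u0; rewrite /f /df; dvs; rewrite /=.
    by field; apply: nz.
have Idf c : \int[mu]_(u in pos) df c u = 2 / (1 + (2 * c) ^+ 2).
  have c2 := sqr_ge0 c.
  have p0 : 1 + (2 * c) ^+ 2 != 0 by rewrite gt_eqF// ltr_pwDl// sqr_ge0.
  have p1 : 4^-1 + c ^+ 2 != 0 by rewrite gt_eqF// ltr_pwDl// ?sqr_ge0 ?invr_gt0.
  pose F (u : R) := expR (- (2^-1 * u)) * (- 2^-1 * cos (c * u) + c * sin (c * u)) / (4^-1 + c ^+ 2).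
  have dF u : dv F u (df c u).
    by rewrite /F /df; dvs; rewrite /=; field; rewrite !gt_eqF//; nra.
  rewrite (@ftc_pos R _ F (F 0) 0) //.
  - by rewrite /F !(mulr0, oppr0, expR0, cos0, sin0, mulr1, mul1r, addr0); field; rewrite !gt_eqF//; nra.
  - by apply: ct_right; exact: dv_ct (dF 0).
  - apply: (@le_cvg0 _ _ _ _ _ (fun u => (2^-1 + `|c|) / `|4^-1 + c ^+ 2| * expR (- (2^-1 * u)))).
      apply: nearW => u; rewrite /F normf_div mulrAC ler_wpM2r ?invr_ge0 ?normr_ge0//.
      rewrite normrM mulrC (ger0_norm (expR_ge0 _)) ler_wpM2r ?expR_ge0//.
      apply: le_trans (ler_normD _ _) _; rewrite !normrM normrN (ger0_norm (_ : 0 <= 2^-1)); last lra.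
      have := @cos_max R (c * u); have := @sin_max R (c * u) => h1 h2.
      by rewrite lerD// ler_piMr//; lra.
    rewrite -[X in _ --> X](mulr0 ((2^-1 + `|c|) / `|4^-1 + c ^+ 2|)).
    apply: cvgM; first exact: cvg_cst.
    apply: (@le_cvg0 _ _ _ _ _ (fun u => 2 * u^-1)).
      near=> u; have u0 : 0 < u by near: u; apply: nbhs_pinfty_gt; rewrite num_real.
      rewrite ger0_norm ?expR_ge0// expRN -[leRHS]invrK lef_pV2 ?posrE ?expR_gt0//.
        rewrite invfM invrK; apply: le_trans (expR_ge1Dx _); lra.
      by rewrite invr_gt0 divr_gt0.
    rewrite -(mulr0 2); apply: cvgM; first exact: cvg_cst.
    by apply/gtr0_cvgV0; [near=> u|exact: cvg_id].
have H c : is_derive c (1 : R) (fun c => \int[mu]_(u in pos) f c u - atan (2 * c)) 0.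
  apply: (dv_eq (d := _ : R)); first apply: (dvB (dI c)); first by dvs; reflexivity.
  by rewrite Idf /=; field; rewrite gt_eqF// ltr_pwDl// sqr_ge0.
have := is_derive_0_is_cst k 0 H => /=.
have -> : \int[mu]_(u in pos) f 0 u = 0.
  rewrite (@Rint_eq R pos (f 0) (fun=> 0 * 0)).
    by rewrite RintZ// ?mul0r//; exact: (@integrable0 _ _ _ mu pos).
  by move=> u _; rewrite /f mul0r sin0 mul0r !mulr0.
by rewrite mulr0 atan0 subr0 => /eqP; rewrite subr_eq0 => /eqP.
Unshelve. all: by end_near. Qed.

Lemma atan_2b3 : atan (2 * b3) = pi / 3.
Proof.
have pi0 := pi_gt0 R.
rewrite -[RHS]tanK; last by rewrite in_itv/=; apply/andP; split; lra.
by congr atan; rewrite /tan sin_pi3 cos_pi3; field.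
Qed.

(** The primitive of AA 0 that vanishes at 0 is 1/pi times the integral of
    exp(- r^3/3 - x r/2) sin(b3 x r) / r over r. After scaling r by x, its
    limit at infinity is given by dirichlet_laplace and equals atan (sqrt 3) /
    pi. *)
Lemma int_AA0 : \int[mu]_(x in pos) AA 0 x = 3^-1.
Proof.
have mp := @mpos R; have pi0 := pi_gt0 R; have b0 := bb_gt0 R.
have nz (u : R) : 0 < u -> u != 0 by move=> ?; rewrite gt_eqF.
pose f (x r : R) := expR (- r ^+ 3 / 3 - x * r / 2) * (sin (b3 * x * r) / r).
have ctf x r : 0 < r -> {for r, continuous (f x)}.
  by move=> r0; apply: dv_ct; rewrite /f; dvs; [by apply: nz|reflexivity].
have fle x r : 0 < r -> `|f x r| <= b3 * `|x| * expR (- r ^+ 3 / 3 + (- x / 2) * r).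
  move=> r0; rewrite /f normrM mulrC (ger0_norm (expR_ge0 _)).
  have -> : - r ^+ 3 / 3 - x * r / 2 = - r ^+ 3 / 3 + - x / 2 * r by ring.
  rewrite ler_wpM2r ?expR_ge0//; apply: le_trans (sinc_le _ r0) _.
  by rewrite normrM (gtr0_norm b0).
have fi x : igr pos (f x).
  have [M M0 HM] := pow_exp_bound 0 (- x / 2).
  apply: (@igr_le R pos (f x) (fun r => b3 * `|x| * (M * expR (- r)))) => //.
  - by apply: meas_cont => [|u]; [exact: open_pos|rewrite in_posE; exact: ctf].
  - by apply: igrZ => //; exact: igr_dom.
  - move=> r; rewrite in_posE => r0; apply: le_trans (fle x r r0) _.
    rewrite ler_wpM2l ?mulr_ge0 ?(ltW b0)//.
    by have := HM r (ltW r0); rewrite expr0 mul1r.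
(* the primitive of AA 0 vanishing at 0 *)
pose S x := pi^-1 * \int[mu]_(r in pos) f x r.
have dS x : dv S x (AA 0 x).
  have [M HM] := @Aint_dom R 0 (`|x| + 1).
  apply: (dv_eq (dvM (dv_cst pi^-1 x) (_ : dv _ x (\int[mu]_(r in pos) Aint 0 x r)))).
    apply: (@int_dv R pos f (fun x => Aint 0 x) (fun r => M * expR (- r)) (x - 1) (x + 1)) => //.
    - by apply/andP; split; lra.
    - move=> z r _; rewrite in_posE => r0; rewrite /f /Aint; dvs; rewrite /=.
      have -> : b3 * z * r + ph R 0 = pi / 2 + (b3 * z * r - pi / 3) by rewrite /ph mul0r; field.
      rewrite (addrC (pi / 2)) cosDpihalf sinB cos_pi3 sin_pi3.
      by field; apply: nz.
    - exact: igr_dom.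
    - move=> z r /andP[z1 z2]; rewrite in_posE => r0; apply: HM; last exact: ltW.
      have : `|z - x| <= 1 by rewrite ler_norml; apply/andP; split; lra.
      have := ler_normD (z - x) x; rewrite subrK; lra.
  by rewrite /AA; ring.
have S0 : S 0 = 0.
  rewrite /S (@Rint_eq R pos (f 0) (fun=> 0 * 0)).
    by rewrite RintZ// ?mul0r ?mulr0//; exact: (@integrable0 _ _ _ mu pos).
  by move=> u _; rewrite /f !(mulr0, mul0r, sin0).
pose k (x u : R) := expR (- (x^-1 * u) ^+ 3 / 3 - 2^-1 * u) * (sin (b3 * u) / u).
have SE x : 0 < x -> S x = pi^-1 * \int[mu]_(u in pos) k x u.
  move=> x0; have xi : 0 < x^-1 by rewrite invr_gt0.
  have xn := nz x x0; congr (_ * _).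
  have := scale_int xi (ctf x) (fi x); rewrite invrK => H.
  have -> : \int[mu]_(r in pos) f x r = x^-1 * \int[mu]_(r in pos) f x (x^-1 * r).
    by rewrite H mulKf.
  rewrite -RintZ//; last exact/(scale_igr xi (ctf x)).
  apply: Rint_eq => u; rewrite in_posE => u0; rewrite /f /k.
  have -> : x * (x^-1 * u) / 2 = 2^-1 * u by field.
  have -> : b3 * x * (x^-1 * u) = b3 * u by field.
  by field; rewrite xn nz.
have Sy : S x @[x --> +oo] --> (3^-1 : R).
  have -> : (3^-1 : R) = pi^-1 * \int[mu]_(u in pos) (expR (- (2^-1 * u)) * (sin (b3 * u) / u)).
    by rewrite dirichlet_laplace atan_2b3 mulrA mulVf ?mul1r ?gt_eqF.
  apply: (@cvg_trans _ (pi^-1 * \int[mu]_(u in pos) k x u @[x --> +oo])).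
    apply: near_eq_cvg; near=> y.
    have y0 : 0 < y by near: y; apply: nbhs_pinfty_gt; rewrite num_real.
    by rewrite (SE _ y0).
  apply: cvgM; first exact: cvg_cst.
  apply: (@int_cvg_pinfty R pos k _ (fun u => b3 * expR (- (2^-1 * u))) 0) => //.
  - move=> x x0; apply: meas_cont => [|u]; [exact: open_pos|rewrite in_posE => u0].
    by apply: dv_ct; rewrite /k; dvs; [by apply: nz|reflexivity].
  - move=> u; rewrite in_posE => u0; rewrite /k; apply: cvgM; last exact: cvg_cst.
    suff H : (- (x^-1 * u) ^+ 3 / 3 - 2^-1 * u) @[x --> +oo] --> (- (2^-1 * u) : R).
      exact: (cvg_comp _ _ H (@continuous_expR R (- (2^-1 * u)))).
    rewrite -[X in _ --> X]add0r; apply: cvgB; last exact: cvg_cst.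
    rewrite -[X in _ --> X](mul0r 3^-1); apply: cvgM; last exact: cvg_cst.
    rewrite -[X in _ --> X]oppr0; apply: cvgN.
    have x0 : x^-1 @[x --> +oo] --> (0 : R).
      by apply/gtr0_cvgV0; [near=> x|exact: cvg_id].
    have H : x^-1 * u @[x --> +oo] --> 0 by rewrite -(mul0r u); apply: cvgM => //; exact: cvg_cst.
    have -> : (0 : R) = 0 * 0 * 0 by rewrite !mul0r.
    under eq_fun do rewrite exprSr expr2.
    by apply: cvgM => //; apply: cvgM.
  - by apply: igrZ => //; apply: igr_expc; lra.
  - move=> x u x0; rewrite in_posE => u0; rewrite /k normrM mulrC (ger0_norm (expR_ge0 _)).
    apply: ler_pM; rewrite ?expR_ge0//; first by have := sinc_le b3 u0; rewrite (gtr0_norm b0).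
    rewrite ler_expR; have : 0 <= (x^-1 * u) ^+ 3 by rewrite exprn_ge0// mulr_ge0 ?invr_ge0// ?(ltW x0)// (ltW u0).
    lra.
rewrite (@ftc_pos R (AA 0) S 0 3^-1) ?subr0//.
- by move=> x _; exact: AA_ct.
- by rewrite -[X in _ --> X]S0; apply: ct_right; exact: dv_ct (dS 0).
- exact: AA_igr0.
Unshelve. all: by end_near. Qed.

(** Equal to 3^(-2/3) Gamma(1/3), see Gamma13; this form arises from the Airy
    integral at 0. *)
Definition I3 : R := \int[mu]_(r in pos) expR (- r ^+ 3 / 3).

Lemma AA00 : AA 0 0 = b3 / pi * I3.
Proof.
have mp := @mpos R.
have pi0 := pi_gt0 R.
have i : igr pos (fun r => expR (- r ^+ 3 / 3)).
  have [M M0 HM] := @pow_exp_bound R 0 0.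
  apply: (@igr_le R pos _ (fun r => M * expR (- r))) => //; last 2 first.
  - exact: igr_dom.
  - move=> r; rewrite in_posE => r0; rewrite ger0_norm ?expR_ge0//.
    by have := HM r (ltW r0); rewrite expr0 mul1r mul0r addr0.
  - by apply: meas_cont => [|u _]; [exact: open_pos|apply: dv_ct; dvs; reflexivity].
rewrite /AA /I3 (@Rint_eq R pos _ (fun r => b3 * expR (- r ^+ 3 / 3))).
  by rewrite RintZ//; ring.
move=> r _; rewrite /Aint expr0 !(mulr0, mul0r, subr0) mul1r mulrC; congr (_ * _).
rewrite /ph mul0r addr0 add0r -sin_pi3 -cosBpihalf.
by rewrite -[in RHS]cosN; congr cos; field.
Qed.

End airy_mass.


(** * Cube roots and uniqueness for the Airy equation *)

Section cube_roots.
Variable R : realType.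
Implicit Types (f g h F : R -> R) (x y a b r v : R) (D : set R).
Notation mu := (@lebesgue_measure R).
Notation igr D f := (mu.-integrable D (EFin \o f)).
Notation pos := (`]0, +oo[%classic : set R).
Notation uni := (`]0, 1[%classic : set R).
Notation b3 := (bb R).

Definition cbrt x : R := x `^ 3^-1.

Lemma cbrt_gt0 x : 0 < x -> 0 < cbrt x.
Proof. exact: powR_gt0. Qed.

Lemma cbrt_cube x : 0 <= x -> cbrt x ^+ 3 = x.
Proof.
by move=> x0; rewrite /cbrt -powR_mulrn ?powR_ge0// -powRrM mulVf ?powRr1.
Qed.

Lemma cbrt_dv x : 0 < x -> dv cbrt x (3 * cbrt x ^+ 2)^-1.
Proof.
move=> x0; apply: (dv_eq (dv_powR 3^-1 x0 (dv_id x))).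
have -> : 3^-1 - 1 = - (2 * 3^-1) :> R by field.
rewrite powRN mulrC powRrM -(powR_mulrn 2 (powR_ge0 _ _)) /cbrt -powRrM mulrC.
by rewrite mulr1 (mulrC 2) -invfM -powRrM mulrC powRrM invfM.
Qed.

Lemma dv_cbrt f x a : 0 < f x -> dv f x a ->
  dv (fun y => cbrt (f y)) x ((3 * cbrt (f x) ^+ 2)^-1 * a).
Proof. by move=> f0 fa; apply: (@dv_comp R cbrt f) fa; exact: cbrt_dv. Qed.

Lemma powR_cvg0' (T : Type) (FF : set_system T) {FFF : Filter FF} (f : T -> R) (p : R) :
  0 < p -> (\forall t \near FF, 0 <= f t) -> f t @[t --> FF] --> 0 ->
  (f t) `^ p @[t --> FF] --> 0.
Proof.
move=> p0 f0 fc; apply/cvgr0Pnorm_le => e e0.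
have e1 : 0 < e `^ p^-1 by rewrite powR_gt0.
have /cvgr0Pnorm_le/(_ _ e1) := fc; apply: filterS2 f0 => t ft.
rewrite !ger0_norm ?powR_ge0// => h.
have -> : e = (e `^ p^-1) `^ p by rewrite -powRrM mulVf ?gt_eqF// powRr1// ltW.
by apply: ge0_ler_powR; rewrite ?nnegrE ?powR_ge0// ltW.
Qed.

Definition qq v : R := cbrt (1 - v ^+ 3).
(** The Caputo kernel (t - s)^(-2/3) after the substitution s = t v^3, up to
    the factor t^(-2/3). *)
Definition WW v : R := (qq v ^+ 2)^-1.

Lemma cube_lt1 v : 0 < v < 1 -> 0 < 1 - v ^+ 3.
Proof. by move=> /andP[v0 v1]; rewrite subr_gt0 exprn_ilt1// ltW. Qed.

Lemma qq_gt0 v : 0 < v < 1 -> 0 < qq v.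
Proof. by move=> /cube_lt1; exact: cbrt_gt0. Qed.

Lemma qq_cube v : 0 < v < 1 -> qq v ^+ 3 = 1 - v ^+ 3.
Proof. by move=> /cube_lt1/ltW; exact: cbrt_cube. Qed.

Lemma qq_dv v : 0 < v < 1 -> dv qq v (- v ^+ 2 / qq v ^+ 2).
Proof.
move=> hv; have q0 := qq_gt0 hv; rewrite /qq.
apply: dv_eq; first by apply: (@dv_cbrt (fun v => 1 - v ^+ 3)); [exact: cube_lt1|dvs; reflexivity].
by rewrite /= -/(qq v); field; rewrite gt_eqF.
Qed.

Lemma WW_gt0 v : 0 < v < 1 -> 0 < WW v.
Proof. by move=> /qq_gt0 h; rewrite /WW invr_gt0 exprn_gt0. Qed.

Lemma WW_dv v : 0 < v < 1 -> exists d, dv WW v d.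
Proof.
move=> hv; have q0 := qq_gt0 hv; eexists; rewrite /WW.
apply: dvV; first by rewrite gt_eqF// exprn_gt0.
by apply: dvX; exact: qq_dv.
Qed.

Lemma WW_ct v : 0 < v < 1 -> {for v, continuous WW}.
Proof. by move=> /WW_dv[d]; exact: dv_ct. Qed.

Lemma WW_igr : igr uni WW.
Proof.
pose F v := - 3 * cbrt (1 - v); pose f v := (cbrt (1 - v) ^+ 2)^-1.
have dF v : 0 < v < 1 -> dv F v (f v).
  move=> /andP[v0 v1]; have h : 0 < 1 - v by lra.
  have c0 := cbrt_gt0 h; rewrite /F /f.
  apply: dv_eq.
    by apply: dvM; [exact: dv_cst|apply: (@dv_cbrt (fun v => 1 - v)); [exact: h|dvs; reflexivity]].
  by rewrite /=; field; rewrite gt_eqF.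
have ctf v : 0 < v < 1 -> {for v, continuous f}.
  move=> /andP[v0 v1]; have h : 0 < 1 - v by lra.
  have c0 := cbrt_gt0 h; rewrite /f; apply: dv_ct; apply: dvV.
    by rewrite gt_eqF// exprn_gt0.
  by apply: dvX; apply: (@dv_cbrt (fun v => 1 - v)); [exact: h|dvs; reflexivity].
have f0 v : 0 <= f v by rewrite /f invr_ge0 sqr_ge0.
have [||h _] := @ftc_oo_ge0 R f F 0 1 (F 0) 0 ltr01 dF ctf (fun v _ => f0 v).
- apply: ct_right; apply: (@dv_ct R F 0 _ (_ : dv F 0 _)).
  have h : 0 < 1 - 0 :> R by lra.
  apply: dvM; first exact: dv_cst.
  by apply: (@dv_cbrt (fun v => 1 - v)); [exact: h|dvs; reflexivity].
- rewrite -[X in _ --> X](mulr0 (- 3)); apply: cvgM; first exact: cvg_cst.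
  apply: powR_cvg0'; first by rewrite invr_gt0.
    by near=> v; rewrite subr_ge0; near: v; exact: nbhs_left_le.
  rewrite -[X in _ --> X](subrr 1); apply: cvgB; first exact: cvg_cst.
  exact: cvg_at_left_filter.
apply: (@igr_le R uni WW f); [exact: measurable_itv| |exact: h|].
  by apply: meas_cont => [|v]; [exact: open_oo|rewrite ooE; exact: WW_ct].
move=> v; rewrite ooE => hv; rewrite (gtr0_norm (WW_gt0 hv)) /WW /f.
have /andP[v0 v1] := hv; have h1 : 0 < 1 - v by lra.
have c0 := cbrt_gt0 h1; have q0 := qq_gt0 hv.
rewrite lef_pV2 ?posrE ?exprn_gt0// lerXn2r ?nnegrE ?(ltW c0) ?(ltW q0)//.
rewrite /qq /cbrt; apply: ge0_ler_powR; rewrite ?nnegrE ?invr_ge0 ?(ltW h1) ?(ltW (cube_lt1 hv))//.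
rewrite lerD2l lerN2 exprS -[leRHS]mulr1 ler_wpM2l ?(ltW v0)//.
by rewrite exprn_ile1// ltW.
Unshelve. all: by end_near. Qed.

(** The derivative w1^2 + x w^2 of w w1 is nonnegative and w w1 vanishes at
    infinity, so w w1 <= 0; hence w^2 is nonincreasing, and it starts from 0.
    *)
Lemma airy_ode_uniq (w w1 : R -> R) :
  (forall x, 0 < x -> dv w x (w1 x)) -> (forall x, 0 < x -> dv w1 x (x * w x)) ->
  w x @[x --> 0^'+] --> (0 : R) -> w x * w1 x @[x --> +oo] --> (0 : R) ->
  forall x, 0 < x -> w x = 0.
Proof.
move=> dw dw1 w0 wy.
have ple x y : 0 < x -> x <= y -> w x * w1 x <= w y * w1 y.
  move=> x0 xy; apply: (@dv_ge0_le R (fun x => w x * w1 x) (fun x => w1 x * w1 x + w x * (x * w x))) => //.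
    move=> z /andP[xz _]; have z0 : 0 < z by apply: lt_le_trans xz.
    by apply: dvM; [exact: dw|exact: dw1].
  move=> z /andP[xz _]; have z0 : 0 < z by apply: lt_le_trans xz.
  apply: addr_ge0; first by rewrite -expr2 sqr_ge0.
  by rewrite mulrCA mulr_ge0 ?(ltW z0) // -expr2 sqr_ge0.
have p0 x : 0 < x -> w x * w1 x <= 0.
  move=> x0; rewrite leNgt; apply/negP => px.
  have /cvgr0Pnorm_lt/(_ _ px) := wy.
  move=> H; near (+oo : set_system R) => y.
  have : `|w y * w1 y| < w x * w1 x by near: y.
  have : w x * w1 x <= w y * w1 y.
    by apply: ple => //; near: y; apply: nbhs_pinfty_ge; rewrite num_real.
  have := ler_norm (w y * w1 y); lra.
move=> x x0; apply/eqP/negP => /negP wx.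
have wx0 : 0 < `|w x| by rewrite normr_gt0.
have /cvgr0Pnorm_lt/(_ _ wx0) := w0 => H.
near ((0:R)^'+) => z.
have z0 : 0 < z by near: z; exact: nbhs_right_gt.
have zx : z <= x by near: z; exact: nbhs_right_le.
have : `|w z| < `|w x| by near: z.
apply/negP; rewrite -leNgt -(@ler_pXn2r _ 2) ?nnegrE ?normr_ge0//.
rewrite -!normrX !ger0_norm ?sqr_ge0// -lerN2.
apply: (@dv_ge0_le R (fun x => - w x ^+ 2) (fun x => - (2 * (w x * w1 x)))) => //.
  move=> t /andP[zt _]; have t0 : 0 < t by apply: lt_le_trans zt.
  by apply: (dv_eq (dvN (dvX 2 (dw t t0)))); rewrite /=; ring.
move=> t /andP[zt _]; have t0 : 0 < t by apply: lt_le_trans zt.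
by have := p0 t t0; lra.
Unshelve. all: by end_near. Qed.

End cube_roots.


(** * A Caputo-type integral solves the Airy equation *)

Section caputo_airy_ode.
Variable R : realType.
Implicit Types (f g h F : R -> R) (x y a b r v : R) (D : set R).
Notation mu := (@lebesgue_measure R).
Notation igr D f := (mu.-integrable D (EFin \o f)).
Notation pos := (`]0, +oo[%classic : set R).
Notation uni := (`]0, 1[%classic : set R).
Notation b3 := (bb R).

Definition Yint (m k : nat) x v : R := WW v * (AA k (x / v) / v ^+ m).
(** YY 0 1 is what the Caputo integral of an Airy average becomes after s = t
    v^3; m counts the powers of v that each differentiation in x brings out.
    *)
Definition YY (m k : nat) x : R := \int[mu]_(v in uni) Yint m k x v.

Let muni : measurable uni. Proof. exact: measurable_itv. Qed.

Lemma AA_div_le m k : exists2 C, 0 <= C & forall x v, 0 < x -> 0 < v ->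
  `|AA k (x / v) / v ^+ m| <= C / x ^+ m.
Proof.
have [C C0 HC] := AA_pow R m k; exists C => // x v x0 v0.
have vm : 0 < v ^+ m by rewrite exprn_gt0.
have xm : 0 < x ^+ m by rewrite exprn_gt0.
have := HC (x / v) (divr_ge0 (ltW x0) (ltW v0)).
rewrite ler_pdivlMr// normf_div (gtr0_norm vm) expr_div_n.
apply: le_trans; rewrite le_eqVlt; apply/orP; left; apply/eqP; field.
by rewrite gt_eqF.
Qed.

Lemma Yint_ct2 m k x v : 0 < v < 1 -> {for v, continuous (Yint m k x)}.
Proof.
move=> hv; have /andP[v0 _] := hv; have vn : v != 0 by rewrite gt_eqF.
have [d dW] := WW_dv hv.
rewrite /Yint; apply: ctM; first exact: WW_ct.
apply: ctM; last by apply: dv_ct; dvs; [rewrite expf_neq0|reflexivity].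
apply: (@ct_comp R (AA k) (fun v => x / v)); first exact: AA_ct.
by apply: dv_ct; dvs; [done|reflexivity].
Qed.

Lemma Yint_meas m k x : measurable_fun uni (Yint m k x).
Proof. by apply: meas_cont => [|v]; [exact: open_oo|rewrite ooE; exact: Yint_ct2]. Qed.

Lemma Yint_le m k : exists2 C, 0 <= C & forall x v, 0 < x -> 0 < v < 1 ->
  `|Yint m k x v| <= C / x ^+ m * WW v.
Proof.
have [C C0 HC] := AA_div_le m k; exists C => // x v x0 hv; have /andP[v0 _] := hv.
rewrite /Yint normrM mulrC (gtr0_norm (WW_gt0 hv)) ler_wpM2r ?HC//.
exact/ltW/WW_gt0.
Qed.

Lemma Yint_igr m k x : 0 < x -> igr uni (Yint m k x).
Proof.
move=> x0; have [C C0 HC] := Yint_le m k.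
apply: (@igr_le R uni _ (fun v => C / x ^+ m * WW v)); [exact: muni|exact: Yint_meas| |].
  by apply: igrZ => //; exact: WW_igr.
by move=> v; rewrite ooE; exact: HC.
Qed.

Lemma YY_dv m k x : 0 < x -> dv (YY m k) x (YY m.+1 k.+1 x).
Proof.
move=> x0; have [C C0 HC] := Yint_le m.+1 k.+1.
apply: (@int_dv R uni (Yint m k) (Yint m.+1 k.+1) (fun v => C / (x / 2) ^+ m.+1 * WW v) (x / 2) (2 * x)) => //.
- by apply/andP; split; lra.
- by move=> z /andP[z1 _]; apply: Yint_igr; lra.
- move=> z v _; rewrite ooE => /andP[v0 v1]; have vn : v != 0 by rewrite gt_eqF.
  rewrite /Yint; apply: dv_eq.
    apply: dvM; first exact: dv_cst.
    apply: dvM; last exact: dv_cst.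
    apply: (@dv_comp R (AA k) (fun z => z / v)); first exact: AA_dv.
    by dvs; reflexivity.
  by rewrite /= (exprS v m); field; rewrite vn expf_neq0.
- by apply: igrZ => //; exact: WW_igr.
- move=> z v /andP[z1 _]; rewrite ooE => hv.
  apply: le_trans (HC z v _ hv) _; first lra.
  rewrite ler_wpM2r ?(ltW (WW_gt0 hv))// ler_wpM2l//.
  rewrite lef_pV2 ?posrE ?exprn_gt0 ?lerXn2r ?nnegrE//; lra.
Qed.

(** The integrand of YY 2 3 x - x * YY 0 1 x is the derivative in v of - (1 -
    v^3)^(1/3) AA 0 (x/v) / v, which vanishes at both ends. *)
Lemma YY2 x : 0 < x -> YY 2 3 x = x * YY 0 1 x.
Proof.
move=> x0.
pose F v := - (qq v * (AA 0 (x / v) / v)).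
have E v : 0 < v -> AA 3 (x / v) = x / v * AA 1 (x / v) + AA 0 (x / v).
  by move=> v0; rewrite AA_rec mul1r.
have dF v : 0 < v < 1 -> dv F v (Yint 2 3 x v - x * Yint 0 1 x v).
  move=> hv; have /andP[v0 v1] := hv; have vn : v != 0 by rewrite gt_eqF.
  have qn : qq v != 0 by rewrite gt_eqF// qq_gt0.
  rewrite /F /Yint /WW E// expr0; apply: dv_eq.
    apply: dvN; apply: dvM; first exact: qq_dv.
    apply: dvM; last by apply: (@dvV R (fun v => v)); [done|exact: dv_id].
    apply: (@dv_comp R (AA 0) (fun v => x / v)); first exact: AA_dv.
    by dvs; [done|reflexivity].
  rewrite /=.
  have q3 := qq_cube hv.
  set A0 := AA 0 _; set A1 := AA 1 _; set q := qq v in q3 qn *.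
  have -> : - (- v ^+ 2 / q ^+ 2 * (A0 / v) +
    q * (A1 * (0 / v + x * (-1 / v ^+ 2)) / v + A0 * (-1 / v ^+ 2))) =
    (q ^+ 2)^-1 * ((v * A0) + q ^+ 3 * (A1 * x / v ^+ 3 + A0 / v ^+ 2)).
    by field; rewrite vn qn.
  by rewrite q3; field; rewrite vn qn.
have ctd v : 0 < v < 1 -> {for v, continuous (fun v => Yint 2 3 x v - x * Yint 0 1 x v)}.
  move=> hv; apply: cvgB; first exact: Yint_ct2.
  by apply: cvgM; [exact: cvg_cst|exact: Yint_ct2].
have i2 := Yint_igr 2 3 x0; have i0 := Yint_igr 0 1 x0.
have : \int[mu]_(v in uni) (Yint 2 3 x v - x * Yint 0 1 x v) = 0 - 0.
  apply: (@ftc_oo R _ F) => //; last by apply: igrB => //; exact: igrZ.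
  - have [C C0 HC] := AA_div_le 2 0.
    apply: (@le_cvg0 _ _ _ _ _ (fun v => C / x ^+ 2 * v)); last first.
      rewrite -[X in _ --> X](mulr0 (C / x ^+ 2)); apply: cvgM; first exact: cvg_cst.
      exact: cvg_at_right_filter.
    near=> v.
    have v0 : 0 < v by near: v; exact: nbhs_right_gt.
    have v1 : v < 1 by near: v; exact: nbhs_right_lt.
    have hv : 0 < v < 1 by rewrite v0.
    rewrite /F normrN normrM; apply: (@le_trans _ _ (1 * `|AA 0 (x / v) / v|)).
      rewrite ler_wpM2r// (gtr0_norm (qq_gt0 hv)).
      rewrite -(@ler_pXn2r _ 3) ?nnegrE ?(ltW (qq_gt0 hv))// qq_cube// expr1n.
      by rewrite gerDl oppr_le0 exprn_ge0// ltW.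
    have -> : AA 0 (x / v) / v = AA 0 (x / v) / v ^+ 2 * v by field; rewrite gt_eqF.
    by rewrite mul1r normrM (gtr0_norm v0) ler_wpM2r ?HC// ltW.
  - have [C C0 HC] := AA_div_le 1 0.
    apply: (@le_cvg0 _ _ _ _ _ (fun v => C / x ^+ 1 * qq v)).
      near=> v.
      have v0 : 0 < v by near: v; exact: nbhs_left_gt.
      have v1 : v < 1 by near: v; exact: nbhs_left_lt.
      have hv : 0 < v < 1 by rewrite v0.
      rewrite /F normrN normrM mulrC (gtr0_norm (qq_gt0 hv)).
      by rewrite ler_wpM2r ?(ltW (qq_gt0 hv))// -{2}[v]expr1; exact: HC.
    rewrite -[X in _ --> X](mulr0 (C / x ^+ 1)); apply: cvgM; first exact: cvg_cst.
    apply: powR_cvg0'; first by rewrite invr_gt0.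
      near=> v; have v0 : 0 < v by near: v; exact: nbhs_left_gt.
      have v1 : v < 1 by near: v; exact: nbhs_left_lt.
      by apply/ltW/cube_lt1; rewrite v0.
    rewrite (_ : 0 = 1 - 1 ^+ 3); last by rewrite expr1n subrr.
    apply: cvg_at_left_filter; apply: (@dv_ct R (fun v => 1 - v ^+ 3)); dvs; reflexivity.
rewrite RintB//; last exact: igrZ.
by rewrite RintZ// subrr => /eqP; rewrite subr_eq0 => /eqP.
Unshelve. all: by end_near. Qed.

Lemma YY_zero : YY 0 1 x @[x --> 0^'+] --> AA 1 0 * \int[mu]_(v in uni) WW v.
Proof.
have [C C0 HC] := Yint_le 0 1.
have := @int_cvg_right R uni (Yint 0 1) (fun v => AA 1 0 * WW v) (fun v => C * WW v) 0 1 muni ltr01.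
rewrite (RintZ (AA 1 0) muni (@WW_igr R)).
apply.
- by move=> x _; exact: Yint_meas.
- move=> v; rewrite ooE => /andP[v0 v1].
  rewrite /Yint (mulrC (AA 1 0)); apply: cvgM; first exact: cvg_cst.
  under eq_fun do rewrite expr0 divr1.
  apply: cvg_at_right_filter.
  rewrite (_ : AA 1 0 = AA 1 (0 / v)); last by rewrite mul0r.
  apply: (@ct_comp R (AA 1) (fun x => x / v) 0 (@AA_ct R 1 (0 / v))).
  by apply: dv_ct; dvs; reflexivity.
- by apply: igrZ => //; exact: WW_igr.
- by move=> x v /andP[x0 _]; rewrite ooE => hv; have := HC x v x0 hv; rewrite expr0 divr1.
Qed.

Lemma YY_le m k : exists2 C, 0 <= C & forall x, 0 < x -> `|YY m k x| <= C / x ^+ m.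
Proof.
have [C C0 HC] := Yint_le m k; have iW := @WW_igr R.
exists (C * \int[mu]_(v in uni) WW v).
  by rewrite mulr_ge0//; apply: Rintegral_ge0 => v; rewrite ooE => /WW_gt0/ltW.
move=> x x0; rewrite mulrAC -RintZ//; apply: Rint_le_norm => //.
- exact: Yint_meas.
- exact: igrZ.
- by move=> v; rewrite ooE; exact: HC.
Qed.

Definition yc : R := AA 1 0 * (\int[mu]_(v in uni) WW v) / AA 0 0.

Lemma I3_gt0 : 0 < I3 R.
Proof.
have i1 : igr uni (fun=> expR (- 3^-1)) by exact: igr_cst_oo.
have mp := @mpos R.
have i : igr pos (fun r => expR (- r ^+ 3 / 3)).
  have [M M0 HM] := @pow_exp_bound R 0 0.
  apply: (@igr_le R pos _ (fun r => M * expR (- r))) => //; last 2 first.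
  - exact: igr_dom.
  - move=> r; rewrite in_posE => r0; rewrite ger0_norm ?expR_ge0//.
    by have := HM r (ltW r0); rewrite expr0 mul1r mul0r addr0.
  - by apply: meas_cont => [|u _]; [exact: open_pos|apply: dv_ct; dvs; reflexivity].
have sub : uni `<=` pos by move=> r; rewrite ooE in_posE => /andP[].
apply: (@lt_le_trans _ _ (\int[mu]_(r in uni) expR (- 3^-1))).
  rewrite Rintegral_cst//= lebesgue_measure_itv/= lte_fin ltr01 oppr0 adde0/= mulr1.
  exact: expR_gt0.
rewrite /I3 -(Rint_patch _ sub); apply: Rint_le => //.
- by rewrite -restrict_EFin; apply/(@integrable_restrict _ _ _ mu) => //; rewrite (setIidr sub).
- move=> r; rewrite in_posE => r0; have [ri|ri] := pselect (uni r); last first.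
    by rewrite patchE1// expR_ge0.
  rewrite patchE0// ler_expR.
  move: ri; rewrite ooE => /andP[_ r1].
  have : r ^+ 3 <= 1 by rewrite exprn_ile1// ltW.
  lra.
Qed.

Lemma AA00_gt0 : 0 < AA 0 (0 : R).
Proof. by rewrite AA00 mulr_gt0 ?I3_gt0// divr_gt0 ?bb_gt0 ?pi_gt0. Qed.

(** YY 0 1 - yc * AA 0 solves the Airy equation, vanishes at 0 by the choice
    of yc, and decays at infinity. *)
Lemma YYE x : 0 < x -> YY 0 1 x = yc * AA 0 x.
Proof.
have A0 := AA00_gt0.
move=> x0; apply/eqP; rewrite -subr_eq0; apply/eqP.
apply: (@airy_ode_uniq R (fun x => YY 0 1 x - yc * AA 0 x) (fun x => YY 1 2 x - yc * AA 1 x)) => //.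
- move=> z z0; apply: dv_eq.
    by apply: dvB; [exact: YY_dv|apply: dvM; [exact: dv_cst|exact: AA_dv]].
  by rewrite /=; ring.
- move=> z z0; apply: dv_eq.
    by apply: dvB; [exact: YY_dv|apply: dvM; [exact: dv_cst|exact: AA_dv]].
  by rewrite /= YY2// AA2; ring.
- rewrite [X in _ --> X](_ : _ = AA 1 0 * \int[mu]_(v in uni) WW v - yc * AA 0 0).
    apply: cvgB; first exact: YY_zero.
    by apply: cvgM; [exact: cvg_cst|apply: ct_right; exact: AA_ct].
  by rewrite /yc divfK ?subrr// gt_eqF.
- have [C1 C10 H1] := YY_le 1 2; have [C2 C20 H2] := AA_bound R 1.
  have [C3 C30 H3] := YY_le 1 1; have [C4 C40 H4] := AA_bound R 0.
  have [C5 C50 H5] := YY_le 0 1.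
  have cx (C : R) : C / x @[x --> +oo] --> 0.
    rewrite -(mulr0 C); apply: cvgM; first exact: cvg_cst.
    by apply/gtr0_cvgV0; [near=> z|exact: cvg_id].
  apply: (@le_cvg0 _ _ _ _ _ (fun z => (C5 + `|yc| * C4) * (C1 / z + `|yc| * `|AA 1 z|))).
    near=> z; have z0 : 0 < z by near: z; apply: nbhs_pinfty_gt; rewrite num_real.
    rewrite normrM; apply: ler_pM => //.
      apply: le_trans (ler_normB _ _) _; apply: lerD.
        by have := H5 z z0; rewrite expr0 divr1.
      by rewrite normrM ler_wpM2l// H4// ltW.
    apply: le_trans (ler_normB _ _) _; apply: lerD; last by rewrite normrM.
    by have := H1 z z0; rewrite expr1.
  rewrite -[X in _ --> X](mulr0 (C5 + `|yc| * C4)); apply: cvgM; first exact: cvg_cst.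
  rewrite -[X in _ --> X]addr0; apply: cvgD; first exact: cx.
  rewrite -[X in _ --> X](mulr0 `|yc|); apply: cvgM; first exact: cvg_cst.
  by rewrite -(normr0 R); apply: cvg_norm; exact: AA_cvg0.
Unshelve. all: by end_near. Qed.

End caputo_airy_ode.


(** * The Caputo-type integral is a multiple of Ai *)

Section caputo_airy.
Variable R : realType.
Implicit Types (f g h F : R -> R) (x y a b r v : R) (D : set R).
Notation mu := (@lebesgue_measure R).
Notation igr D f := (mu.-integrable D (EFin \o f)).
Notation pos := (`]0, +oo[%classic : set R).
Notation uni := (`]0, 1[%classic : set R).
Notation b3 := (bb R).

Let muni : measurable uni. Proof. exact: measurable_itv. Qed.

Lemma int_vW : igr uni (fun v => v * WW v) /\
  \int[mu]_(v in uni) (v * WW v) = pi / (3 * b3).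
Proof.
have b0 := bb_gt0 R; have b2 := bb_sq R; have pi0 := pi_gt0 R.
have bn : b3 != 0 by rewrite gt_eqF.
pose Dv v := v ^+ 2 - v * qq v + qq v ^+ 2.
(* the primitive of w / (1 + w^3) at w = v / qq v, by partial fractions *)
pose F v := 6^-1 * (ln (Dv v) - 2 * ln (qq v + v))
  + (2 * b3)^-1 * atan ((2 * v - qq v) / (2 * b3 * qq v)).
have D1 v : 0 < v < 1 -> Dv v * (qq v + v) = 1.
  move=> hv; have q3 := qq_cube hv.
  have -> : Dv v * (qq v + v) = qq v ^+ 3 + v ^+ 3 by rewrite /Dv; ring.
  by rewrite q3; ring.
have dF v : 0 < v < 1 -> dv F v (v * WW v).
  move=> hv; have /andP[v0 v1] := hv; have q0 := qq_gt0 hv.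
  have qn : qq v != 0 by rewrite gt_eqF.
  have qv0 : 0 < qq v + v by lra.
  have D0 : 0 < Dv v by rewrite -(pmulr_lgt0 _ qv0) D1.
  rewrite /F; apply: dv_eq.
    apply: dvD; apply: dvM; try exact: dv_cst.
      apply: dvB.
        apply: (@dv_ln R Dv) => //; rewrite /Dv; apply: dvD.
          apply: dvB; first by apply: dvX; exact: dv_id.
          by apply: dvM; [exact: dv_id|exact: qq_dv].
        by apply: dvX; exact: qq_dv.
      apply: dvM; first exact: dv_cst.
      by apply: (@dv_ln R (fun v => qq v + v)) => //; apply: dvD; [exact: qq_dv|exact: dv_id].
    apply: (@dv_atan R (fun v => (2 * v - qq v) / (2 * b3 * qq v))).
    apply: dvM; first by apply: dvB; [apply: dvM; [exact: dv_cst|exact: dv_id]|exact: qq_dv].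
    apply: (@dvV R (fun v => 2 * b3 * qq v)); first by rewrite !mulf_neq0.
    by apply: dvM; [exact: dv_cst|exact: qq_dv].
  have e1 : (Dv v)^-1 = qq v + v.
    by rewrite -[LHS]mulr1 -(D1 v hv) mulKf// gt_eqF.
  have e2 : (qq v + v)^-1 = Dv v.
    by rewrite -[LHS]mul1r -(D1 v hv) mulfK// gt_eqF.
  have e3 : (1 + ((2 * v - qq v) / (2 * b3 * qq v)) ^+ 2)^-1 = b3 ^+ 2 * qq v ^+ 2 * (qq v + v).
    rewrite -e1; have -> : 1 + ((2 * v - qq v) / (2 * b3 * qq v)) ^+ 2 = Dv v / (b3 ^+ 2 * qq v ^+ 2).
      have -> : Dv v = (4 * b3 ^+ 2 * qq v ^+ 2 + (2 * v - qq v) ^+ 2) / 4.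
        by rewrite b2 /Dv; field.
      by field; rewrite qn bn.
    by rewrite invf_div.
  rewrite /= e1 e2 e3.
  have q3 := qq_cube hv.
  have -> : v * WW v = v * (qq v ^+ 3 + v ^+ 3) / qq v ^+ 2.
    by rewrite q3 /WW subrK mulr1.
  by rewrite /Dv; field; rewrite qn bn.
have ctf v : 0 < v < 1 -> {for v, continuous (fun v => v * WW v)}.
  by move=> hv; apply: ctM; [exact: cvg_id|exact: WW_ct].
have f0 v : 0 < v < 1 -> 0 <= v * WW v.
  by move=> hv; have /andP[v0 _] := hv; rewrite mulr_ge0 ?ltW// WW_gt0.
have lncvg (T : Type) (FF : set_system T) (FFF : Filter FF) (f : T -> R) :
    f t @[t --> FF] --> (1 : R) -> ln (f t) @[t --> FF] --> (0 : R).
  move=> fc; rewrite -(@ln1 R).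
  exact: (cvg_comp _ _ fc (@continuous_ln R 1 ltr01)).
have atan6 : atan ((2 * b3)^-1) = pi / 6.
  rewrite -[RHS]tanK; last by rewrite in_itv/=; apply/andP; split; lra.
  congr atan; rewrite /tan.
  have -> : pi / 6 = pi / 2 - pi / 3 :> R by field.
  by rewrite sinB cosB sin_pihalf cos_pihalf sin_pi3 cos_pi3; field.
have q00 : qq (0 : R) = 1.
  by rewrite /qq expr0n/= subr0 /cbrt powR1.
have Fl : F v @[v --> 0^'+] --> F 0.
  have dq : exists d, dv (@qq R) 0 d.
    eexists; rewrite /qq; apply: (@dv_cbrt R (fun v => 1 - v ^+ 3)).
      by rewrite expr0n/= subr0.
    by dvs; reflexivity.
  have [d hd] := dq; apply: ct_right; apply: (@dv_ct R F 0 _ (_ : dv F 0 _)).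
  rewrite /F; apply: dvD; apply: dvM; try exact: dv_cst.
    apply: dvB.
      apply: (@dv_ln R Dv); first by rewrite /Dv q00; lra.
      apply: dvD.
        apply: dvB; first by apply: dvX; exact: dv_id.
        by apply: dvM; [exact: dv_id|exact: hd].
      by apply: dvX; exact: hd.
    apply: dvM; first exact: dv_cst.
    apply: (@dv_ln R (fun v => qq v + v)); first by rewrite q00; lra.
    by apply: dvD; [exact: hd|exact: dv_id].
  apply: (@dv_atan R (fun v => (2 * v - qq v) / (2 * b3 * qq v))).
  apply: dvM; first by apply: dvB; [apply: dvM; [exact: dv_cst|exact: dv_id]|exact: hd].
  apply: (@dvV R (fun v => 2 * b3 * qq v)); first by rewrite q00 !mulf_neq0.
  by apply: dvM; [exact: dv_cst|exact: hd].
have q1 : @qq R v @[v --> 1^'-] --> (0 : R).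
  apply: powR_cvg0'; first by rewrite invr_gt0.
    near=> v; have v0 : 0 < v by near: v; exact: nbhs_left_gt.
    have v1 : v < 1 by near: v; exact: nbhs_left_lt.
    by apply/ltW/cube_lt1; rewrite v0.
  rewrite [X in _ --> X](_ : _ = 1 - 1 ^+ 3); last by rewrite expr1n subrr.
  apply: cvg_at_left_filter; apply: (@dv_ct R (fun v => 1 - v ^+ 3)); dvs; reflexivity.
have vv1 : v @[v --> (1 : R)^'-] --> (1 : R) by exact: cvg_at_left_filter.
have Fr : F v @[v --> 1^'-] --> (2 * b3)^-1 * (pi / 2).
  rewrite -[X in _ --> X]add0r; apply: cvgD.
    rewrite -[X in _ --> X](mulr0 6^-1); apply: cvgM; first exact: cvg_cst.
    rewrite -[X in _ --> X](subrr 0); apply: cvgB.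
      apply: lncvg; rewrite [X in _ --> X](_ : _ = 1 ^+ 2 - 1 * 0 + 0 ^+ 2); last first.
        by rewrite expr1n mulr0 expr0n/= subr0 addr0.
      rewrite /Dv; apply: cvgD; first apply: cvgB.
      - by under eq_fun do rewrite expr2; rewrite expr2; exact: cvgM.
      - exact: cvgM.
      - by under eq_fun do rewrite expr2; rewrite expr2; exact: cvgM.
    rewrite -[X in _ --> X](mulr0 2); apply: cvgM; first exact: cvg_cst.
    by apply: lncvg; rewrite -[X in _ --> X]add0r; exact: cvgD.
  apply: cvgM; first exact: cvg_cst.
  suff H : ((2 * v - qq v) / (2 * b3 * qq v)) @[v --> 1^'-] --> +oo.
    exact: (cvg_comp _ _ H (@cvgy_atan R)).
  apply/gtr0_cvgV0.
    near=> v; have v0 : 2^-1 < v by near: v; apply: nbhs_left_gt; lra.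
    have v1 : v < 1 by near: v; exact: nbhs_left_lt.
    have hv : 0 < v < 1 by apply/andP; split; lra.
    have q0 := qq_gt0 hv; rewrite divr_gt0 ?mulr_gt0// subr_gt0.
    apply: (@le_lt_trans _ _ 1); last lra.
    rewrite -(@ler_pXn2r _ 3) ?nnegrE ?(ltW q0)// qq_cube// expr1n.
    by rewrite gerDl oppr_le0 exprn_ge0//; lra.
  rewrite [X in X @ _ --> _](_ : _ = (fun v => 2 * b3 * qq v / (2 * v - qq v))); last first.
    by apply/funext => v /=; rewrite invf_div.
  rewrite [X in _ --> X](_ : _ = 2 * b3 * 0 / (2 * 1 - 0)); last by rewrite mulr0 mul0r.
  apply: cvgM; first by apply: cvgM; [exact: cvg_cst|].
  apply: cvgV; first by rewrite mulr1 subr0.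
  by apply: cvgB => //; apply: cvgM => //; exact: cvg_cst.
have [h1 h2] := @ftc_oo_ge0 R _ F 0 1 _ _ ltr01 dF ctf f0 Fl Fr.
split => //; rewrite h2 /F /Dv q00.
rewrite !(expr0n, mul0r, mulr0, subr0, add0r, addr0, sub0r, expr1n, ln1, oppr0)/=.
by rewrite mulr1 mulN1r atanN atan6; field.
Unshelve. all: by end_near. Qed.

(** Integrating in x first leaves the integral of v (1 - v^3)^(-2/3), which
    has an elementary primitive (int_vW). *)
Lemma YY01_int : igr pos (@YY R 0 1) /\ \int[mu]_(x in pos) YY 0 1 x = - AA 0 0 * (pi / (3 * b3)).
Proof.
have mp := @mpos R.
have [ivW evW] := int_vW.
pose f v x := Yint 0 1 x v.
have ctA x : 0 < x -> {for x, continuous (@AA R 1)} by move=> _; exact: AA_ct.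
have fE v x : 0 < v -> f v x = WW v * AA 1 (v^-1 * x).
  by move=> v0; rewrite /f /Yint expr0 divr1 (mulrC x).
have vi v : 0 < v < 1 -> 0 < v^-1 by move=> /andP[v0 _]; rewrite invr_gt0.
have i2 v : uni v -> igr pos (f v).
  rewrite ooE => hv; have /andP[v0 _] := hv.
  apply: (@igr_eq R pos (fun x => WW v * AA 1 (v^-1 * x))) => //.
    by move=> x _; rewrite fE.
  by apply: igrZ => //; apply/(scale_igr (vi v hv) ctA); exact: AA_igr0.
have iA := igr_norm mp (AA_igr0 R 1).
pose M := \int[mu]_(x in pos) `|AA 1 x|.
have ctAn x : 0 < x -> {for x, continuous (fun x => `|AA 1 x| : R)}.
  by move=> _; apply: ct_norm; exact: AA_ct.
have c1 v x : uni v -> pos x -> {for x, continuous (f v)}.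
  rewrite ooE => hv _; have /andP[v0 _] := hv.
  rewrite (_ : f v = fun x => WW v * AA 1 (v^-1 * x)); last by apply/funext => z; rewrite fE.
  apply: ctM; first exact: ct_cst.
  apply: (@ct_comp R (AA 1) (fun x => v^-1 * x)); first exact: AA_ct.
  by apply: dv_ct; dvs; reflexivity.
have c2 v x : uni v -> pos x -> {for v, continuous (f ^~ x)}.
  by rewrite ooE => hv _; exact: Yint_ct2.
have i1 x : pos x -> igr uni (f ^~ x) by rewrite in_posE => hx; exact: Yint_igr.
have bd v : uni v -> \int[mu]_(x in pos) `|f v x| <= M * (v * WW v).
  rewrite ooE => hv; have /andP[v0 _] := hv.
  rewrite (@Rint_eq R pos _ (fun x => WW v * `|AA 1 (v^-1 * x)|)); last first.
    by move=> x _; rewrite fE// normrM (gtr0_norm (WW_gt0 hv)).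
  rewrite (RintZ (WW v) mp); last exact/(scale_igr (f := fun x => `|AA 1 x|) (vi v hv) ctAn).
  rewrite (@scale_int R (fun x => `|AA 1 x|) _ (vi v hv) ctAn iA) invrK -/M.
  by rewrite le_eqVlt; apply/orP; left; apply/eqP; ring.
have mf := sepcont_meas (@open_oo R 0 1) (@open_pos R) c1 c2.
have [h1 h2 h3] := @fubini_R R uni pos f (fun v => M * (v * WW v)) muni mp mf i2 i1
  (igrZ M muni ivW) bd.
split; first exact: h2.
rewrite -[LHS]h3 (@Rint_eq R uni _ (fun v => - AA 0 0 * (v * WW v))).
  by rewrite (RintZ (- AA 0 0) muni ivW) evW.
move=> v; rewrite ooE => hv; have /andP[v0 _] := hv.
rewrite (@Rint_eq R pos _ (fun x => WW v * AA 1 (v^-1 * x))); last first.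
  by move=> x _; rewrite fE.
rewrite (RintZ (WW v) mp); last by apply/(scale_igr (vi v hv) ctA); exact: AA_igr0.
by rewrite (scale_int (vi v hv) ctA (AA_igr0 R 1)) invrK int_AA; ring.
Qed.

Lemma ycE : yc R = - I3 R.
Proof.
have [_ H] := YY01_int; have mp := @mpos R; have pi0 := pi_gt0 R; have b0 := bb_gt0 R.
move: H; rewrite (@Rint_eq R pos _ (fun x => yc R * AA 0 x)); last first.
  by move=> x; rewrite in_posE; exact: YYE.
rewrite (RintZ (yc R) mp (AA_igr0 R 0)) int_AA0 AA00 => /(congr1 (fun z => z * 3)).
rewrite mulfVK// => ->.
by move: (pi : R) pi0 => p p0; field; rewrite !gt_eqF.
Qed.

(** The constant yc of YYE is found by comparing the integrals over the
    half-line, int_AA0 and YY01_int. *)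
Lemma YY_airy x : 0 < x -> YY 0 1 x = - I3 R * AA 0 x.
Proof. by move=> x0; rewrite YYE// ycE. Qed.

End caputo_airy.


(** * Schwartz functions *)

Section schwartz_functions.
Variable R : realType.
Implicit Types (f g h F phi : R -> R) (x y a b r v s : R) (D : set R).
Notation mu := (@lebesgue_measure R).
Notation igr D f := (mu.-integrable D (EFin \o f)).
Notation pos := (`]0, +oo[%classic : set R).

Lemma schwartz_dv phi n x : schwartz phi -> dv (derive1n n phi) x (derive1n n.+1 phi x).
Proof.
case=> d _; rewrite /dv; apply: DeriveDef; first exact: d.
by rewrite derive1nS derive1E.
Qed.

Lemma schwartz_dv0 phi x : schwartz phi -> dv phi x (derive1 phi x).
Proof. by move=> /(schwartz_dv 0 x). Qed.

Lemma schwartz_ct phi n x : schwartz phi -> {for x, continuous (derive1n n phi)}.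
Proof. by move=> /(schwartz_dv n x)/dv_ct. Qed.

Lemma schwartz_derive phi : schwartz phi -> schwartz (derive1 phi).
Proof.
case=> d b; split=> [n x|m n]; first by have := d n.+1 x; rewrite derive1Sn.
by have [C HC] := b m n.+1; exists C => x; have := HC x; rewrite derive1Sn.
Qed.

Lemma schwartz_derive1n phi n : schwartz phi -> schwartz (derive1n n phi).
Proof.
move=> sp; elim: n => [//|n IH]; rewrite derive1nS; exact: schwartz_derive.
Qed.

(** The iterated derivatives of a function that comes with explicit
    candidates; this avoids computing derive1n. *)
Lemma derive1n_seq (fs : nat -> R -> R) : (forall n x, dv (fs n) x (fs n.+1 x)) ->
  forall n, derive1n n (fs 0) = fs n.
Proof.
move=> H; elim=> [//|n IH]; rewrite derive1nS IH; apply/funext => x.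
by have /dv_derive1[] := H n x.
Qed.

Lemma schwartz_seq (fs : nat -> R -> R) : (forall n x, dv (fs n) x (fs n.+1 x)) ->
  (forall m n, exists C, forall x, `|x ^+ m * fs n x| <= C) -> schwartz (fs 0).
Proof.
move=> H b; have E := derive1n_seq H; split=> [n x|m n]; rewrite E.
  by have /dv_derive1[] := H n x.
exact: b.
Qed.

Lemma derive1n_mulx phi : schwartz phi -> forall n,
  derive1n n (fun x => x * phi x) =
  fun x => x * derive1n n phi x + n%:R * derive1n n.-1 phi x.
Proof.
move=> sp n; pose fs n x := x * derive1n n phi x + n%:R * derive1n n.-1 phi x.
have -> : (fun x => x * phi x) = fs 0 by apply/funext => x; rewrite /fs mul0r addr0.
apply: derive1n_seq => {}n x.
apply: dv_eq; first by apply: dvD; apply: dvM; [exact: dv_id|exact: schwartz_dv|exact: dv_cst|exact: schwartz_dv].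
by rewrite /fs; case: n => [|n] /=; rewrite -?natr1; ring.
Qed.

Lemma schwartz_mulx phi : schwartz phi -> schwartz (fun x => x * phi x).
Proof.
move=> sp; have E := derive1n_mulx sp.
pose fs n x := x * derive1n n phi x + n%:R * derive1n n.-1 phi x.
have -> : (fun x => x * phi x) = fs 0 by apply/funext => x; rewrite /fs mul0r addr0.
have [_ b] := sp; apply: schwartz_seq => [n x|m n].
  apply: dv_eq; first by apply: dvD; apply: dvM; [exact: dv_id|exact: schwartz_dv|exact: dv_cst|exact: schwartz_dv].
  by rewrite /fs; case: n => [|n] /=; rewrite -?natr1; ring.
have [C1 H1] := b m.+1 n; have [C2 H2] := b m n.-1; exists (C1 + n%:R * C2) => x.
rewrite /fs mulrDr; apply: le_trans (ler_normD _ _) _; apply: lerD.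
  by rewrite mulrA -exprSr.
by rewrite mulrCA normrM normr_nat ler_wpM2l.
Qed.

Lemma schwartz_bound phi m n : schwartz phi ->
  exists2 C, 0 <= C & forall x, (1 + x ^+ 2) ^+ m * `|derive1n n phi x| <= C.
Proof.
move=> [_ b]; have [C1 H1] := b 0 n; have [C2 H2] := b (2 * m)%N n.
have h1 x : `|derive1n n phi x| <= C1 by have := H1 x; rewrite expr0 mul1r.
have h2 x : (x ^+ 2) ^+ m * `|derive1n n phi x| <= C2.
  by have := H2 x; rewrite normrM exprM (ger0_norm (exprn_ge0 _ (sqr_ge0 x))).
have C10 : 0 <= C1 by apply: le_trans (h1 0).
have C20 : 0 <= C2 by apply: le_trans (h2 0); rewrite mulr_ge0// exprn_ge0// sqr_ge0.
exists (2 ^+ m * (C1 + C2)); first by rewrite mulr_ge0 ?exprn_ge0 ?addr_ge0.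
move=> x; have x2 := sqr_ge0 x.
apply: (@le_trans _ _ (2 ^+ m * (1 + (x ^+ 2) ^+ m) * `|derive1n n phi x|)).
  rewrite ler_wpM2r//; have [x1|x1] := leP (x ^+ 2) 1.
    apply: (@le_trans _ _ (2 ^+ m)).
      by rewrite lerXn2r ?nnegrE//; lra.
    by rewrite ler_peMr ?exprn_ge0// lerDl exprn_ge0.
  apply: (@le_trans _ _ ((2 * x ^+ 2) ^+ m)).
    by rewrite lerXn2r ?nnegrE//; lra.
  by rewrite exprMn ler_wpM2l ?exprn_ge0// lerDr.
by rewrite -mulrA ler_wpM2l ?exprn_ge0// mulrDl mul1r lerD.
Qed.

(** A translate of the Lorentzian, the integrable majorant of all translates
    of Schwartz functions. *)
Definition JJ y x : R := (1 + (x + y) ^+ 2)^-1.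

Lemma JJ_den y x : 0 < 1 + (x + y) ^+ 2.
Proof. by rewrite ltr_pwDl// sqr_ge0. Qed.

Lemma JJ_gt0 y x : 0 < JJ y x.
Proof. by rewrite invr_gt0 JJ_den. Qed.

Lemma schwartz_JJ phi n : schwartz phi ->
  exists2 C, 0 <= C & forall y x, `|derive1n n phi (x + y)| <= C * JJ y x.
Proof.
move=> sp; have [C C0 HC] := schwartz_bound 1 n sp; exists C => // y x.
by rewrite /JJ ler_pdivlMr ?JJ_den// mulrC -[1 + _]expr1.
Qed.

Lemma schwartz_JJ2 phi n : schwartz phi ->
  exists2 C, 0 <= C & forall y x,
    (1 + x ^+ 2) * `|derive1n n phi (x + y)| <= C * (1 + y ^+ 2) * JJ y x.
Proof.
move=> sp; have [C C0 HC] := schwartz_bound 2 n sp; exists (2 * C).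
  by rewrite mulr_ge0.
move=> y x; rewrite /JJ ler_pdivlMr ?JJ_den//.
have h : 1 + x ^+ 2 <= 2 * (1 + y ^+ 2) * (1 + (x + y) ^+ 2).
  have := sqr_ge0 (x + 2 * y); have := sqr_ge0 (y * (x + y)); have := sqr_ge0 x; nra.
have D0 := JJ_den y x.
apply: (@le_trans _ _ (2 * (1 + y ^+ 2) * (1 + (x + y) ^+ 2) * `|derive1n n phi (x + y)| * (1 + (x + y) ^+ 2))).
  by rewrite ler_wpM2r ?(ltW D0)// ler_wpM2r.
have := HC (x + y); have y0 : 0 <= 2 * (1 + y ^+ 2) by rewrite mulr_ge0// addr_ge0// sqr_ge0.
move=> /(ler_wpM2l y0) H.
apply: (@le_trans _ _ (2 * (1 + y ^+ 2) * C)); last by rewrite le_eqVlt; apply/orP; left; apply/eqP; ring.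
by apply: le_trans H; rewrite le_eqVlt; apply/orP; left; apply/eqP; ring.
Qed.

Lemma cvgNy_atan : atan x @[x --> -oo] --> - (pi / 2 : R).
Proof.
apply/cvgNy_compNP; rewrite (_ : _ \o _ = fun x => - atan x).
  by apply: cvgN; exact: cvgy_atan.
by apply/funext => x /=; rewrite atanN.
Qed.

Lemma JJ_igr y : igr setT (JJ y) /\ \int[mu]_x JJ y x = pi.
Proof.
have [|||||h1 h2] := @ftc_T_ge0 R (JJ y) (fun x => atan (x + y)) (- (pi / 2)) (pi / 2).
- by move=> x; rewrite /JJ; dvs; rewrite /=; ring.
- by move=> x; apply: dv_ct; rewrite /JJ; dvs; [rewrite gt_eqF ?JJ_den|reflexivity].
- by move=> x; exact/ltW/JJ_gt0.
- have H : x + y @[x --> -oo] --> -oo.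
    apply/cvgrNyPle => A; near=> x; rewrite -lerBrDr.
    by near: x; apply: nbhs_ninfty_le; rewrite num_real.
  exact: (cvg_comp _ _ H cvgNy_atan).
- have H : x + y @[x --> +oo] --> +oo.
    apply/cvgryPge => A; near=> x; rewrite -lerBlDr.
    by near: x; apply: nbhs_pinfty_ge; rewrite num_real.
  exact: (cvg_comp _ _ H (@cvgy_atan R)).
- by split => //; rewrite h2; field.
Unshelve. all: by end_near. Qed.

Lemma JJ_cvgy y : JJ y x @[x --> +oo] --> (0 : R).
Proof.
apply/gtr0_cvgV0; first by apply: nearW => x; exact: JJ_den.
apply/cvgryPge => A; near=> x.
have x1 : 1 <= x + y by rewrite -lerBlDr; near: x; apply: nbhs_pinfty_ge; rewrite num_real.
have : A <= x + y by rewrite -lerBlDr; near: x; apply: nbhs_pinfty_ge; rewrite num_real.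
nra.
Unshelve. all: by end_near. Qed.

Lemma JJ_cvgNy y : JJ y x @[x --> -oo] --> (0 : R).
Proof.
apply/gtr0_cvgV0; first by apply: nearW => x; exact: JJ_den.
apply/cvgryPge => A; near=> x.
have x1 : x + y <= - 1 by rewrite -lerBrDr; near: x; apply: nbhs_ninfty_le; rewrite num_real.
have : x + y <= - A by rewrite -lerBrDr; near: x; apply: nbhs_ninfty_le; rewrite num_real.
nra.
Unshelve. all: by end_near. Qed.

Lemma JJ_near y z x : `|z - y| <= 1 -> JJ z x <= 3 * JJ y x.
Proof.
move=> zy; rewrite /JJ ler_pdivlMr ?JJ_den// mulrC ler_pdivrMr ?JJ_den//.
have : (x + y) = (x + z) - (z - y) by ring.
move: zy; set d := z - y; rewrite ler_norml => /andP[d1 d2] ->.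
have := sqr_ge0 ((x + z) + d); have d3 : d ^+ 2 <= 1 by nra.
have := sqr_ge0 (x + z); nra.
Qed.

End schwartz_functions.


(** * The Schroedinger kernel *)

Section schroedinger_kernel.
Variable R : realType.
Implicit Types (f g h F phi k : R -> R) (x y a b r v s d : R) (D : set R).
Notation mu := (@lebesgue_measure R).
Notation igr D f := (mu.-integrable D (EFin \o f)).
Notation pos := (`]0, +oo[%classic : set R).

(** The real part of the Schroedinger kernel at time s with phase d; the phase
    is a parameter because differentiation in s shifts it by - pi / 2. *)
Definition KK d s x : R := (Num.sqrt (2 * pi * s))^-1 * cos (x ^+ 2 / (2 * s) + d).
(** The Schroedinger evolution of phi at time s, evaluated at y. The kernel is
    bounded but not integrable in x, so it is always paired with a Schwartz
    function. *)
Definition GG d phi s y : R := \int[mu]_x (KK d s x * phi (x + y)).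

Lemma ct_shift phi n y x : schwartz phi -> {for x, continuous (fun x => derive1n n phi (x + y))}.
Proof.
move=> sp; apply: (@ct_comp R (derive1n n phi) (fun x => x + y)); first exact: schwartz_ct.
by apply: dv_ct; dvs; reflexivity.
Qed.

Lemma poly2_ge1 x : 1 <= 1 + x ^+ 2.
Proof. by rewrite lerDl sqr_ge0. Qed.

Section against_schwartz.
Variables (phi : R -> R) (n : nat) (y : R).
Hypothesis sp : schwartz phi.

Lemma igr_k_phi k M : (forall x, {for x, continuous k}) ->
  (forall x, `|k x| <= M * (1 + x ^+ 2)) ->
  igr setT (fun x => k x * derive1n n phi (x + y)).
Proof.
move=> ck kM; have [C C0 HC] := schwartz_JJ2 n sp.
have M0 : 0 <= M.
  by have := kM 0; rewrite expr0n/= addr0 mulr1; apply: le_trans.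
apply: (@igr_le R setT _ (fun x => M * (C * (1 + y ^+ 2)) * JJ y x)) => //.
- apply: meas_cont => [|x _]; first exact: openT.
  by apply: ctM => //; exact: ct_shift.
- by apply: igrZ => //; exact: (proj1 (JJ_igr y)).
- move=> x _; rewrite normrM; apply: (@le_trans _ _ (M * (1 + x ^+ 2) * `|derive1n n phi (x + y)|)).
    by rewrite ler_wpM2r.
  by rewrite -!mulrA ler_wpM2l// !mulrA.
Qed.

Lemma ibp_R k k' M : (forall x, dv k x (k' x)) -> (forall x, {for x, continuous k'}) ->
  (forall x, `|k x| <= M * (1 + x ^+ 2)) -> (forall x, `|k' x| <= M * (1 + x ^+ 2)) ->
  \int[mu]_x (k' x * derive1n n phi (x + y)) = - \int[mu]_x (k x * derive1n n.+1 phi (x + y)).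
Proof.
move=> dk ck kM k'M.
have M0 : 0 <= M.
  by have := kM 0; rewrite expr0n/= addr0 mulr1; apply: le_trans.
have [C C0 HC] := schwartz_JJ2 n sp.
have ckk x : {for x, continuous k} by exact: dv_ct (dk x).
have i1 := igr_k_phi ck k'M.
have [C1 C10 HC1] := schwartz_JJ2 n.+1 sp.
have i2 : igr setT (fun x => k x * derive1n n.+1 phi (x + y)).
  apply: (@igr_le R setT _ (fun x => M * (C1 * (1 + y ^+ 2)) * JJ y x)) => //.
  - apply: meas_cont => [|x _]; first exact: openT.
    by apply: ctM => //; exact: ct_shift.
  - by apply: igrZ => //; exact: (proj1 (JJ_igr y)).
  - move=> x _; rewrite normrM; apply: (@le_trans _ _ (M * (1 + x ^+ 2) * `|derive1n n.+1 phi (x + y)|)).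
      by rewrite ler_wpM2r.
    by rewrite -!mulrA ler_wpM2l// !mulrA.
pose F x := k x * derive1n n phi (x + y).
have Fle x : `|F x| <= M * (C * (1 + y ^+ 2)) * JJ y x.
  rewrite /F normrM; apply: (@le_trans _ _ (M * (1 + x ^+ 2) * `|derive1n n phi (x + y)|)).
    by rewrite ler_wpM2r.
  by rewrite -!mulrA ler_wpM2l// !mulrA.
have : \int[mu]_x (k' x * derive1n n phi (x + y) + k x * derive1n n.+1 phi (x + y)) = 0 - 0.
  apply: (@ftc_T R _ F).
  - move=> x; apply: dv_eq.
      apply: dvM; first exact: dk.
      apply: (@dv_comp R (derive1n n phi) (fun x => x + y)); first exact: schwartz_dv.
      by dvs; reflexivity.
    by rewrite /=; ring.
  - by move=> x; apply: ctD; apply: ctM => //; exact: ct_shift.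
  - apply: (@le_cvg0 R _ _ _ F (fun x => M * (C * (1 + y ^+ 2)) * JJ y x)); first exact: nearW.
    rewrite -[X in _ --> X](mulr0 (M * (C * (1 + y ^+ 2)))).
    by apply: cvgM; [exact: cvg_cst|exact: JJ_cvgNy].
  - apply: (@le_cvg0 R _ _ _ F (fun x => M * (C * (1 + y ^+ 2)) * JJ y x)); first exact: nearW.
    rewrite -[X in _ --> X](mulr0 (M * (C * (1 + y ^+ 2)))).
    by apply: cvgM; [exact: cvg_cst|exact: JJ_cvgy].
  - exact: igrD.
rewrite (RintD measurableT i1 i2) subr0 => /eqP; rewrite addr_eq0 => /eqP //.
Qed.

End against_schwartz.

Let as_ s : R := (Num.sqrt (2 * pi * s))^-1.

Lemma sq2pi_gt0 s : 0 < s -> 0 < Num.sqrt (2 * pi * s).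
Proof. by move=> s0; rewrite sqrtr_gt0 !mulr_gt0// pi_gt0. Qed.

Lemma as_gt0 s : 0 < s -> 0 < as_ s.
Proof. by move=> s0; rewrite invr_gt0 sq2pi_gt0. Qed.

Lemma as_dv s : 0 < s -> dv as_ s (- as_ s / (2 * s)).
Proof.
move=> s0; have q0 := sq2pi_gt0 s0; rewrite /as_; apply: dv_eq.
  apply: dvV; first by rewrite gt_eqF.
  by apply: (@dv_sqrt R (fun s => 2 * pi * s)); [rewrite !mulr_gt0// pi_gt0|dvs; reflexivity].
rewrite /=; have := @sqr_sqrtr R (2 * pi * s).
have p0 := pi_gt0 R; have ps : 0 < 2 * pi * s by rewrite !mulr_gt0.
move: q0 p0 ps; set q := Num.sqrt _; move: (pi : R) => p q0 p0 ps /(_ (ltW ps)) E.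
have -> : s = q ^+ 2 / (2 * p) by rewrite E; field; rewrite gt_eqF.
by field; rewrite !gt_eqF.
Qed.

Lemma KK_le d s x : 0 < s -> `|KK d s x| <= as_ s.
Proof.
move=> s0; rewrite /KK normrM (gtr0_norm (as_gt0 s0)).
by rewrite ler_piMr ?cos_max// ltW// as_gt0.
Qed.

Lemma KK_ct d s x : {for x, continuous (KK d s)}.
Proof. by apply: dv_ct; rewrite /KK; dvs; reflexivity. Qed.

Lemma KK_le2 d s x : 0 < s -> `|KK d s x| <= as_ s * (1 + x ^+ 2).
Proof.
move=> s0; apply: le_trans (KK_le d x s0) _.
by rewrite ler_peMr ?poly2_ge1// ltW// as_gt0.
Qed.

Definition KKs d s x : R := - as_ s / (2 * s) * cos (x ^+ 2 / (2 * s) + d)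
  + as_ s * (x ^+ 2 / (2 * s ^+ 2)) * sin (x ^+ 2 / (2 * s) + d).
Definition KKx d s x : R := as_ s * (x / s) * cos (x ^+ 2 / (2 * s) + d).

Lemma KK_dvs d s x : 0 < s -> dv (fun s => KK d s x) s (KKs d s x).
Proof.
move=> s0; rewrite /KK; apply: dv_eq.
  apply: dvM; first exact: as_dv.
  by dvs; [rewrite mulf_neq0// gt_eqF|reflexivity].
by rewrite /KKs /as_ /=; move: (Num.sqrt _)^-1 => q; field; rewrite gt_eqF.
Qed.

Lemma KK_pihalf d s x : KK (d - pi / 2) s x = as_ s * sin (x ^+ 2 / (2 * s) + d).
Proof. by rewrite /KK addrA cosBpihalf. Qed.

Lemma KK_dvx d s x : 0 < s -> dv (KK (d - pi / 2) s) x (KKx d s x).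
Proof.
move=> s0; rewrite (_ : KK _ _ = fun x => as_ s * sin (x ^+ 2 / (2 * s) + d)); last first.
  by apply/funext => z; exact: KK_pihalf.
by dvs; rewrite /= /KKx; field; rewrite gt_eqF.
Qed.

Lemma KKx_dvx d s x : 0 < s -> dv (KKx d s) x (- 2 * KKs d s x).
Proof. by move=> s0; rewrite /KKx; dvs; rewrite /= /KKs; field; rewrite gt_eqF. Qed.

Lemma KKx_le d s x : 0 < s -> `|KKx d s x| <= as_ s / s * (1 + x ^+ 2).
Proof.
move=> s0; have a0 := as_gt0 s0.
rewrite /KKx normrM; apply: (@le_trans _ _ (`|as_ s * (x / s)|)).
  by rewrite ler_piMr// cos_max.
rewrite mulrA mulrAC normrM gtr0_norm ?divr_gt0// ler_wpM2l ?(ltW (divr_gt0 a0 s0))//.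
by rewrite ler_norml; have := sqr_ge0 (x - 1); have := sqr_ge0 (x + 1) => h1 h2; apply/andP; split; nra.
Qed.

Lemma KKs_le d s s0 x : 0 < s0 -> s0 <= s ->
  `|KKs d s x| <= (as_ s0 / (2 * s0) + as_ s0 / (2 * s0 ^+ 2)) * (1 + x ^+ 2).
Proof.
move=> s00 ss; have s1 : 0 < s by apply: lt_le_trans ss.
have a0 := as_gt0 s1; have a1 := as_gt0 s00.
have aa : as_ s <= as_ s0.
  by rewrite /as_ lef_pV2 ?posrE ?sq2pi_gt0// ler_wsqrtr// ler_wpM2l// mulr_ge0// pi_ge0.
have x2 := sqr_ge0 x.
have h1 : as_ s / (2 * s) <= as_ s0 / (2 * s0).
  apply: ler_pM; [exact: ltW|by rewrite invr_ge0 mulr_ge0// ltW|exact: aa|].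
  by rewrite lef_pV2 ?posrE ?mulr_gt0// ler_pM2l.
have h2 : as_ s / (2 * s ^+ 2) <= as_ s0 / (2 * s0 ^+ 2).
  apply: ler_pM; [exact: ltW|by rewrite invr_ge0 mulr_ge0// exprn_ge0// ltW|exact: aa|].
  by rewrite lef_pV2 ?posrE ?mulr_gt0 ?exprn_gt0// ler_pM2l// lerXn2r ?nnegrE ?(ltW s1) ?(ltW s00).
have p1 : 0 <= as_ s / (2 * s) by rewrite divr_ge0 ?(ltW a0)// mulr_ge0// ltW.
have p2 : 0 <= as_ s / (2 * s ^+ 2) by rewrite divr_ge0 ?(ltW a0)// mulr_ge0// exprn_ge0// ltW.
rewrite /KKs; apply: le_trans (ler_normD _ _) _.
apply: (@le_trans _ _ (as_ s / (2 * s) + as_ s / (2 * s ^+ 2) * x ^+ 2)).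
  apply: lerD; rewrite normrM.
    by rewrite mulNr normrN (ger0_norm p1) ler_piMr// cos_max.
  rewrite (_ : as_ s * (x ^+ 2 / (2 * s ^+ 2)) = as_ s / (2 * s ^+ 2) * x ^+ 2); last by ring.
  by rewrite (ger0_norm (mulr_ge0 p2 x2)) ler_piMr ?sin_max // mulr_ge0.
have := mulr_ge0 p2 x2; nra.
Qed.

Lemma KKx_ct d s x : 0 < s -> {for x, continuous (KKx d s)}.
Proof. by move=> s0; exact: dv_ct (KKx_dvx d x s0). Qed.

Lemma KKs_ct d s x : 0 < s -> {for x, continuous (KKs d s)}.
Proof. by move=> s0; apply: dv_ct; rewrite /KKs; dvs; reflexivity. Qed.

Lemma GG_igr d phi n s y : schwartz phi -> 0 < s ->
  igr setT (fun x => KK d s x * derive1n n phi (x + y)).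
Proof.
move=> sp s0; apply: (@igr_k_phi phi n y sp (KK d s) (as_ s)) => [x|x].
  exact: KK_ct.
exact: KK_le2.
Qed.

(** The Schroedinger equation d_s K = - (1/2) d_x^2 K, with the phase of K
    shifted by - pi / 2 on the right, moved onto phi by two integrations by
    parts. *)
Lemma GG_dvs d phi n s y : schwartz phi -> 0 < s ->
  dv (fun s => GG d (derive1n n phi) s y) s
     (- 2^-1 * GG (d - pi / 2) (derive1n n.+2 phi) s y).
Proof.
move=> sp s0; have a0 := as_gt0 s0.
have h0 : 0 < s / 2 by rewrite divr_gt0.
apply: (dv_eq (d := \int[mu]_x (KKs d s x * derive1n n phi (x + y)))).
  have [C C0 HC] := schwartz_JJ2 n sp.
  set M := as_ (s / 2) / (2 * (s / 2)) + as_ (s / 2) / (2 * (s / 2) ^+ 2).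
  have M0 : 0 <= M.
    have a1 := as_gt0 h0.
    by rewrite addr_ge0// divr_ge0 ?(ltW a1)// mulr_ge0// ?exprn_ge0// ltW.
  apply: (@int_dv R setT (fun s x => KK d s x * derive1n n phi (x + y))
    (fun s x => KKs d s x * derive1n n phi (x + y))
    (fun x => M * (C * (1 + y ^+ 2)) * JJ y x) (s / 2) (2 * s)) => //.
  - by apply/andP; split; lra.
  - by move=> z /andP[z1 _]; apply: GG_igr => //; lra.
  - move=> z x /andP[z1 _] _; apply: dv_eq.
      by apply: dvM; [apply: KK_dvs; lra|exact: dv_cst].
    by rewrite /=; ring.
  - by apply: igrZ => //; exact: (proj1 (JJ_igr y)).
  - move=> z x /andP[z1 _] _; rewrite normrM.
    apply: (@le_trans _ _ (M * (1 + x ^+ 2) * `|derive1n n phi (x + y)|)).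
      by rewrite ler_wpM2r// KKs_le// ltW.
    by rewrite -!mulrA ler_wpM2l// !mulrA.
set M := (as_ s / (2 * s) + as_ s / (2 * s ^+ 2)) * 2 + as_ s / s + as_ s.
have M1 : 0 < as_ s / s by rewrite divr_gt0.
have M2 : 0 < as_ s / (2 * s) by rewrite divr_gt0// mulr_gt0.
have M3 : 0 < as_ s / (2 * s ^+ 2) by rewrite divr_gt0// mulr_gt0// exprn_gt0.
have p1 x : 0 < 1 + x ^+ 2 :> R by rewrite ltr_pwDl// sqr_ge0.
have b2 x : `|- 2 * KKs d s x| <= M * (1 + x ^+ 2).
  rewrite normrM (_ : `|- 2| = 2 :> R); last by rewrite normrN ger0_norm.
  have := KKs_le d x s0 (lexx s); have := p1 x; rewrite /M; nra.
have b1 x : `|KKx d s x| <= M * (1 + x ^+ 2).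
  by have := KKx_le d x s0; have := p1 x; rewrite /M; nra.
have b0 x : `|KK (d - pi / 2) s x| <= M * (1 + x ^+ 2).
  by have := KK_le2 (d - pi / 2) x s0; have := p1 x; rewrite /M; nra.
have c2 x : {for x, continuous (fun x => - 2 * KKs d s x)}.
  by apply: ctM; [exact: ct_cst|exact: KKs_ct].
have E1 := @ibp_R phi n y sp (KKx d s) (fun x => - 2 * KKs d s x) M
  (fun x => KKx_dvx d x s0) c2 b1 b2.
have E2 := @ibp_R phi n.+1 y sp (KK (d - pi / 2) s) (KKx d s) M
  (fun x => KK_dvx d x s0) (fun x => @KKx_ct d s x s0) b0 b1.
rewrite /GG -[X in _ = _ * X]opprK -E2 -E1.
rewrite (@Rint_eq R setT (fun x => - 2 * KKs d s x * derive1n n phi (x + y))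
  (fun x => - 2 * (KKs d s x * derive1n n phi (x + y)))); last by move=> x _; rewrite mulrA.
rewrite RintZ//.
  by field.
apply: (@igr_k_phi phi n y sp (KKs d s) M) => x; first exact: KKs_ct.
have := b2 x; rewrite normrM (_ : `|- 2| = 2 :> R); last by rewrite normrN ger0_norm.
by apply: le_trans; rewrite ler_peMl ?ler1n.
Qed.

(** The commutation of multiplication by y with the evolution, from x K(s,x) =
    s d_x K with shifted phase. *)
Lemma GG_mulx d phi s y : schwartz phi -> 0 < s ->
  y * GG d phi s y = GG d (fun x => x * phi x) s y + s * GG (d - pi / 2) (derive1 phi) s y.
Proof.
move=> sp s0; have a0 := as_gt0 s0.
have b0 x : `|s * KK (d - pi / 2) s x| <= (s * as_ s + as_ s) * (1 + x ^+ 2).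
  rewrite normrM (gtr0_norm s0); have := KK_le2 (d - pi / 2) x s0.
  have : 0 < 1 + x ^+ 2 by rewrite ltr_pwDl// sqr_ge0.
  nra.
have b1 x : `|x * KK d s x| <= (s * as_ s + as_ s) * (1 + x ^+ 2).
  rewrite normrM; have h := KK_le d x s0.
  have p1 : 0 < 1 + x ^+ 2 by rewrite ltr_pwDl// sqr_ge0.
  apply: (@le_trans _ _ (`|x| * as_ s)); first by rewrite ler_wpM2l.
  rewrite mulrDl mulrC; apply: (@le_trans _ _ (as_ s * (1 + x ^+ 2))).
    rewrite ler_wpM2l ?(ltW a0)//.
    by rewrite ler_norml; have := sqr_ge0 (x - 1); have := sqr_ge0 (x + 1) => h1 h2; apply/andP; split; nra.
  by rewrite lerDr !mulr_ge0 ?(ltW s0) ?(ltW a0) ?(ltW p1).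
have dk x : dv (fun x => s * KK (d - pi / 2) s x) x (x * KK d s x).
  apply: dv_eq; first by apply: dvM; [exact: dv_cst|exact: KK_dvx].
  by rewrite /= /KKx /KK /as_; field; rewrite ?gt_eqF ?sq2pi_gt0.
have ck x : {for x, continuous (fun x => x * KK d s x)}.
  by apply: ctM; [exact: cvg_id|exact: KK_ct].
have := @ibp_R phi 0 y sp _ _ _ dk ck b0 b1.
rewrite /= => E.
have i1 := @GG_igr d phi 0 s y sp s0.
have i2 := @GG_igr d (fun x => x * phi x) 0 s y (schwartz_mulx sp) s0.
have i3 := @GG_igr (d - pi / 2) phi 1 s y sp s0.
rewrite /= in i1 i2 i3.
have E2 : \int[mu]_x (x * KK d s x * phi (x + y)) = - (s * GG (d - pi / 2) (derive1 phi) s y).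
  rewrite E /GG -RintZ//; congr (- _); apply: Rint_eq => x _; by rewrite mulrA.
have i4 : igr setT (fun x => x * KK d s x * phi (x + y)) by exact: (@igr_k_phi phi 0 y sp _ _ ck b1).
rewrite -[s * _]opprK -E2 /GG -RintB// -RintZ//; apply: Rint_eq => x _; ring.
Qed.

End schroedinger_kernel.


(** * Fresnel integrals and bounds on the evolution *)

Section fresnel.
Variable R : realType.
Implicit Types (f g h F phi k : R -> R) (x y a b r v s d : R) (D : set R).
Notation mu := (@lebesgue_measure R).
Notation igr D f := (mu.-integrable D (EFin \o f)).
Notation pos := (`]0, +oo[%classic : set R).
Notation uni := (`]0, 1[%classic : set R).

Let muni : measurable uni. Proof. exact: measurable_itv. Qed.

(** An antiderivative of the Fresnel integrand vanishing at 0, written over a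
    fixed interval so that its derivative is an integral with a parameter. *)
Definition Fr d y : R := y * \int[mu]_(v in uni) cos ((y * v) ^+ 2 / 2 + d).

Let cosf_igr d y : igr uni (fun v => cos ((y * v) ^+ 2 / 2 + d)).
Proof.
apply: (@igr_le R uni _ (fun=> 1)) => //; last by move=> v _; exact: cos_max.
  by apply: meas_cont => [|v _]; [exact: open_oo|apply: dv_ct; dvs; reflexivity].
exact: igr_cst_oo.
Qed.

Lemma Rint_cst_uni (c : R) : \int[mu]_(v in uni) c = c.
Proof.
by rewrite Rintegral_cst//= lebesgue_measure_itv/= lte_fin ltr01 oppr0 adde0/= mulr1.
Qed.

Lemma Fr_dv d y : dv (Fr d) y (cos (y ^+ 2 / 2 + d)).
Proof.
pose g (y v : R) := - sin ((y * v) ^+ 2 / 2 + d) * (y * v ^+ 2).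
have gle z v : y - 1 < z < y + 1 -> 0 < v < 1 -> `|g z v| <= `|y| + 1.
  move=> /andP[z1 z2] /andP[v0 v1]; rewrite /g normrM normrN.
  apply: (@le_trans _ _ (1 * (`|z| * 1))).
    apply: ler_pM => //; first exact: sin_max.
    rewrite normrM ler_wpM2l// ger0_norm ?sqr_ge0// expr_le1//; first exact: ltW.
    exact: ltW.
  rewrite mul1r mulr1; have : `|z - y| <= 1 by rewrite ler_norml; apply/andP; split; lra.
  have := ler_normD (z - y) y; rewrite subrK; lra.
have gct z v : {for v, continuous (g z)} by apply: dv_ct; rewrite /g; dvs; reflexivity.
have gi : igr uni (g y).
  apply: (@igr_le R uni _ (fun=> `|y| + 1)) => //.
  - by apply: meas_cont => [|v _]; [exact: open_oo|exact: gct].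
  - exact: igr_cst_oo.
  - by move=> v; rewrite ooE => hv; apply: gle => //; apply/andP; split; lra.
have dI : dv (fun y => \int[mu]_(v in uni) cos ((y * v) ^+ 2 / 2 + d)) y (\int[mu]_(v in uni) g y v).
  apply: (@int_dv R uni (fun y v => cos ((y * v) ^+ 2 / 2 + d)) g (fun=> `|y| + 1) (y - 1) (y + 1)) => //.
  - by apply/andP; split; lra.
  - by move=> z v _ _; rewrite /g; dvs; rewrite /=; field.
  - exact: igr_cst_oo.
apply: dv_eq; first by apply: dvM; [exact: dv_id|exact: dI].
rewrite mul1r -RintZ// -RintD//; last exact: igrZ.
pose F v := v * cos ((y * v) ^+ 2 / 2 + d).
have dF v : dv F v (cos ((y * v) ^+ 2 / 2 + d) + y * g y v).
  by rewrite /F /g; dvs; rewrite /=; field.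
rewrite (@ftc_oo R _ F 0 1 (F 0) (F 1) ltr01).
- by rewrite /F mul0r subr0 mul1r mulr1.
- by move=> v _; exact: dF.
- move=> v _; apply: ctD; last by apply: ctM; [exact: ct_cst|exact: gct].
  by apply: dv_ct; dvs; reflexivity.
- by apply: ct_right; exact: dv_ct (dF 0).
- by apply: cvg_at_left_filter; exact: dv_ct (dF 1).
- by apply: igrD => //; exact: igrZ.
Qed.

Lemma Fr_abs d y : `|Fr d y| <= `|y|.
Proof.
rewrite /Fr normrM ler_piMr// -[leRHS](Rint_cst_uni 1).
apply: Rint_le_norm => //; first exact: igr_meas (cosf_igr d y).
  exact: igr_cst_oo.
by move=> v _; exact: cos_max.
Qed.

Lemma Fr_odd d y : Fr d (- y) = - Fr d y.
Proof.
by rewrite /Fr mulNr; congr (- (_ * _)); apply: Rint_eq => v _; rewrite mulNr sqrrN.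
Qed.

(** The value of the Fresnel integral over the half-line. *)
Definition Lfr d : R := Num.sqrt pi / 2 * (cos d - sin d).

Lemma gauss_igr : igr pos (fun r => expR (- r ^+ 2)).
Proof.
apply: (@igr_le R pos _ (fun r => expR 1 * expR (- r))).
- exact: mpos.
- by apply: meas_cont => [|v _]; [exact: open_pos|apply: dv_ct; dvs; reflexivity].
- exact: igr_dom.
- move=> r _; rewrite ger0_norm ?expR_ge0// -expRD ler_expR.
  have := sqr_ge0 (r - 2^-1); nra.
Qed.

Lemma gauss_int : \int[mu]_(r in pos) expR (- r ^+ 2) = Num.sqrt pi / 2.
Proof.
rewrite (Rintegral_itv_obnd_cbnd gauss_igr).
have := @integral0y_gauss R => /(congr1 fine) /= <-.
by rewrite /Rintegral.
Qed.

(** The Fresnel phase rotated to slope 1, where the integrand is Gaussian. *)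
Lemma Fr_cvg d : Fr d x @[x --> +oo] --> Lfr d.
Proof.
have uE r : arc_u 0 1 0 d r 0 = cos (r ^+ 2 / 2 + d).
  by rewrite /arc_u /aP /aQ !(mulr0, mul0r, expr0n, subr0, addr0, add0r, oppr0, expR0, mul1r, mulr1)/=.
have u1 r : arc_u 0 1 0 d r 1 = (cos d - sin d) * expR (- r ^+ 2).
  by rewrite /arc_u /aP /aQ !(mulr0, mul0r, expr1n, subrr, subr0, addr0, add0r, oppr0, mul1r, mulr1)/= mulrC.
have H : igr pos (fun r => arc_u 0 1 0 d r 1).
  apply: (@igr_eq R pos (fun r => (cos d - sin d) * expR (- r ^+ 2))); first exact: mpos.
    by move=> r _; rewrite u1.
  by apply: igrZ; [exact: mpos|exact: gauss_igr].
have := @arc_cvg R 0 1 0 d 1 _ _ H.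
rewrite (@Rint_eq R pos _ (fun r => (cos d - sin d) * expR (- r ^+ 2))); last by move=> r _; rewrite u1.
rewrite (RintZ _ (@mpos R) gauss_igr) gauss_int mulrC -/(Lfr d) => K.
have := K _ _; rewrite ler01 lexx => /(_ isT) {}K.
apply: cvg_trans (K _); last first.
  move=> A n A1 /andP[n0 _]; rewrite /aP !mul0r !add0r addr0 mul1r.
  by have := sqr_ge0 A => A2; have := mulr_ge0 n0 A2; lra.
apply: near_eq_cvg; near=> A; have A0 : 0 < A by near: A; apply: nbhs_pinfty_gt; rewrite num_real.
rewrite (@Rint_eq R _ _ (fun r => cos (r ^+ 2 / 2 + d))); last by move=> r _; rewrite uE.
rewrite (@ftc_oo R _ (Fr d) 0 A (Fr d 0) (Fr d A) A0).
- by rewrite {2}/Fr mul0r subr0.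
- by move=> r _; exact: Fr_dv.
- by move=> r _; apply: dv_ct; dvs; reflexivity.
- by apply: ct_right; exact: dv_ct (Fr_dv d 0).
- by apply: cvg_at_left_filter; exact: dv_ct (Fr_dv d A).
- apply: (@igr_le R _ _ (fun=> 1)); [exact: measurable_itv| |exact: igr_cst_oo|].
    by apply: meas_cont => [|v _]; [exact: open_oo|apply: dv_ct; dvs; reflexivity].
  by move=> v _; exact: cos_max.
Unshelve. all: by end_near. Qed.

Lemma Fr_bounded d : exists2 C, 0 <= C & forall y, `|Fr d y| <= C.
Proof.
have /cvgrPdist_le/(_ 1 ltr01) [N [Nr HN]] := @Fr_cvg d.
exists (`|N| + `|Lfr d| + 1); first by rewrite !addr_ge0.
have H y : 0 <= y -> `|Fr d y| <= `|N| + `|Lfr d| + 1.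
  move=> y0; have [yN|yN] := leP y N.
    have := Fr_abs d y; rewrite (ger0_norm y0); have := ler_norm N; have := normr_ge0 (Lfr d); lra.
  have := HN y yN; rewrite /= distrC => h.
  have := ler_normD (Fr d y - Lfr d) (Lfr d); rewrite subrK; have := normr_ge0 N; lra.
move=> y; have [/H//|y0] := leP 0 y.
by rewrite -normrN -Fr_odd; apply: H; lra.
Qed.

Lemma Fr_ct d y : {for y, continuous (Fr d)}.
Proof. exact: dv_ct (Fr_dv d y). Qed.

Let c0 : R := (Num.sqrt (2 * pi))^-1.

(** The kernel K is the derivative of a Fresnel integral, bounded uniformly in
    s; this removes the singularity s^(-1/2) at the cost of one derivative of
    phi. *)
Lemma GG_parts d phi n s y : schwartz phi -> 0 < s ->
  GG d (derive1n n phi) s y =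
  - \int[mu]_x (c0 * Fr d (x / Num.sqrt s) * derive1n n.+1 phi (x + y)).
Proof.
move=> sp s0; have q0 : 0 < Num.sqrt s by rewrite sqrtr_gt0.
have [C C1 HC] := Fr_bounded d.
have c00 : 0 < c0 by rewrite invr_gt0 sqrtr_gt0 mulr_gt0// pi_gt0.
have p1 x : 1 <= 1 + x ^+ 2 by exact: poly2_ge1.
have a0 : 0 < (Num.sqrt (2 * pi * s))^-1 by rewrite invr_gt0 sq2pi_gt0.
apply: (@ibp_R R phi n y sp (fun x => c0 * Fr d (x / Num.sqrt s)) (KK d s) (c0 * C + (Num.sqrt (2 * pi * s))^-1)).
- move=> x; apply: dv_eq.
    apply: dvM; first exact: dv_cst.
    apply: (@dv_comp R (Fr d) (fun x => x / Num.sqrt s)); first exact: Fr_dv.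
    by dvs; reflexivity.
  rewrite /= /KK expr_div_n sqr_sqrtr ?(ltW s0)// sqrtrM ?mulr_ge0 ?pi_ge0// /c0.
  have -> : x ^+ 2 / s / 2 = x ^+ 2 / (2 * s) by field; rewrite gt_eqF.
  by rewrite [(_ * Num.sqrt s)^-1]invfM; ring.
- by move=> x; exact: KK_ct.
- move=> x; rewrite normrM (gtr0_norm c00); apply: (@le_trans _ _ ((c0 * C) * 1)).
    by rewrite mulr1 ler_wpM2l// ltW.
  apply: ler_pM => //; first by rewrite mulr_ge0// ltW.
  by rewrite lerDl ltW.
- move=> x; apply: le_trans (KK_le2 d x s0) _.
  by rewrite ler_wpM2r ?lerDr ?mulr_ge0 ?(ltW c00)// (le_trans _ (p1 x)).
Qed.

(** Uniformity down to s = 0 is what makes the superposition in s converge. *)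
Lemma GG_bound d phi n : schwartz phi -> exists2 C, 0 <= C &
  forall s y, 0 < s -> `|GG d (derive1n n phi) s y| <= C.
Proof.
move=> sp; have [C C1 HC] := Fr_bounded d.
have c00 : 0 < c0 by rewrite invr_gt0 sqrtr_gt0 mulr_gt0// pi_gt0.
have [M M0 HM] := schwartz_JJ n.+1 sp.
exists (c0 * C * M * pi); first by rewrite !mulr_ge0 ?pi_ge0// ltW.
move=> s y s0; rewrite GG_parts// normrN.
have [iJ eJ] := JJ_igr y; rewrite -[X in _ <= _ * X]eJ -RintZ//.
apply: Rint_le_norm => //; last 2 first.
- exact: igrZ.
- move=> x _; rewrite normrM normrM (gtr0_norm c00) -!mulrA ler_wpM2l ?(ltW c00)//.
  by apply: ler_pM.
- apply: meas_cont => [|x _]; first exact: openT.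
  apply: ctM; last exact: ct_shift.
  apply: ctM; first exact: ct_cst.
  apply: (@ct_comp R (Fr d) (fun x => x / Num.sqrt s)); first exact: Fr_ct.
  by apply: dv_ct; dvs; reflexivity.
Qed.

Lemma GG_dvy d phi n s y : schwartz phi -> 0 < s ->
  dv (GG d (derive1n n phi) s) y (GG d (derive1n n.+1 phi) s y).
Proof.
move=> sp s0; have a0 : 0 < (Num.sqrt (2 * pi * s))^-1 by rewrite invr_gt0 sq2pi_gt0.
have [M M0 HM] := schwartz_JJ n.+1 sp.
apply: (@int_dv R setT (fun y x => KK d s x * derive1n n phi (x + y))
  (fun y x => KK d s x * derive1n n.+1 phi (x + y))
  (fun x => (Num.sqrt (2 * pi * s))^-1 * (M * 3) * JJ y x) (y - 1) (y + 1)).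
- exact: measurableT.
- by apply/andP; split; lra.
- by move=> z _; exact: GG_igr.
- move=> z x _ _; apply: dv_eq.
    apply: dvM; first exact: dv_cst.
    apply: (@dv_comp R (derive1n n phi) (fun z => x + z)); first exact: schwartz_dv.
    by dvs; reflexivity.
  by rewrite /=; ring.
- by apply: igrZ => //; exact: (proj1 (JJ_igr y)).
- move=> z x /andP[z1 z2] _; rewrite normrM; have := KK_le d x s0.
  set q := (Num.sqrt _)^-1 => hk; rewrite -!mulrA; apply: ler_pM => //.
  apply: le_trans (HM z x) _; rewrite ler_wpM2l//; apply: JJ_near.
  by rewrite ler_norml; apply/andP; split; lra.
Qed.

(** By GG_mulx each power of y costs at most one power of 1 + s. *)
Lemma GG_wbound m : forall d phi, schwartz phi -> exists2 C, 0 <= C &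
  forall s y, 0 < s -> `|y ^+ m * GG d phi s y| <= C * (1 + s) ^+ m.
Proof.
elim: m => [|m IH] d phi sp.
  have [C C0 HC] := GG_bound d 0 sp; exists C => // s y s0.
  by rewrite !expr0 mul1r mulr1; exact: HC.
have [C1 C10 H1] := IH d _ (schwartz_mulx sp).
have [C2 C20 H2] := IH (d - pi / 2) _ (schwartz_derive sp).
exists (C1 + C2); first exact: addr_ge0.
move=> s y s0; rewrite exprSr -mulrA GG_mulx// mulrDr.
apply: le_trans (ler_normD _ _) _; rewrite [leRHS]mulrDl.
have s1 : 0 <= (1 + s) ^+ m by rewrite exprn_ge0//; lra.
apply: lerD.
  by apply: le_trans (H1 s y s0) _; rewrite ler_wpM2l// exprSr ler_peMr//; lra.
rewrite mulrCA normrM (gtr0_norm s0) exprSr mulrA [leRHS]mulrC.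
by apply: ler_pM => //; [exact: ltW|lra|exact: H2].
Qed.

Lemma GG_derive1n d phi s : schwartz phi -> 0 < s ->
  forall n, derive1n n (GG d phi s) = GG d (derive1n n phi) s.
Proof.
move=> sp s0 n; apply: (@derive1n_seq R (fun n => GG d (derive1n n phi) s)) => {}n y.
exact: GG_dvy.
Qed.

Lemma GG_schwartz d phi s : schwartz phi -> 0 < s -> schwartz (GG d phi s).
Proof.
move=> sp s0; apply: (@schwartz_seq R (fun n => GG d (derive1n n phi) s)) => [n y|m n].
  exact: GG_dvy.
have [C _ HC] := GG_wbound m d (schwartz_derive1n n sp).
by exists (C * (1 + s) ^+ m) => y; exact: HC.
Qed.

End fresnel.


(** * The initial value of the evolution *)

Section initial_value.
Variable R : realType.
Implicit Types (f g h F phi k : R -> R) (x y a b r v s d : R) (D : set R).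
Notation mu := (@lebesgue_measure R).
Notation igr D f := (mu.-integrable D (EFin \o f)).
Notation pos := (`]0, +oo[%classic : set R).

Lemma sin_pi4 : sin (pi / 4) = (Num.sqrt 2)^-1 :> R.
Proof.
have k0 : 0 < cos (pi / 4 : R) by rewrite cos_gt0_pihalf//; have := pi_gt0 R => p; apply/andP; split; lra.
have E := tan_piquarter R; have S : sin (pi / 4) = cos (pi / 4) :> R.
  by move: E; rewrite /tan => /divr1_eq.
apply: (@mulrI _ (Num.sqrt 2)); first by rewrite unitfE gt_eqF// sqrtr_gt0.
rewrite divff ?gt_eqF ?sqrtr_gt0//.
have := cos2Dsin2 (pi / 4 : R); rewrite S => H.
have t0 : 0 < Num.sqrt (2 : R) by rewrite sqrtr_gt0.
have t2 : Num.sqrt 2 ^+ 2 = 2 :> R by rewrite sqr_sqrtr.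
have : (Num.sqrt 2 * cos (pi / 4)) ^+ 2 = 1 ^+ 2 :> R by rewrite exprMn t2; lra.
by move/eqP; rewrite eqrXn2// => [/eqP//|]; rewrite mulr_ge0// ltW.
Qed.

Lemma cos_pi4 : cos (pi / 4) = (Num.sqrt 2)^-1 :> R.
Proof.
rewrite -sin_pi4; have := tan_piquarter R; rewrite /tan => /divr1_eq/esym.
exact.
Qed.

Lemma exh_neg : exh (`]-oo, 0[%classic : set R) (fun n => - (n + 1).+1%:R : R) (fun n => - (n + 1).+1%:R^-1).
Proof.
have [h1 h2 h3] := @exh_pos R.
have E x : (`]-oo, 0[%classic : set R) x = (x < 0) :> Prop by rewrite /= in_itv.
split=> [n|n x /andP[a1 a2]|x].
- by rewrite ltrN2; exact: h1.
- by rewrite E; apply: le_lt_trans a2 _; rewrite oppr_lt0 invr_gt0 ltr0n.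
- rewrite E => x0; have /h3 : pos (- x) by rewrite in_posE oppr_gt0.
  by apply: filterS => n /andP[a1 a2]; apply/andP; split; [rewrite lerNl|rewrite lerNr].
Qed.

Lemma sg_igr phi y : schwartz phi ->
  igr setT (fun x => Num.sg x * derive1n 1 phi (x + y)).
Proof.
move=> sp; have [M M0 HM] := schwartz_JJ 1 sp; pose f x := derive1n 1 phi (x + y).
have iM : igr setT (fun x => M * JJ y x) by apply: igrZ => //; exact: (proj1 (JJ_igr y)).
have mf : measurable_fun setT f.
  by apply: meas_cont => [|x _]; [exact: openT|exact: ct_shift].
have msg : measurable_fun setT (fun x => Num.sg x * f x).
  apply: (@measurable_funM _ _ _ _ (Num.sg : R -> R)) => //.
  have -> : (Num.sg : R -> R) = (fun x => \1_`]0, +oo[%classic x - \1_`]-oo, 0[%classic x).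
    apply/funext => x; rewrite !indicE !mem_setE !in_itv/= !andbT.
    case: (ltgtP x 0) => [x0|x0|->]; first by rewrite ltr0_sg// sub0r.
      by rewrite gtr0_sg// subr0.
    by rewrite sgr0 subrr.
  by apply: measurable_funB; apply: measurable_indic => //; exact: measurable_itv.
apply: (igr_le _ msg iM) => // x _; rewrite normrM -[leRHS]mul1r; apply: ler_pM => //.
  by rewrite normr_sg; case: (x != 0).
exact: HM.
Qed.

Lemma int_sg_derive phi y : schwartz phi ->
  \int[mu]_x (Num.sg x * derive1n 1 phi (x + y)) = - 2 * phi y.
Proof.
move=> sp; pose f x := derive1n 1 phi (x + y).
pose F x := phi (x + y).
have dF x : dv F x (f x).
  apply: dv_eq.
    by apply: (@dv_comp R phi (fun x => x + y)); [exact: schwartz_dv0 sp|dvs; reflexivity].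
  by rewrite /f /=; ring.
have cf x : {for x, continuous f} by exact: ct_shift.
have [M M0 HM] := schwartz_JJ 1 sp.
have [M' M'0 HM'] := schwartz_JJ 0 sp.
have iM : igr setT (fun x => M * JJ y x) by apply: igrZ => //; exact: (proj1 (JJ_igr y)).
have mf : measurable_fun setT f by apply: meas_cont => [|x _]; [exact: openT|exact: cf].
have i0 : igr setT f by apply: (igr_le _ mf iM) => // x _; exact: HM.
pose neg := (`]-oo, 0[%classic : set R).
have mneg : measurable neg by exact: measurable_itv.
have mposc : measurable (`[0, +oo[%classic : set R) by exact: measurable_itv.
have iN : igr neg f by exact: igrS i0.
have iP : igr pos f by apply: igrS i0 => //; exact: mpos.
have F0 : F 0 = phi y by rewrite /F add0r.
have vp : \int[mu]_(x in pos) f x = 0 - phi y.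
  rewrite -F0; apply: (@ftc_pos R f F) => //.
    by apply: ct_right; exact: dv_ct (dF 0).
  apply: (@le_cvg0 R _ _ _ F (fun x => M' * JJ y x)); first by apply: nearW => x; exact: HM'.
  by rewrite -[X in _ --> X](mulr0 M'); apply: cvgMr; exact: JJ_cvgy.
have vn : \int[mu]_(x in neg) f x = phi y - 0.
  rewrite -F0; apply: (@ftc_igr R neg _ _ f F _ _ mneg exh_neg) => //.
    have FN : F x @[x --> -oo] --> (0 : R).
      apply: (@le_cvg0 R _ _ _ F (fun x => M' * JJ y x)); first by apply: nearW => x; exact: HM'.
      by rewrite -[X in _ --> X](mulr0 M'); apply: cvgMr; exact: JJ_cvgNy.
    by move/cvg_ninftyP : FN; apply; apply/(cvgNrNy (fun n => (n + 1).+1%:R)); exact: cvg_natSr.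
  have z0 : - (n + 1).+1%:R^-1 @[n --> \oo] --> (0 : R).
    by rewrite -[X in _ --> X]oppr0; apply: cvgN; exact: cvg_invSr.
  exact: (cvg_comp _ _ z0 (dv_ct (dF 0))).
have iS := sg_igr y sp.
have E : setT = neg `|` `[0, +oo[%classic.
  apply/seteqP; split => x // _; rewrite /= !in_itv/= andbT.
  by case: (ltP x 0) => ?; [left|right].
have iE : igr (neg `|` `[0, +oo[%classic) (fun x => Num.sg x * f x) by rewrite -E.
rewrite E (@Rintegral_setU _ _ R mu neg _ _ mneg mposc iE); last first.
  apply/disj_setPS => x [/=]; rewrite /neg /= !in_itv/= andbT => h1 h2; by move: (lt_le_trans h1 h2); rewrite ltxx.
have iS0 : igr pos (fun x => Num.sg x * f x) by apply: igrS iS => //; exact: mpos.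
have E2 : \int[mu]_(x in `[0, +oo[) (Num.sg x * f x) = \int[mu]_(x in pos) (Num.sg x * f x).
  by apply/esym; exact: Rintegral_itv_obnd_cbnd iS0.
rewrite [X in _ + X]E2.
rewrite (@Rint_eq R pos _ f); last by move=> x; rewrite in_posE => x0; rewrite gtr0_sg// mul1r.
rewrite (@Rint_eq R neg _ (fun x => -1 * f x)); last first.
  by move=> x; rewrite /neg /= in_itv/= => x0; rewrite ltr0_sg.
by rewrite (RintZ _ mneg iN) vp vn; ring.
Qed.

Let c0 : R := (Num.sqrt (2 * pi))^-1.

(** As s -> 0+ the Fresnel antiderivative in GG_parts tends to a multiple of
    the sign function, and the integral of sgn(x) phi'(x + y) is - 2 phi(y).
    *)
Lemma GG_lim d phi y : schwartz phi ->
  GG d phi s y @[s --> 0^'+] --> cos (d + pi / 4) * phi y.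
Proof.
move=> sp; have [C C1 HC] := Fr_bounded d.
have c00 : 0 < c0 by rewrite invr_gt0 sqrtr_gt0 mulr_gt0// pi_gt0.
have [M M0 HM] := schwartz_JJ 1 sp.
have ctp x : {for x, continuous (fun x => derive1n 1 phi (x + y))} by exact: ct_shift.
pose sg x : R := Num.sg x.
have key : \int[mu]_x (c0 * (Lfr d * sg x) * derive1n 1 phi (x + y)) = - (cos (d + pi / 4) * phi y).
  have isg : igr setT (fun x => sg x * derive1n 1 phi (x + y)) by exact: sg_igr.
  rewrite (@Rint_eq R _ _ (fun x => (c0 * Lfr d) * (sg x * derive1n 1 phi (x + y)))); last first.
    by move=> x _; ring.
  rewrite (RintZ _ measurableT isg) int_sg_derive//.
  have -> : c0 * Lfr d * (- 2 * phi y) = - ((2 * (c0 * Lfr d)) * phi y) by ring.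
  congr (- (_ * _)); rewrite cosD sin_pi4 cos_pi4 /c0 /Lfr.
  have p0 := pi_gt0 R; have q0 : 0 < Num.sqrt (pi : R) by rewrite sqrtr_gt0.
  have t0 : 0 < Num.sqrt (2 : R) by rewrite sqrtr_gt0.
  rewrite sqrtrM//; move: q0 t0; set q := Num.sqrt pi; set t := Num.sqrt 2 => q0 t0.
  by field; rewrite !gt_eqF.
rewrite -[X in _ --> X]opprK -key.
apply: (@cvg_trans _ ((- (\int[mu]_x (c0 * Fr d (x / Num.sqrt s) * derive1n 1 phi (x + y)))) @[s --> 0^'+])).
  apply: near_eq_cvg; near=> s; have s0 : 0 < s by near: s; exact: nbhs_right_gt.
  by rewrite -(GG_parts d 0 y sp s0).
apply: cvgN.
apply: (@int_cvg_right R setT (fun s x => c0 * Fr d (x / Num.sqrt s) * derive1n 1 phi (x + y))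
  _ (fun x => c0 * C * M * JJ y x) 0 1) => //.
- move=> s _; apply: meas_cont => [|x _]; first exact: openT.
  apply: ctM; last exact: ctp.
  apply: ctM; first exact: ct_cst.
  apply: (@ct_comp R (Fr d) (fun x => x / Num.sqrt s)); first exact: Fr_ct.
  by apply: dv_ct; dvs; reflexivity.
- move=> x _; apply: cvgM; last exact: cvg_cst.
  apply: cvgM; first exact: cvg_cst.
  have sq0 : (Num.sqrt s)^-1 @[s --> (0:R)^'+] --> +oo.
    apply/cvgryPge => A; have [A0|A0] := leP A 0.
      near=> s; have s0 : 0 < s by near: s; exact: nbhs_right_gt.
      by rewrite (le_trans A0)// invr_ge0 sqrtr_ge0.
    have B0 : 0 < A^-1 ^+ 2 by rewrite exprn_gt0// invr_gt0.
    near=> s; have s0 : 0 < s by near: s; exact: nbhs_right_gt.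
    have q0 : 0 < Num.sqrt s by rewrite sqrtr_gt0.
    rewrite -[A]invrK lef_pV2 ?posrE ?invr_gt0//.
    rewrite -(ler_pXn2r (_ : 0 < 2)%N) ?nnegrE ?invr_ge0 ?(ltW A0) ?(ltW q0)//.
    rewrite sqr_sqrtr ?(ltW s0)//.
    by apply: ltW; near: s; exact: nbhs_right_lt.
  have P z : 0 < z -> Fr d (z / Num.sqrt s) @[s --> 0^'+] --> Lfr d.
    move=> z0; suff H : z / Num.sqrt s @[s --> (0:R)^'+] --> +oo.
      exact: (cvg_comp _ _ H (@Fr_cvg R d)).
    by apply: gt0_cvgMry.
  have [x0|x0|x0] := ltgtP x 0.
  + rewrite /sg ltr0_sg// mulrN1.
    rewrite (_ : (fun s => _) = fun s => - Fr d (- x / Num.sqrt s)); last first.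
      by apply/funext => s; rewrite -Fr_odd mulNr opprK.
    by apply: cvgN; apply: P; lra.
  + by rewrite /sg gtr0_sg// mulr1; exact: P.
  + rewrite x0 /sg sgr0 mulr0; under eq_fun do rewrite mul0r /Fr mul0r.
    exact: cvg_cst.
- by apply: igrZ => //; exact: (proj1 (JJ_igr y)).
- move=> s x _ _; rewrite normrM [`|c0 * _|]normrM (gtr0_norm c00) -!mulrA ler_wpM2l ?(ltW c00)//.
  by apply: ler_pM.
Unshelve. all: by end_near. Qed.

End initial_value.


(** * Averages against Airy functions *)

Section airy_averages.
Variable R : realType.
Implicit Types (f g h F phi k G : R -> R) (x y a b r v s t c d : R) (D : set R).
Notation mu := (@lebesgue_measure R).
Notation igr D f := (mu.-integrable D (EFin \o f)).
Notation pos := (`]0, +oo[%classic : set R).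
Notation uni := (`]0, 1[%classic : set R).

Let muni : measurable uni. Proof. exact: measurable_itv. Qed.

(** Polynomial growth on the half-line; nothing is asked at 0, where only
    one-sided limits are used. *)
Definition grow C (N : nat) G := forall s, 0 < s -> `|G s| <= C * (1 + s) ^+ N.
Definition ctpos G := forall s, 0 < s -> {for s, continuous G}.

(** Averages against derivatives of Ai. Scaling G rather than the kernel puts
    the parameter c in G, so differentiating in c only uses derivatives of G.
    *)
Definition VV (n : nat) G c : R := \int[mu]_(z in pos) (AA n z * G (c * z)).

Lemma grow_ge0 C N G : grow C N G -> 0 <= C.
Proof.
move=> /(_ 1 ltr01) H; have := le_trans (normr_ge0 _) H.
by rewrite pmulr_lge0// exprn_gt0//; lra.
Qed.

Lemma grow_scale C N G c z : grow C N G -> 0 < c -> 0 < z ->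
  `|G (c * z)| <= C * (1 + c) ^+ N * (1 + z) ^+ N.
Proof.
move=> gG c0 z0; apply: le_trans (gG _ (mulr_gt0 c0 z0)) _.
rewrite -mulrA ler_wpM2l ?(grow_ge0 gG)// -exprMn.
have cz := mulr_gt0 c0 z0.
by apply: lerXn2r; rewrite ?nnegrE; nra.
Qed.

Lemma cvg_right0 (T : Type) (FF : set_system T) {FFF : Filter FF} (h : T -> R) :
  h x @[x --> FF] --> (0 : R) -> (\forall x \near FF, 0 < h x) -> h x @[x --> FF] --> (0 : R)^'+.
Proof. by move=> h0 hp A /h0 hA; rewrite /nbhs/=; apply: filterS2 hp hA => x p; apply. Qed.

Section growth.
Variables (G : R -> R) (C : R) (N : nat).
Hypotheses (cG : ctpos G) (gG : grow C N G).

Definition Vdom n c z : R := C * (1 + c) ^+ N * ((1 + z) ^+ N * `|AA n z|).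

Lemma Vdom_igr n c : igr pos (Vdom n c).
Proof. by apply: igrZ; [exact: mpos|exact: AA_igr]. Qed.

Lemma VV_le n c z : 0 < c -> 0 < z -> `|AA n z * G (c * z)| <= Vdom n c z.
Proof.
move=> c0 z0; rewrite normrM /Vdom mulrA mulrC ler_wpM2r//.
exact: grow_scale.
Qed.

Lemma Vdom_mono n c c' z : 0 < c -> c <= c' -> 0 < z -> Vdom n c z <= Vdom n c' z.
Proof.
move=> c0 cc z0; rewrite /Vdom ler_wpM2r//.
  by rewrite mulr_ge0// exprn_ge0//; lra.
rewrite ler_wpM2l ?(grow_ge0 gG)//; apply: lerXn2r; rewrite ?nnegrE; lra.
Qed.

Lemma Vint_ct n c z : 0 < c -> 0 < z -> {for z, continuous (fun z => AA n z * G (c * z))}.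
Proof.
move=> c0 z0; apply: ctM; first exact: AA_ct.
apply: (@ct_comp R G (fun z => c * z)); first by apply: cG; exact: mulr_gt0.
by apply: dv_ct; dvs; reflexivity.
Qed.

Lemma Vint_meas n c : 0 < c -> measurable_fun pos (fun z => AA n z * G (c * z)).
Proof.
move=> c0; apply: meas_cont => [|z]; first exact: open_pos.
by rewrite in_posE => z0; exact: Vint_ct.
Qed.

Lemma Vint_igr n c : 0 < c -> igr pos (fun z => AA n z * G (c * z)).
Proof.
move=> c0; apply: (igr_le (@mpos R) (Vint_meas n c0) (Vdom_igr n c)) => z.
by rewrite in_posE; exact: VV_le.
Qed.

Lemma VV_ct n c : 0 < c -> {for c, continuous (VV n G)}.
Proof.
move=> c0; apply: (@int_ct R pos (fun c z => AA n z * G (c * z)) (Vdom n (c + 1)) 0 (c + 1) c).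
- exact: mpos.
- by rewrite c0 ltrDl ltr01.
- by move=> x /andP[x0 _]; exact: Vint_meas.
- move=> x z /andP[x0 _]; rewrite in_posE => z0; apply: ctM; first exact: ct_cst.
  apply: (@ct_comp R G (fun x => x * z)); first by apply: cG; exact: mulr_gt0.
  by apply: dv_ct; dvs; reflexivity.
- exact: Vdom_igr.
- move=> x z /andP[x0 x1]; rewrite in_posE => z0.
  by apply: le_trans (VV_le n x0 z0) _; apply: Vdom_mono => //; exact: ltW.
Qed.

Lemma VV_lim n l : G x @[x --> 0^'+] --> l ->
  VV n G c @[c --> 0^'+] --> (\int[mu]_(z in pos) AA n z) * l.
Proof.
move=> Gl.
rewrite mulrC -(RintZ l (@mpos R) (AA_igr0 R n)).
apply: (@int_cvg_right R pos (fun c z => AA n z * G (c * z)) _ (Vdom n 1) 0 1) => //.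
- by move=> x /andP[x0 _]; exact: Vint_meas.
- move=> z; rewrite in_posE => z0; rewrite [l * _]mulrC; apply: cvgM; first exact: cvg_cst.
  have H : x * z @[x --> (0 : R)^'+] --> (0 : R)^'+.
    apply: cvg_right0.
      by rewrite -[X in _ --> X](mul0r z); apply: cvgM; [exact: cvg_at_right_filter|exact: cvg_cst].
    by near=> x; rewrite mulr_gt0//; near: x; exact: nbhs_right_gt.
  exact: (cvg_comp _ _ H Gl).
- exact: Vdom_igr.
- move=> x z /andP[x0 x1]; rewrite in_posE => z0.
  by apply: le_trans (VV_le n x0 z0) _; apply: Vdom_mono => //; exact: ltW.
Unshelve. all: by end_near. Qed.

End growth.

(** z AA 0 z = AA 2 z turns the derivative into an average of F against AA 2;
    an integration by parts, with F -> 0 at 0+ to remove the boundary term,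
    leaves the second derivative H against AA 1. *)
Lemma VV_dv G F H C N c : ctpos H -> grow C N G -> grow C N F -> grow C N H ->
  (forall s, 0 < s -> dv G s (F s)) -> (forall s, 0 < s -> dv F s (H s)) ->
  F s @[s --> 0^'+] --> (0 : R) -> 0 < c -> dv (VV 0 G) c (- c * VV 1 H c).
Proof.
move=> cH gG gF gH dG dF F0 c0.
have cG : ctpos G by move=> s s0; exact: dv_ct (dG s s0).
have cF : ctpos F by move=> s s0; exact: dv_ct (dF s s0).
apply: (dv_eq (d := \int[mu]_(z in pos) (AA 0 z * (z * F (c * z))))).
  apply: (@int_dv R pos (fun c z => AA 0 z * G (c * z)) (fun c z => AA 0 z * (z * F (c * z)))
    (Vdom C N 2 (c + 1)) 0 (c + 1)).
  - exact: mpos.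
  - by rewrite c0 ltrDl ltr01.
  - by move=> x /andP[x0 _]; exact: (Vint_igr cG gG).
  - move=> x z /andP[x0 _]; rewrite in_posE => z0; apply: dv_eq.
      apply: dvM; first exact: dv_cst.
      apply: (@dv_comp R G (fun x => x * z)); first exact: dG _ (mulr_gt0 x0 z0).
      by dvs; reflexivity.
    by rewrite /=; ring.
  - exact: Vdom_igr.
  - move=> x z /andP[x0 x1]; rewrite in_posE => z0.
    have -> : AA 0 z * (z * F (x * z)) = AA 2 z * F (x * z) by rewrite AA2; ring.
    by apply: le_trans (VV_le gF 2 x0 z0) _; apply: (Vdom_mono gF) => //; exact: ltW.
rewrite (@Rint_eq R pos _ (fun z => AA 2 z * F (c * z))); last by move=> z _; rewrite AA2; ring.
have i1 := Vint_igr cF gF 2 c0; have i2 := Vint_igr cH gH 1 c0.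
have Z : \int[mu]_(z in pos) (AA 2 z * F (c * z) + c * (AA 1 z * H (c * z))) = 0 - 0.
  apply: (@ftc_pos R _ (fun z => AA 1 z * F (c * z))).
  - move=> z z0; apply: dv_eq.
      apply: dvM; first exact: AA_dv.
      apply: (@dv_comp R F (fun z => c * z)); first exact: dF _ (mulr_gt0 c0 z0).
      by dvs; reflexivity.
    by rewrite /=; ring.
  - move=> z z0; apply: ctD; first exact: (Vint_ct cF).
    by apply: ctM; [exact: ct_cst|exact: (Vint_ct cH)].
  - rewrite -[X in _ --> X](mulr0 (AA 1 0)); apply: cvgM; first by apply: ct_right; exact: AA_ct.
    have K : c * z @[z --> (0 : R)^'+] --> (0 : R)^'+.
      apply: cvg_right0.
        by rewrite -[X in _ --> X](mulr0 c); apply: cvgM; [exact: cvg_cst|exact: cvg_at_right_filter].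
      by near=> z; rewrite mulr_gt0//; near: z; exact: nbhs_right_gt.
    exact: (cvg_comp _ _ K F0).
  - have [D D0 HD] := @AA_decay R N.+1 1.
    apply: (@le_cvg0 R _ _ _ _ (fun z => C * (1 + c) ^+ N * D * (1 + z)^-1)).
      near=> z; have z0 : 0 < z by near: z; apply: nbhs_pinfty_gt; rewrite num_real.
      have z1 : 0 < 1 + z by lra.
      apply: le_trans (VV_le gF 1 c0 z0) _; rewrite /Vdom -[leRHS]mulrA ler_wpM2l//.
        by rewrite mulr_ge0 ?(grow_ge0 gF)// exprn_ge0//; lra.
      by rewrite ler_pdivlMr// mulrAC -exprSr; apply: HD; exact: ltW.
    rewrite -[X in _ --> X](mulr0 (C * (1 + c) ^+ N * D)); apply: cvgMr.
    apply/gtr0_cvgV0; first by near=> z; have : 0 < z; [near: z; apply: nbhs_pinfty_gt; rewrite num_real|lra].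
    apply/cvgryPge => A; near=> z; rewrite -lerBlDl.
    by near: z; apply: nbhs_pinfty_ge; rewrite num_real.
  - by apply: igrD => //; apply: igrZ.
have mp := @mpos R; move: Z; rewrite (RintD mp i1 (igrZ c mp i2)) (RintZ _ mp i2) subrr /VV.
by move/eqP; rewrite addr_eq0 mulNr => /eqP.
Unshelve. all: by end_near. Qed.

End airy_averages.


(** * The Caputo derivative of an average *)

Section caputo_average.
Variable R : realType.
Implicit Types (f g h F phi k G : R -> R) (x y a b r v s t c d : R) (D : set R).
Notation mu := (@lebesgue_measure R).
Notation igr D f := (mu.-integrable D (EFin \o f)).
Notation pos := (`]0, +oo[%classic : set R).
Notation uni := (`]0, 1[%classic : set R).

Let muni : measurable uni. Proof. exact: measurable_itv. Qed.

Lemma cbrtM x y : 0 <= x -> 0 <= y -> cbrt (x * y) = cbrt x * cbrt y.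
Proof. by move=> x0 y0; rewrite /cbrt powRM. Qed.

Lemma cbrt_X3 x : 0 <= x -> cbrt (x ^+ 3) = x.
Proof.
by move=> x0; rewrite /cbrt -powR_mulrn// -powRrM mulfV ?powRr1.
Qed.

Lemma powR23 x : 0 <= x -> x `^ (2 / 3) = cbrt x ^+ 2.
Proof. by move=> x0; rewrite mulrC powRrM powR_mulrn// powR_ge0. Qed.

Lemma powRN23 x : 0 < x -> x `^ (1 - 2 / 3 - 1) = (cbrt x ^+ 2)^-1.
Proof.
move=> x0; rewrite (_ : 1 - 2 / 3 - 1 = - (2 / 3) :> R); last by field.
by rewrite powRN powR23// ltW.
Qed.

Lemma Gamma13 : Gamma (1 - 2 / 3 : R) = cbrt 3 ^+ 2 * I3 R.
Proof.
have k0 : 0 < cbrt (3 : R) by exact: cbrt_gt0.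
have k3 : cbrt (3 : R) ^+ 3 = 3 by exact: cbrt_cube.
have ex := @exh_pos R.
pose f x : R := x `^ (1 - 2 / 3 - 1) * expR (- x).
have cf y : pos y -> {for y, continuous f}.
  by rewrite in_posE => y0; apply: dv_ct; rewrite /f; dvs; [|reflexivity].
have dphi x : pos x -> dv (fun r => r ^+ 3 / 3) x (x ^+ 2).
  by move=> _; dvs; rewrite /=; field.
have cphi x : pos x -> {for x, continuous (fun r : R => r ^+ 2)}.
  by move=> _; apply: dv_ct; dvs; reflexivity.
have p0 x : pos x -> 0 < x ^+ 2 by rewrite in_posE => ?; rewrite exprn_gt0.
have pD x : pos x -> pos (x ^+ 3 / 3) by rewrite !in_posE => ?; rewrite divr_gt0// exprn_gt0.
have pS y : pos y -> exists2 x, pos x & x ^+ 3 / 3 = y.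
  rewrite in_posE => y0; exists (cbrt (3 * y)); first by rewrite in_posE cbrt_gt0// mulr_gt0.
  by rewrite cbrt_cube ?mulr_ge0 ?ltW//; field.
have E x : pos x -> f (x ^+ 3 / 3) * x ^+ 2 = cbrt 3 ^+ 2 * expR (- x ^+ 3 / 3).
  rewrite in_posE => x0; have x3 : 0 < x ^+ 3 / 3 by rewrite divr_gt0// exprn_gt0.
  rewrite /f powRN23// cbrtM ?exprn_ge0 ?(ltW x0)// cbrt_X3 ?(ltW x0)//.
  rewrite mulNr; have -> : cbrt (3^-1 : R) = (cbrt 3)^-1.
    apply: (@mulrI _ (cbrt 3)); first by rewrite unitfE gt_eqF.
    by rewrite -cbrtM// !divff ?gt_eqF// /cbrt powR1.
  by rewrite exprMn exprVn; field; rewrite !gt_eqF.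
have S1 := @subst_igr R pos pos _ _ _ _ f (@open_pos R) (@open_pos R) ex dphi cphi p0 pD pS cf.
have S2 := @subst_int R pos pos _ _ _ _ f (@open_pos R) (@open_pos R) ex dphi cphi p0 pD pS cf.
have iE : igr pos (fun r => expR (- r ^+ 3 / 3)).
  apply: (@igr_le R pos _ (fun r => expR 1 * expR (- r))).
  - exact: mpos.
  - by apply: meas_cont => [|v _]; [exact: open_pos|apply: dv_ct; dvs; reflexivity].
  - exact: igr_dom.
  - move=> r; rewrite in_posE => r0; rewrite ger0_norm ?expR_ge0// -expRD ler_expR.
    rewrite mulNr -subr_ge0.
    have -> : 1 - r - - (r ^+ 3 / 3) = (r - 1) ^+ 2 * (r + 2) / 3 + 3^-1 by field.
    by rewrite addr_ge0// divr_ge0// mulr_ge0 ?sqr_ge0//; lra.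
have i1 : igr pos f.
  apply/S1; apply: (@igr_eq R pos (fun x => cbrt 3 ^+ 2 * expR (- x ^+ 3 / 3))).
  - exact: mpos.
  - by move=> x px; rewrite E.
  - by apply: igrZ => //; exact: mpos.
rewrite /Gamma -(S2 i1) (@Rint_eq R pos _ _ E).
by rewrite (RintZ _ (@mpos R) iE).
Qed.

Variable lambda : R.
Hypothesis l0 : 0 < lambda.

(** The length scale of the density pp at time t. *)
Definition cc t : R := lambda * cbrt (3 * t).

Lemma cc_gt0 t : 0 < t -> 0 < cc t.
Proof. by move=> t0; rewrite mulr_gt0// cbrt_gt0// mulr_gt0. Qed.

Lemma cc_dv t : 0 < t -> dv cc t (cc t / (3 * t)).
Proof.
move=> t0; have p : 0 < 3 * t by rewrite mulr_gt0.
apply: dv_eq.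
  apply: dvM; first exact: dv_cst.
  by apply: (@dv_cbrt R (fun t => 3 * t)); [|dvs; reflexivity].
rewrite /= /cc; have q0 := cbrt_gt0 p; have := cbrt_cube (ltW p); set q := cbrt _ in q0 * => E.
have -> : t = q ^+ 3 / 3 by rewrite E; field.
by field; rewrite gt_eqF.
Qed.

Lemma cc_scale t v : 0 < t -> 0 < v -> cc (t * v ^+ 3) = cc t * v.
Proof.
move=> t0 v0; rewrite /cc mulrA cbrtM ?mulr_ge0 ?exprn_ge0 ?(ltW t0) ?(ltW v0)//.
by rewrite cbrt_X3 ?(ltW v0)// mulrA.
Qed.

Lemma cc_lim : cc t @[t --> 0^'+] --> (0 : R)^'+.
Proof.
apply: cvg_right0; last by near=> t; apply: cc_gt0; near: t; exact: nbhs_right_gt.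
rewrite -[X in _ --> X](mulr0 lambda); apply: cvgMr.
apply: powR_cvg0' => //.
- by near=> t; rewrite mulr_ge0// ltW//; near: t; exact: nbhs_right_gt.
- rewrite -[X in _ --> X](mulr0 (3 : R)); apply: cvgM; first exact: cvg_cst.
  exact: cvg_at_right_filter.
Unshelve. all: by end_near. Qed.

Definition pp t s : R := 3 / cc t * AA 0 (s / cc t).
(** The average of G against pp, in the form without singularity at t = 0, see
    pp_int. *)
Definition UU G t : R := 3 * VV 0 G (cc t).

Lemma pp_int G C N t : ctpos G -> grow C N G -> 0 < t ->
  igr pos (fun s => pp t s * G s) /\ \int[mu]_(s in pos) (pp t s * G s) = UU G t.
Proof.
move=> cG gG t0; have c0 := cc_gt0 t0; set c := cc t in c0.
pose f s : R := AA 0 (s / c) * G s.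
have cf x : 0 < x -> {for x, continuous f}.
  move=> x0; apply: ctM; last exact: cG.
  apply: (@ct_comp R (AA 0) (fun x => x / c)); first exact: AA_ct.
  by apply: dv_ct; dvs; reflexivity.
have E z : f (c * z) = AA 0 z * G (c * z).
  by rewrite /f (_ : c * z / c = z)//; field; rewrite gt_eqF.
have iF : igr pos f.
  apply/(scale_igr c0 cf); apply: (@igr_eq R pos (fun z => AA 0 z * G (c * z))).
  - exact: mpos.
  - by move=> z _; rewrite E.
  - exact: (Vint_igr cG gG).
have mp := @mpos R.
have E2 x : pos x -> 3 / c * f x = pp t x * G x by move=> _; rewrite /pp -/c /f; ring.
split; first by apply: (@igr_eq R pos (fun x => 3 / c * f x) _ mp E2); exact: igrZ.
rewrite -(Rint_eq E2) (RintZ _ mp iF) /UU -/c.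
have := scale_int c0 cf iF; rewrite (@Rint_eq R pos _ (fun z => AA 0 z * G (c * z))); last first.
  by move=> z _; exact: E.
by rewrite -/(VV 0 G c) => ->; ring.
Qed.

Lemma UU_lim G C N l : ctpos G -> grow C N G -> G x @[x --> (0 : R)^'+] --> (l : R) ->
  UU G t @[t --> (0 : R)^'+] --> (l : R).
Proof.
move=> cG gG Gl; have H := @VV_lim R G C N cG gG 0 l Gl.
rewrite int_AA0 in H.
rewrite -[X in _ --> X](_ : 3 * (3^-1 * l) = l); last by field.
by apply: cvgMr; exact: (cvg_comp _ _ cc_lim H).
Qed.

Section caputo_UU.
Variables (G F H : R -> R) (C : R) (N : nat).
Hypotheses (cH : ctpos H) (gG : grow C N G) (gF : grow C N F) (gH : grow C N H).
Hypotheses (dG : forall s, 0 < s -> dv G s (F s)) (dF : forall s, 0 < s -> dv F s (H s)).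
Hypothesis F0 : F s @[s --> (0 : R)^'+] --> (0 : R).

(** The time derivative of UU G, see UU_dv. *)
Definition UUd t : R := - (cc t ^+ 2 / t) * VV 1 H (cc t).

Lemma UU_dv t : 0 < t -> dv (UU G) t (UUd t).
Proof.
move=> t0; have c0 := cc_gt0 t0; apply: dv_eq.
  apply: dvM; first exact: dv_cst.
  apply: (@dv_comp R (VV 0 G) cc); last exact: cc_dv.
  exact: (VV_dv cH gG gF gH dG dF F0).
by rewrite /UUd /=; field; rewrite gt_eqF.
Qed.

Lemma UUd_ct t : 0 < t -> {for t, continuous UUd}.
Proof.
move=> t0; have c0 := cc_gt0 t0; have dc := cc_dv t0.
apply: ctM.
  apply: dv_ct; apply: dvN; apply: dvM; first by apply: dvX; exact: dc.
  by apply: dvV; [rewrite gt_eqF|exact: dv_id].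
apply: (@ct_comp R (VV 1 H) cc); last exact: dv_ct dc.
exact: (VV_ct cH gH).
Qed.

Lemma UU_derive1 t : 0 < t -> derive1 (UU G) t = UUd t.
Proof. by move=> t0; have /dv_derive1[] := UU_dv t0. Qed.

Let Q t v : R := WW v * \int[mu]_(y in pos) (AA 1 (y / v) * H (cc t * y)).

(** Fubini exchanges the integral in v with the Airy average, and YY_airy
    evaluates the inner integral. *)
Lemma Q_int t : 0 < t -> igr uni (Q t) /\
  \int[mu]_(v in uni) Q t v = - I3 R * VV 0 H (cc t).
Proof.
move=> t0; have c0 := cc_gt0 t0; set c := cc t in c0.
have mp := @mpos R.
have [D D0 HD] := @AA_decay R N.+2 1.
pose M := D * (C * (1 + c) ^+ N).
pose f v y : R := WW v * (AA 1 (y / v) * H (c * y)).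
have le1 v y : 0 < v < 1 -> 0 < y -> `|AA 1 (y / v) * H (c * y)| <= M * ((1 + y) ^+ 2)^-1.
  move=> /andP[v0 v1] y0; have yv : y <= y / v by rewrite ler_pdivlMr// ler_piMr// ltW.
  have y1 : 0 < 1 + y by lra.
  rewrite normrM; have h1 := grow_scale gH c0 y0.
  have h2 : `|AA 1 (y / v)| <= D / (1 + y) ^+ N.+2.
    rewrite ler_pdivlMr ?exprn_gt0// mulrC; apply: le_trans (HD (y / v) _); last by lra.
    by rewrite ler_wpM2r//; apply: lerXn2r; rewrite ?nnegrE; lra.
  apply: (le_trans (ler_pM _ _ h2 h1)) => //.
  by rewrite le_eqVlt; apply/orP; left; apply/eqP; rewrite /M !exprS; field; rewrite ?expf_eq0 ?gt_eqF ?andbF ?exprn_gt0.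
have cf1 v y : 0 < v -> 0 < y -> {for y, continuous (fun y => AA 1 (y / v) * H (c * y))}.
  move=> v0 y0; apply: ctM.
    apply: (@ct_comp R (AA 1) (fun x => x / v)); first exact: AA_ct.
    by apply: dv_ct; dvs; reflexivity.
  apply: (@ct_comp R H (fun x => c * x)); first by apply: cH; exact: mulr_gt0.
  by apply: dv_ct; dvs; reflexivity.
have cf2 v y : 0 < v < 1 -> {for v, continuous (f ^~ y)}.
  move=> /andP[v0 v1]; apply: ctM; first by apply: WW_ct; rewrite v0.
  apply: ctM; last exact: ct_cst.
  apply: (@ct_comp R (AA 1) (fun v => y / v)); first exact: AA_ct.
  by apply: dv_ct; dvs; [rewrite gt_eqF|reflexivity].
have iM : igr pos (fun y => M * ((1 + y) ^+ 2)^-1) by apply: igrZ => //; exact: igr_inv2.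
have i1 v : 0 < v < 1 -> igr pos (fun y => AA 1 (y / v) * H (c * y)).
  move=> hv; have /andP[v0 v1] := hv.
  apply: (igr_le mp _ iM); last by move=> y; rewrite in_posE; exact: le1.
  by apply: meas_cont => [|y]; [exact: open_pos|rewrite in_posE; exact: cf1].
have iW : igr uni (@WW R) by exact: WW_igr.
pose L := \int[mu]_(y in pos) (M * ((1 + y) ^+ 2)^-1).
have [|||||h1 h2 h3] := @fubini_R R uni pos f (fun v => L * WW v) muni mp.
- apply: sepcont_meas; [exact: open_oo|exact: open_pos| |].
    move=> v y; rewrite ooE in_posE => /andP[v0 v1] y0.
    by apply: ctM; [exact: ct_cst|exact: cf1].
  by move=> v y; rewrite ooE => hv _; exact: cf2.
- by move=> v; rewrite ooE => hv; apply: igrZ => //; exact: i1.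
- move=> y; rewrite in_posE => y0.
  apply: (@igr_le R uni _ (fun v => (M * ((1 + y) ^+ 2)^-1) * WW v)) => //.
  + by apply: meas_cont => [|v]; [exact: open_oo|rewrite ooE; exact: cf2].
  + exact: igrZ.
  + move=> v; rewrite ooE => hv; rewrite /f normrM [leLHS]mulrC [`|WW v|]gtr0_norm ?WW_gt0//.
    by rewrite ler_wpM2r ?le1// ltW// WW_gt0.
- exact: igrZ.
- move=> v; rewrite ooE => hv; have w0 := WW_gt0 hv.
  rewrite (@Rint_eq R pos _ (fun y => WW v * `|AA 1 (y / v) * H (c * y)|)); last first.
    by move=> y _; rewrite /f normrM gtr0_norm.
  rewrite (RintZ _ mp (igr_norm mp (i1 v hv))) [leLHS]mulrC ler_wpM2r ?(ltW w0)//.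
  apply: Rint_le => //; first exact: igr_norm (i1 v hv).
  by move=> y; rewrite in_posE; exact: le1.
have EQ v : uni v -> \int[mu]_(y in pos) f v y = Q t v.
  by rewrite ooE => hv; rewrite /f (RintZ _ mp (i1 v hv)).
split; first exact: (igr_eq muni EQ h1).
rewrite -(Rint_eq EQ) h3.
rewrite (@Rint_eq R pos _ (fun y => - I3 R * (AA 0 y * H (c * y)))).
  by rewrite (RintZ _ mp (Vint_igr cH gH 0 c0)).
move=> y; rewrite in_posE => y0.
rewrite (@Rint_eq R uni _ (fun v => H (c * y) * Yint 0 1 y v)); last first.
  by move=> v _; rewrite /f /Yint expr0 divr1; ring.
by rewrite (RintZ _ muni (Yint_igr 0 1 y0)) -/(YY 0 1 y) YY_airy//; ring.
Qed.

(** Since cc (t v^3) = cc t * v, the Caputo integrand under s = t v^3 involves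
    t only through powers. *)
Lemma Q_subst t v : 0 < t -> 0 < v < 1 ->
  UUd (t * v ^+ 3) / (t - t * v ^+ 3) `^ (2 / 3) * (t * (3 * v ^+ 2)) =
  - 3 * cc t ^+ 2 / cbrt t ^+ 2 * Q t v.
Proof.
move=> t0 hv; have /andP[v0 v1] := hv; have c0 := cc_gt0 t0.
have q0 := qq_gt0 hv; have k0 := cbrt_gt0 t0; have w1 := cube_lt1 hv.
have -> : t - t * v ^+ 3 = t * (1 - v ^+ 3) by ring.
rewrite powR23 ?mulr_ge0 ?(ltW t0) ?(ltW w1)// cbrtM ?(ltW t0) ?(ltW w1)// -/(qq v).
rewrite /UUd cc_scale// /Q /WW.
have -> : \int[mu]_(y in pos) (AA 1 (y / v) * H (cc t * y)) = v * VV 1 H (cc t * v).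
  have cf x : 0 < x -> {for x, continuous (fun y => AA 1 (y / v) * H (cc t * y))}.
    move=> x0; apply: ctM.
      apply: (@ct_comp R (AA 1) (fun x => x / v)); first exact: AA_ct.
      by apply: dv_ct; dvs; reflexivity.
    apply: (@ct_comp R H (fun x => cc t * x)); first by apply: cH; exact: mulr_gt0.
    by apply: dv_ct; dvs; reflexivity.
  have E z : AA 1 (v * z / v) * H (cc t * (v * z)) = AA 1 z * H (cc t * v * z).
    by rewrite mulrA (_ : v * z / v = z)//; field; rewrite gt_eqF.
  have := @scale_int R (fun y => AA 1 (y / v) * H (cc t * y)) v v0 cf.
  rewrite (@Rint_eq R pos (fun r => AA 1 (v * r / v) * H (cc t * (v * r))) _ (fun z _ => E z)) -/(VV 1 H (cc t * v)).
  move=> ->; first by rewrite mulrA divff ?mul1r// gt_eqF.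
  apply/(scale_igr v0 cf).
  have i := Vint_igr cH gH 1 (mulr_gt0 c0 v0).
  by apply: (igr_eq (@mpos R) _ i) => z _; rewrite E.
by field; rewrite !gt_eqF.
Qed.

(** The powers of t and 3 cancel against Gamma (1/3) = 3^(2/3) I3. *)
Lemma UU_caputo t : 0 < t ->
  igr `]0, t[%classic (caputo_integrand (2 / 3) (UU G) t) /\ caputo (2 / 3) (UU G) t = lambda ^+ 2 * UU H t.
Proof.
move=> t0; have c0 := cc_gt0 t0; have k0 := cbrt_gt0 t0; have k3 := cbrt_cube (ltW t0).
pose D := `]0, t[%classic : set R.
have DE s : D s = (0 < s < t) :> Prop by rewrite /D ooE.
pose f s := UUd s / (t - s) `^ (2 / 3).
have ex := @exh_oo R 0 1 ltr01.
have cf s : D s -> {for s, continuous f}.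
  rewrite DE => /andP[s0 s1]; apply: ctM; first exact: UUd_ct.
  have ts : 0 < t - s by rewrite subr_gt0.
  by apply: dv_ct; dvs; [..|reflexivity]; rewrite ?gt_eqF ?powR_gt0.
have dphi x : uni x -> dv (fun v => t * v ^+ 3) x (t * (3 * x ^+ 2)).
  by move=> _; dvs; rewrite /=; ring.
have cphi x : uni x -> {for x, continuous (fun v : R => t * (3 * v ^+ 2))}.
  by move=> _; apply: dv_ct; dvs; reflexivity.
have p0 x : uni x -> 0 < t * (3 * x ^+ 2).
  by rewrite ooE => /andP[x0 _]; rewrite !mulr_gt0// exprn_gt0.
have pD x : uni x -> D (t * x ^+ 3).
  rewrite ooE DE => hx; have := cube_lt1 hx; have /andP[x0 _] := hx => ?.
  have x3 : 0 < x ^+ 3 by rewrite exprn_gt0.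
  by rewrite mulr_gt0//= gtr_pMr//; lra.
have pS y : D y -> exists2 x, uni x & t * x ^+ 3 = y.
  rewrite DE => /andP[y0 y1]; have yt : 0 < y / t by rewrite divr_gt0.
  have E := cbrt_cube (ltW yt); have q0 := cbrt_gt0 yt.
  exists (cbrt (y / t)); last by rewrite E; field; rewrite gt_eqF.
  rewrite ooE q0 /= -(ltr_pXn2r (_ : 0 < 3)%N) ?nnegrE ?(ltW q0)// E expr1n.
  by rewrite ltr_pdivrMr// mul1r.
have oD : open D by exact: open_oo.
have S1 := @subst_igr R uni D _ _ _ _ f (@open_oo R 0 1) oD ex dphi cphi p0 pD pS cf.
have S2 := @subst_int R uni D _ _ _ _ f (@open_oo R 0 1) oD ex dphi cphi p0 pD pS cf.
have [iQ vQ] := Q_int t0.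
have E x : uni x -> - 3 * cc t ^+ 2 / cbrt t ^+ 2 * Q t x = f (t * x ^+ 3) * (t * (3 * x ^+ 2)).
  by rewrite ooE => hx; rewrite /f Q_subst.
have iF : igr D f.
  by apply/S1; apply: (igr_eq muni E); exact: igrZ.
have mD : measurable D by exact: measurable_itv.
have EF s : D s -> f s = caputo_integrand (2 / 3) (UU G) t s.
  by rewrite DE => /andP[s0 _]; rewrite /caputo_integrand UU_derive1.
split; first exact: igr_eq EF iF.
rewrite /caputo -(Rint_eq EF) -(S2 iF) -(Rint_eq E) (RintZ _ muni iQ) vQ Gamma13 /UU.
have g0 := cbrt_gt0 (ltr0n R 3 : 0 < 3); have i0 := @I3_gt0 R.
have -> : cc t = lambda * (cbrt 3 * cbrt t) by rewrite /cc cbrtM// ltW.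
move: (VV 0 H _) => V; field.
by rewrite !gt_eqF.
Qed.

End caputo_UU.

End caputo_average.


(** * The superposition integral *)

Section superposition.
Variable R : realType.
Implicit Types (f g h F phi psi k G : R -> R) (x y a b r v s t c d : R) (D : set R).
Notation mu := (@lebesgue_measure R).
Notation igr D f := (mu.-integrable D (EFin \o f)).
Notation pos := (`]0, +oo[%classic : set R).

(** An integrable majorant s^(-1/2) / (1 + s) of the integrand of u, with
    primitive 2 atan (sqrt s). *)
Definition ss s : R := (Num.sqrt s * (1 + s))^-1.

Lemma ss_igr : igr pos ss.
Proof.
have [||||| h _] // := @ftc_pos_ge0 R ss (fun s => 2 * atan (Num.sqrt s)) 0 (2 * (pi / 2)).
- move=> x x0; have q0 : 0 < Num.sqrt x by rewrite sqrtr_gt0.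
  apply: dv_eq.
    apply: dvM; first exact: dv_cst.
    by apply: (@dv_atan R Num.sqrt); exact: (@dv_sqrt R (fun y => y) x _ x0 (dv_id x)).
  rewrite /= /ss sqr_sqrtr ?(ltW x0)//.
  have x1 : 0 < 1 + x by lra.
  by move: (Num.sqrt x) q0 => q q0; field; rewrite !gt_eqF.
- move=> x x0; have q0 : 0 < Num.sqrt x by rewrite sqrtr_gt0.
  have x1 : 0 < 1 + x by lra.
  have n0 : Num.sqrt x * (1 + x) != 0 by rewrite gt_eqF// mulr_gt0.
  by apply: dv_ct; rewrite /ss; dvs; [exact: n0|exact: (@dv_sqrt R (fun y => y) x _ x0 (dv_id x))|reflexivity].
- by move=> x x0; rewrite invr_ge0 mulr_ge0 ?sqrtr_ge0//; lra.
- have E : (fun s : R => 2 * atan (Num.sqrt s)) 0 = 0 by rewrite sqrtr0 atan0 mulr0.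
  have S : Num.sqrt s @[s --> (0 : R)^'+] --> (0 : R).
    by rewrite -[X in _ --> X](@sqrtr0 R); apply: ct_right; exact: sqrt_continuous.
  rewrite -[X in _ --> X](mulr0 (2 : R)); apply: cvgMr; rewrite -[X in _ --> X](@atan0 R).
  exact: (cvg_comp _ _ S (@continuous_atan R 0)).
- apply: cvgMr; have S : (Num.sqrt s : R) @[s --> (+oo : set_system R)] --> (+oo : set_system R).
    apply/cvgryPge => A; near=> s; have [A0|A0] := leP A 0.
      by rewrite (le_trans A0)// sqrtr_ge0.
    rewrite -(ler_pXn2r (_ : 0 < 2)%N) ?nnegrE ?sqrtr_ge0 ?(ltW A0)//.
    rewrite sqr_sqrtr; last by near: s; apply: nbhs_pinfty_ge; rewrite num_real.
    by near: s; apply: nbhs_pinfty_ge; rewrite num_real.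
  exact: (cvg_comp _ _ S (@cvgy_atan R)).
Unshelve. all: by end_near. Qed.

Variable lambda : R.
Hypothesis l0 : 0 < lambda.
Let d0 : R := - (pi / 4).

Lemma u_integrandE x t s : 0 < t -> 0 < s ->
  u_integrand lambda x t s = pp lambda t s * KK d0 s x.
Proof.
move=> t0 s0; have c0 := cc_gt0 l0 t0.
rewrite /u_integrand -/(cbrt _) airyE; last by rewrite divr_ge0// ltW.
rewrite /pp /KK /d0 /cc in c0 *; set q := _^-1; set k := cos _; set A := AA _ _.
by rewrite invfM; ring.
Qed.

Lemma pp_ct t s : 0 < t -> {for s, continuous (pp lambda t)}.
Proof.
move=> t0; apply: ctM; first exact: ct_cst.
apply: (@ct_comp R (AA 0) (fun s => s / cc lambda t)); first exact: AA_ct.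
by apply: dv_ct; dvs; reflexivity.
Qed.

Lemma pp_le t : 0 < t -> exists2 M, 0 <= M & forall s, 0 < s -> `|pp lambda t s| <= M * (1 + s)^-1.
Proof.
move=> t0; have c0 := cc_gt0 l0 t0; set c := cc lambda t in c0.
have [D D0 HD] := @AA_decay R 1 0.
have k0 : 0 <= 3 / c by rewrite divr_ge0// ltW.
exists (3 / c * (D * (1 + c))) => [|s s0].
  by apply: mulr_ge0 => //; apply: mulr_ge0 => //; lra.
rewrite /pp -/c normrM (ger0_norm k0) -[leRHS]mulrA ler_wpM2l//.
have s1 : 0 < 1 + s by lra.
rewrite ler_pdivlMr//; have sc : 0 < s / c by rewrite divr_gt0.
have := HD _ (ltW sc); rewrite expr1 => h.
have e : 1 + s <= (1 + c) * (1 + s / c).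
  have -> : (1 + c) * (1 + s / c) = 1 + s + c + s / c by field; rewrite gt_eqF.
  lra.
apply: (@le_trans _ _ (`|AA 0 (s / c)| * ((1 + c) * (1 + s / c)))); first by rewrite ler_wpM2l.
have := normr_ge0 (AA 0 (s / c)); nra.
Qed.

Definition uint t x s : R := pp lambda t s * KK d0 s x.

Lemma uint_le t : 0 < t -> exists2 M, 0 <= M & forall x s, 0 < s -> `|uint t x s| <= M * ss s.
Proof.
move=> t0; have [M M0 HM] := pp_le t0.
have k0 : 0 < (Num.sqrt (2 * pi : R))^-1 by rewrite invr_gt0 sqrtr_gt0 mulr_gt0// pi_gt0.
exists (M * (Num.sqrt (2 * pi))^-1) => [|x s s0]; first by rewrite mulr_ge0// ltW.
have h := KK_le d0 x s0; have h1 := HM s s0.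
rewrite /uint normrM; apply: (le_trans (ler_pM _ _ h1 h)) => //.
by rewrite sqrtrM ?mulr_ge0 ?pi_ge0// /ss !invfM le_eqVlt; apply/orP; left; apply/eqP; ring.
Qed.

Lemma uint_ct t x s : 0 < t -> 0 < s -> {for s, continuous (uint t x)}.
Proof.
move=> t0 s0; apply: ctM; first exact: pp_ct.
exact: dv_ct (KK_dvs d0 x s0).
Qed.

Lemma uint_ctx t x s : {for x, continuous (uint t ^~ s)}.
Proof. by apply: ctM; [exact: ct_cst|exact: KK_ct]. Qed.

Lemma uint_meas t x : 0 < t -> measurable_fun pos (uint t x).
Proof.
by move=> t0; apply: meas_cont => [|s]; [exact: open_pos|rewrite in_posE; exact: uint_ct].
Qed.

Lemma uint_igr t x : 0 < t -> igr pos (uint t x).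
Proof.
move=> t0; have [M M0 HM] := uint_le t0; have mp := @mpos R.
apply: (igr_le mp (uint_meas x t0) (igrZ M mp ss_igr)) => s.
by rewrite in_posE; exact: HM.
Qed.

Lemma u_integrand_igr x t : 0 < t -> igr pos (u_integrand lambda x t).
Proof.
move=> t0; apply: (igr_eq (@mpos R) _ (uint_igr x t0)) => s.
by rewrite in_posE => s0; rewrite u_integrandE.
Qed.

Lemma u_solE x t : 0 < t -> u_sol lambda x t = \int[mu]_(s in pos) uint t x s.
Proof.
by move=> t0; apply: Rint_eq => s; rewrite in_posE => s0; rewrite u_integrandE.
Qed.

Lemma u_sol_le t : 0 < t -> exists2 M, 0 <= M & forall x, `|u_sol lambda x t| <= M.
Proof.
move=> t0; have [M M0 HM] := uint_le t0; have mp := @mpos R.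
exists (\int[mu]_(s in pos) (M * ss s)).
  apply: Rintegral_ge0 => s; rewrite in_posE => s0.
  by rewrite (le_trans _ (HM 0 s s0)).
move=> x; rewrite u_solE//.
apply: (Rint_le_norm mp (uint_meas x t0) (igrZ M mp ss_igr)) => s.
by rewrite in_posE; exact: HM.
Qed.

Lemma u_sol_ct t x : 0 < t -> {for x, continuous (u_sol lambda ^~ t)}.
Proof.
move=> t0; have [M M0 HM] := uint_le t0; have mp := @mpos R.
rewrite (_ : u_sol lambda ^~ t = fun x => \int[mu]_(s in pos) uint t x s); last first.
  by apply/funext => z; exact: u_solE.
apply: (@int_ct R pos (uint t) (fun s => M * ss s) (x - 1) (x + 1)) => //.
- by apply/andP; split; lra.
- by move=> z _; exact: uint_meas.
- by move=> z s _ _; exact: uint_ctx.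
- by apply: igrZ => //; exact: ss_igr.
- by move=> z s _; rewrite in_posE; exact: HM.
Qed.

Lemma schwartz_igr phi : schwartz phi -> igr setT phi.
Proof.
move=> sp; have [M M0 HM] := schwartz_JJ 0 sp.
apply: (@igr_le R setT _ (fun x => M * JJ 0 x)) => //.
- by apply: meas_cont => [|x _]; [exact: openT|exact: (@schwartz_ct R phi 0 x sp)].
- by apply: igrZ => //; exact: (proj1 (JJ_igr 0)).
- by move=> x _; have := HM 0 x; rewrite addr0.
Qed.

Lemma u_sol_phi_igr t phi : 0 < t -> schwartz phi -> igr setT (fun x => u_sol lambda x t * phi x).
Proof.
move=> t0 sp; have [M M0 HM] := u_sol_le t0.
apply: (@igr_le R setT _ (fun x => M * `|phi x|)) => //.
- apply: meas_cont => [|x _]; first exact: openT.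
  by apply: ctM; [exact: u_sol_ct|exact: (@schwartz_ct R phi 0 x sp)].
- by apply: igrZ => //; apply: igr_norm => //; exact: schwartz_igr.
- by move=> x _; rewrite normrM ler_wpM2r.
Qed.

Definition G0 phi s : R := GG d0 phi s 0.

(** Pairing with phi and integrating in s commute; the inner integral over x
    is the Schroedinger evolution of phi at the point 0. *)
Lemma u_distE t phi : 0 < t -> schwartz phi ->
  function_dist (fun x => u_sol lambda x t) phi = UU lambda (G0 phi) t.
Proof.
move=> t0 sp; have [M M0 HM] := uint_le t0; have mp := @mpos R.
have ip := schwartz_igr sp.
have [C C0 HC] := GG_bound d0 0 sp.
have cG : ctpos (G0 phi) by move=> s s0; exact: dv_ct (GG_dvs d0 0 0 sp s0).
have gG : grow C 0 (G0 phi) by move=> s s0; rewrite expr0 mulr1; exact: HC.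
have [iP <-] := pp_int l0 cG gG t0.
pose f s x : R := uint t x s * phi x.
set L := \int[mu]_x `|phi x|.
have ipn : igr setT (fun x => `|phi x|) by exact: igr_norm.
have i2 s : 0 < s -> igr setT (f s).
  move=> s0; apply: (@igr_le R setT _ (fun x => (M * ss s) * `|phi x|)) => //.
  + apply: meas_cont => [|x _]; first exact: openT.
    by apply: ctM; [exact: uint_ctx|exact: (@schwartz_ct R phi 0 x sp)].
  + exact: igrZ.
  + by move=> x _; rewrite normrM ler_wpM2r// HM.
have [|||||h1 h2 h3] := @fubini_R R pos setT f (fun s => L * (M * ss s)) mp measurableT.
- apply: sepcont_meas; [exact: open_pos|exact: openT| |].
    move=> s x; rewrite in_posE => s0 _.
    by apply: ctM; [exact: uint_ctx|exact: (@schwartz_ct R phi 0 x sp)].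
  by move=> s x; rewrite in_posE => s0 _; apply: ctM; [exact: uint_ct|exact: ct_cst].
- by move=> s; rewrite in_posE; exact: i2.
- move=> x _; rewrite (_ : f^~ x = fun s => phi x * uint t x s); last by apply/funext => s; rewrite /f mulrC.
  by apply: igrZ => //; exact: uint_igr.
- by apply: igrZ => //; apply: igrZ => //; exact: ss_igr.
- move=> s; rewrite in_posE => s0; rewrite [leRHS]mulrC /L -(RintZ _ measurableT ipn).
  apply: Rint_le => //.
  + by apply: igr_norm => //; exact: i2.
  + exact: igrZ.
  + by move=> x _; rewrite normrM ler_wpM2r// HM.
rewrite /function_dist.
rewrite (@Rint_eq R setT _ (fun x => \int[mu]_(s in pos) f s x)).
  rewrite -h3; apply: Rint_eq => s; rewrite in_posE => s0.
  rewrite (@Rint_eq R setT _ (fun x => pp lambda t s * (KK d0 s x * phi (x + 0)))).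
    by rewrite (RintZ _ measurableT (GG_igr d0 0 0 sp s0)).
  by move=> x _; rewrite /f /uint addr0 mulrA.
move=> x _; rewrite u_solE// mulrC -(RintZ _ mp (uint_igr x t0)).
by apply: Rint_eq => s _; rewrite /f mulrC.
Qed.

End superposition.


(** * Existence *)

Section existence.
Variable R : realType.
Implicit Types (f g h F phi psi k G : R -> R) (x y a b r v s t c d : R) (D : set R).
Notation mu := (@lebesgue_measure R).
Notation igr D f := (mu.-integrable D (EFin \o f)).
Notation pos := (`]0, +oo[%classic : set R).

(** With this phase the evolution starts at the identity, see GG_lim. *)
Definition ph0 : R := - (pi / 4).

Lemma GG_pi d phi s y : schwartz phi -> 0 < s ->
  GG (d - pi / 2 - pi / 2) phi s y = - GG d phi s y.
Proof.
move=> sp s0; have I : igr setT (fun x => KK d s x * phi (x + y)) by exact: (GG_igr d 0 y sp s0).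
rewrite /GG -[RHS]mulN1r -(RintZ _ measurableT I).
apply: Rint_eq => x _; rewrite /KK !addrA cosBpihalf sinBpihalf.
by rewrite /=; ring.
Qed.

(** The first and second derivatives in s of the evolution are GF and GH. *)
Definition GF phi y s : R := - 2^-1 * GG (ph0 - pi / 2) (derive1n 2 phi) s y.
Definition GH phi y s : R := - 4^-1 * GG ph0 (derive1n 4 phi) s y.

Lemma G_dv phi y s : schwartz phi -> 0 < s -> dv (fun s => GG ph0 phi s y) s (GF phi y s).
Proof. by move=> sp s0; exact: (GG_dvs ph0 0 y sp s0). Qed.

Lemma GF_dv phi y s : schwartz phi -> 0 < s -> dv (GF phi y) s (GH phi y s).
Proof.
move=> sp s0; apply: dv_eq.
  by apply: dvM; [exact: dv_cst|exact: (GG_dvs (ph0 - pi / 2) 2 y sp s0)].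
rewrite GG_pi//; last exact: (schwartz_derive1n 4).
rewrite mul0r add0r /GH /=; move: (GG _ _ _ _) => z; by field.
Qed.

Lemma GH_ct phi y : schwartz phi -> ctpos (GH phi y).
Proof.
move=> sp s s0; apply: ctM; first exact: ct_cst.
exact: dv_ct (GG_dvs ph0 4 y sp s0).
Qed.

Lemma GF_lim phi y : schwartz phi -> GF phi y s @[s --> (0 : R)^'+] --> (0 : R).
Proof.
move=> sp; rewrite -[X in _ --> X](mulr0 (- 2^-1)); apply: cvgMr.
have := @GG_lim R (ph0 - pi / 2) _ y (schwartz_derive1n 2 sp).
rewrite (_ : ph0 - pi / 2 + pi / 4 = - (pi / 2)); last by rewrite /ph0; move: (pi : R) => p; field.
by rewrite cosN cos_pihalf mul0r.
Qed.

Lemma G_lim phi y : schwartz phi -> GG ph0 phi s y @[s --> (0 : R)^'+] --> phi y.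
Proof.
move=> sp; have := @GG_lim R ph0 _ y sp.
by rewrite (_ : ph0 + pi / 4 = 0) ?cos0 ?mul1r// /ph0 addNr.
Qed.

(** Growth of degree 0: GG_bound is uniform in s. *)
Lemma G_grow phi : schwartz phi -> exists2 C, 0 <= C &
  forall y, [/\ grow C 0 (fun s => GG ph0 phi s y), grow C 0 (GF phi y) & grow C 0 (GH phi y)].
Proof.
move=> sp; have [C1 C10 H1] := GG_bound ph0 0 sp.
have [C2 C20 H2] := GG_bound (ph0 - pi / 2) 2 sp.
have [C3 C30 H3] := GG_bound ph0 4 sp.
exists (C1 + C2 + C3) => [|y]; first by rewrite !addr_ge0.
split=> s s0; rewrite expr0 mulr1.
- by have := H1 s y s0; rewrite /=; lra.
- have := H2 s y s0; rewrite /GF normrM => h.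
  have e : `|- 2^-1 : R| = 2^-1 by rewrite normrN ger0_norm// invr_ge0.
  rewrite e; lra.
- have := H3 s y s0; rewrite /GH normrM => h.
  have e : `|- 4^-1 : R| = 4^-1 by rewrite normrN ger0_norm// invr_ge0.
  rewrite e; lra.
Qed.

Lemma seminorm_ge phi m n x : schwartz phi -> `|x ^+ m * derive1n n phi x| <= schwartz_seminorm m n phi.
Proof.
move=> [_ b]; have [C HC] := b m n; apply: ub_le_sup; last by exists x.
by exists C => _ [z _ <-]; exact: HC.
Qed.

Lemma seminorm_ge0 phi m n : schwartz phi -> 0 <= schwartz_seminorm m n phi.
Proof. by move=> sp; apply: le_trans (seminorm_ge m n 0 sp). Qed.

Lemma seminorm_sum_ge phi N m n : schwartz phi -> (m <= N)%N -> (n <= N)%N ->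
  schwartz_seminorm m n phi <= \sum_(m < N.+1) \sum_(n < N.+1) schwartz_seminorm m n phi.
Proof.
move=> sp mN nN; rewrite (bigD1 (inord m : 'I_N.+1))//= (bigD1 (inord n : 'I_N.+1))//=.
rewrite !inordK// -addrA lerDl addr_ge0//; apply: sumr_ge0 => i _.
  exact: seminorm_ge0.
by apply: sumr_ge0 => j _; exact: seminorm_ge0.
Qed.

Variable lambda : R.
Hypothesis l0 : 0 < lambda.

Lemma u_tempered t : 0 < t -> tempered (function_dist (fun x => u_sol lambda x t)).
Proof.
move=> t0; split.
  move=> a phi psi sp sq; rewrite /function_dist.
  have i1 := u_sol_phi_igr l0 t0 sp; have i2 := u_sol_phi_igr l0 t0 sq.
  rewrite -(RintZ a measurableT i1) -(RintD measurableT (igrZ a measurableT i1) i2).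
  by apply: Rint_eq => x _; ring.
have [M M0 HM] := u_sol_le l0 t0; exists (M * (2 * pi)), 2%N => phi sp.
set S := \sum_(_ < _) _.
have S0 : 0 <= S by apply: le_trans (seminorm_sum_ge sp (leq0n 2) (leq0n 2)); exact: seminorm_ge0.
have [iJ vJ] := JJ_igr (0 : R).
have HP x : `|phi x| <= 2 * S * JJ 0 x.
  rewrite /JJ addr0 ler_pdivlMr; last by have := sqr_ge0 x; lra.
  have h1 := le_trans (seminorm_ge 0 0 x sp) (seminorm_sum_ge sp (leq0n 2) (leq0n 2)).
  have h2 := le_trans (seminorm_ge 2 0 x sp) (seminorm_sum_ge sp (leqnn 2) (leq0n 2)).
  rewrite /= -/S expr0 mul1r in h1; rewrite /= -/S normrM ger0_norm ?sqr_ge0// in h2.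
  rewrite mulrDr mulr1 mulrC; lra.
rewrite (_ : M * (2 * pi) * S = (M * (2 * S)) * \int[mu]_x JJ 0 x); last first.
  by rewrite vJ; move: (pi : R) => p; ring.
rewrite -(RintZ _ measurableT iJ); apply: Rint_le_norm => //.
- exact: igr_meas (u_sol_phi_igr l0 t0 sp).
- exact: igrZ.
- move=> x _; rewrite normrM -mulrA; apply: ler_pM => //.
Qed.

(** UU_caputo for the evolution of phi at the point 0; the second derivative
    in s is - 1/4 times the evolution of the fourth derivative of phi. *)
Lemma u_cauchy : cauchy_solution lambda (fun t => function_dist (fun x => u_sol lambda x t)).
Proof.
split; first exact: u_tempered.
move=> phi sp g.
have gE t : 0 < t -> g t = UU lambda (fun s => GG ph0 phi s 0) t.
  by move=> t0; rewrite /g u_distE.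
have [C C0 HC] := G_grow sp; have [g1 g2 g3] := HC 0.
have dG s : 0 < s -> dv (fun s => GG ph0 phi s 0) s (GF phi 0 s) by exact: G_dv.
have dF s : 0 < s -> dv (GF phi 0) s (GH phi 0 s) by exact: GF_dv.
have cH := @GH_ct _ 0 sp; have F0 := @GF_lim phi 0 sp.
have cG : ctpos (fun s => GG ph0 phi s 0) by move=> s s0; exact: dv_ct (dG s s0).
have dU t : 0 < t -> dv g t (UUd lambda (GH phi 0) t).
  move=> t0; apply: dv_near (UU_dv l0 cH g1 g2 g3 dG dF F0 t0).
  by near=> z; rewrite gE//; near: z; exact: lt_nbhsr.
have d1 t : 0 < t -> derive1 g t = UUd lambda (GH phi 0) t.
  by move=> t0; have /dv_derive1[] := dU t t0.
have ci t s : 0 < s -> caputo_integrand (2 / 3) (UU lambda (fun s => GG ph0 phi s 0)) t s =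
    caputo_integrand (2 / 3) g t s.
  by move=> s0; rewrite /caputo_integrand d1// (UU_derive1 l0 cH g1 g2 g3 dG dF F0).
have mo t : measurable (`]0, t[%classic : set R) by exact: measurable_itv.
have cE t : (`]0, t[%classic : set R) `<=` pos.
  by move=> x; rewrite ooE in_posE => /andP[].
split.
- move=> t t0; split; first by have /dv_derive1[] := dU t t0.
  apply: (@cvg_trans _ (UUd lambda (GH phi 0) z @[z --> t])); last first.
    rewrite d1//; exact: (UUd_ct l0 cH g3 t0).
  apply: near_eq_cvg; near=> z; rewrite d1//; near: z; exact: lt_nbhsr.
- apply: (@cvg_trans _ (UU lambda (fun s => GG ph0 phi s 0) t @[t --> (0 : R)^'+])); last first.
    exact: (UU_lim l0 cG g1 (@G_lim phi 0 sp)).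
  by apply: near_eq_cvg; near=> t; rewrite gE//; near: t; exact: nbhs_right_gt.
- move=> t t0; have [h _] := UU_caputo l0 cH g1 g2 g3 dG dF F0 t0.
  apply: igr_eq h => // s; rewrite ooE => /andP[s0 _]; exact: ci.
- move=> t t0; have [_ h] := UU_caputo l0 cH g1 g2 g3 dG dF F0 t0.
  have -> : caputo (2 / 3) g t = caputo (2 / 3) (UU lambda (fun s => GG ph0 phi s 0)) t.
    congr (_ * _); apply: Rint_eq => s; rewrite ooE => /andP[s0 _].
    exact: (esym (ci t s s0)).
  have s4 := schwartz_derive1n 4 sp.
  rewrite h /dist_derive u_distE// /UU /GH.
  rewrite /VV (@Rint_eq R pos _ (fun z => - 4^-1 * (AA 0 z * G0 (derive1n 4 phi) (cc lambda t * z)))); last first.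
    by move=> z _; rewrite /G0; ring.
  have [C' C'0 HC'] := G_grow s4; have [g1' _ _] := HC' 0.
  have cG' : ctpos (G0 (derive1n 4 phi)) by move=> s s0; exact: dv_ct (G_dv 0 s4 s0).
  rewrite (RintZ _ (@mpos R) (Vint_igr cG' g1' 0 (cc_gt0 l0 t0))).
  by rewrite -signr_odd expr0; field.
Unshelve. all: by end_near. Qed.

End existence.


(** * A beta integral *)

Section beta_integral.
Variable R : realType.
Implicit Types (f g h F phi psi k q : R -> R) (x y a b r v s t c d T : R) (D : set R).
Notation mu := (@lebesgue_measure R).
Notation igr D f := (mu.-integrable D (EFin \o f)).
Notation pos := (`]0, +oo[%classic : set R).
Notation uni := (`]0, 1[%classic : set R).

Let muni : measurable uni. Proof. exact: measurable_itv. Qed.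

Definition bker x : R := (cbrt x ^+ 2)^-1 * (cbrt (1 - x))^-1.
(** The beta integral B(1/3, 2/3). *)
Definition Bc : R := \int[mu]_(x in uni) bker x.

Lemma cbrt_lt1 x : 0 < x < 1 -> cbrt x < 1.
Proof.
move=> /andP[x0 x1]; rewrite -(ltr_pXn2r (_ : 0 < 3)%N) ?nnegrE ?ltW ?cbrt_gt0//.
by rewrite cbrt_cube ?expr1n// ltW.
Qed.

Lemma bker_ct x : 0 < x < 1 -> {for x, continuous bker}.
Proof.
move=> /andP[x0 x1]; have x2 : 0 < 1 - x by lra.
have c1 := cbrt_gt0 x0; have c2 := cbrt_gt0 x2.
apply: dv_ct; apply: dvM.
  by apply: dvV; [rewrite expf_neq0// gt_eqF|apply: dvX; exact: cbrt_dv].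
apply: dvV; first by rewrite gt_eqF.
by apply: (@dv_cbrt R (fun x => 1 - x)) => //; dvs; reflexivity.
Qed.

Lemma bker_ge1 x : 0 < x < 1 -> 1 <= bker x.
Proof.
move=> hx; have /andP[x0 x1] := hx; have x2 : 0 < 1 - x < 1 by apply/andP; split; lra.
have /andP[x3 _] := x2.
have c1 := cbrt_gt0 x0; have c2 := cbrt_gt0 x3.
have d1 := cbrt_lt1 hx; have d2 := cbrt_lt1 x2.
rewrite -[1]mulr1; apply: ler_pM => //; rewrite invf_ge1 ?exprn_gt0//; last exact: ltW.
by rewrite expr_le1// ltW.
Qed.

Lemma bker_igr : igr uni bker.
Proof.
have ou := @open_oo R 0 1.
have dphi x : uni x -> dv (fun v : R => v ^+ 3) x (3 * x ^+ 2).
  by move=> _; dvs; rewrite /=; ring.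
have cphi x : uni x -> {for x, continuous (fun v : R => 3 * v ^+ 2)}.
  by move=> _; apply: dv_ct; dvs; reflexivity.
have p0 x : uni x -> 0 < 3 * x ^+ 2.
  by rewrite ooE => /andP[x0 _]; rewrite mulr_gt0// exprn_gt0.
have pD x : uni x -> uni (x ^+ 3).
  rewrite !ooE => /andP[x0 x1]; rewrite exprn_gt0//= expr_lt1//; exact: ltW.
have pS y : uni y -> exists2 x, uni x & x ^+ 3 = y.
  rewrite ooE => hy; have /andP[y0 y1] := hy; exists (cbrt y); last by rewrite cbrt_cube// ltW.
  by rewrite ooE cbrt_gt0// cbrt_lt1.
have cb y : uni y -> {for y, continuous bker} by rewrite ooE; exact: bker_ct.
apply/(@subst_igr R uni uni _ _ _ _ bker ou ou (@exh_oo R 0 1 ltr01) dphi cphi p0 pD pS cb).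
have E v : uni v -> bker (v ^+ 3) * (3 * v ^+ 2) = 3 * (qq v)^-1.
  rewrite ooE => hv; have /andP[v0 v1] := hv; have q0 := qq_gt0 hv.
  rewrite /bker cbrt_X3 ?(ltW v0)// -/(qq v).
  by field; rewrite !gt_eqF.
apply: (@igr_eq R uni (fun v => 3 * (qq v)^-1) _ muni); first by move=> v uv; rewrite E.
apply: igrZ => //; apply: (@igr_le R uni _ (@WW R)) => //.
- apply: meas_cont => // v; rewrite ooE => hv.
  by apply: dv_ct (dvV _ (qq_dv hv)); rewrite gt_eqF// qq_gt0.
- exact: WW_igr.
- move=> v; rewrite ooE => hv; have q0 := qq_gt0 hv; have /andP[v0 v1] := hv.
  have v3 : 0 < v ^+ 3 by rewrite exprn_gt0.
  have q1 : qq v < 1 by apply: cbrt_lt1; have := cube_lt1 hv => ?; apply/andP; split; lra.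
  rewrite gtr0_norm ?invr_gt0// /WW lef_pV2 ?posrE ?exprn_gt0//.
  by rewrite expr2 ler_piMr// ltW.
Qed.

Lemma Bc_gt0 : 0 < Bc.
Proof.
apply: (@lt_le_trans _ _ 1) => //; rewrite -[leLHS](@Rint_cst_uni R 1).
apply: Rint_le => //; [exact: igr_cst_oo|exact: bker_igr|].
by move=> x; rewrite ooE; exact: bker_ge1.
Qed.

(** Scaling to the unit interval: the exponents add up to -1, so the value
    depends neither on s nor on T. *)
Lemma beta_kernel s T : s < T ->
  igr `]s, T[%classic (fun t => (cbrt (t - s) ^+ 2)^-1 * (cbrt (T - t))^-1) /\
  \int[mu]_(t in `]s, T[) ((cbrt (t - s) ^+ 2)^-1 * (cbrt (T - t))^-1) = Bc.
Proof.
move=> sT; have L0 : 0 < T - s by lra.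
set L := T - s in L0; pose D := `]s, T[%classic : set R.
have DE x : D x = (s < x < T) :> Prop by rewrite /D ooE.
pose f t : R := (cbrt (t - s) ^+ 2)^-1 * (cbrt (T - t))^-1.
have ou := @open_oo R 0 1; have oD : open D by exact: open_oo.
have dphi x : uni x -> dv (fun v : R => s + L * v) x L.
  by move=> _; dvs; rewrite /=; ring.
have cphi x : uni x -> {for x, continuous (fun v : R => L)} by move=> _; exact: ct_cst.
have p0 x : uni x -> 0 < L by [].
have pD x : uni x -> D (s + L * x).
  rewrite ooE DE => /andP[x0 x1]; rewrite ltrDl mulr_gt0//=.
  have : L * x < L by rewrite gtr_pMr.
  rewrite /L; lra.
have pS y : D y -> exists2 x, uni x & s + L * x = y.
  rewrite DE => /andP[y0 y1]; exists ((y - s) / L); last by field; rewrite gt_eqF.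
  by rewrite ooE divr_gt0 ?subr_gt0//= ltr_pdivrMr// mul1r ltrD2r.
have cb y : D y -> {for y, continuous f}.
  rewrite DE => /andP[y0 y1]; have u0 : 0 < y - s by lra.
  have u1 : 0 < T - y by lra.
  have c1 := cbrt_gt0 u0; have c2 := cbrt_gt0 u1.
  apply: dv_ct; apply: dvM.
    apply: dvV; [by rewrite expf_neq0// gt_eqF|apply: dvX].
    by apply: (@dv_cbrt R (fun x => x - s)) => //; dvs; reflexivity.
  apply: dvV; first by rewrite gt_eqF.
  by apply: (@dv_cbrt R (fun x => T - x)) => //; dvs; reflexivity.
have E v : uni v -> bker v = f (s + L * v) * L.
  rewrite ooE => /andP[v0 v1]; have v2 : 0 < 1 - v by lra.
  rewrite /f (_ : s + L * v - s = L * v); last by ring.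
  rewrite (_ : T - (s + L * v) = L * (1 - v)); last by rewrite /L; ring.
  rewrite !cbrtM ?(ltW L0) ?(ltW v0) ?(ltW v2)// /bker.
  have k0 := cbrt_gt0 L0; have k3 := cbrt_cube (ltW L0).
  have a0 := cbrt_gt0 v0; have a1 := cbrt_gt0 v2.
  move: (cbrt L) k0 k3 => p p1 <-; move: (cbrt v) a0 (cbrt (1 - v)) a1 => z z0 w w0.
  by field; rewrite !gt_eqF.
have iF : igr D f.
  apply/(@subst_igr R uni D _ _ _ _ f ou oD (@exh_oo R 0 1 ltr01) dphi cphi p0 pD pS cb).
  by apply: (igr_eq muni E); exact: bker_igr.
split; first exact: iF.
rewrite /Bc (Rint_eq E).
by rewrite (@subst_int R uni D _ _ _ _ f ou oD (@exh_oo R 0 1 ltr01) dphi cphi p0 pD pS cb iF).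
Qed.

End beta_integral.

(** * Abel inversion *)

Section abel.
Variable R : realType.
Implicit Types (f g h F phi psi k q : R -> R) (x y a b r v s t c d T : R) (D : set R).
Notation mu := (@lebesgue_measure R).
Notation igr D f := (mu.-integrable D (EFin \o f)).
Notation pos := (`]0, +oo[%classic : set R).

(** The Abel kernel extended by 0, so that a triangle of integration becomes a
    square. *)
Definition kk x : R := ((fun u => (cbrt u ^+ 2)^-1) \_ pos) x.

Lemma kkE x : 0 < x -> kk x = (cbrt x ^+ 2)^-1.
Proof. by move=> x0; rewrite /kk patchE0// in_posE. Qed.

Lemma kk0 x : ~ 0 < x -> kk x = 0.
Proof. by move=> x0; rewrite /kk patchE1// in_posE. Qed.

Lemma kk_ge0 x : 0 <= kk x.
Proof.
have [x0|x0] := boolP (0 < x); last by rewrite kk0//; exact/negP.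
by rewrite kkE// invr_ge0 exprn_ge0// ltW// cbrt_gt0.
Qed.

Lemma kk_meas : measurable_fun setT kk.
Proof.
have mp := @mpos R; apply/(measurable_restrictT _ mp).
apply: meas_cont => [|x]; first exact: open_pos.
rewrite in_posE => x0; apply: dv_ct.
by apply: dvV; [rewrite expf_neq0// gt_eqF// cbrt_gt0|apply: dvX; exact: cbrt_dv].
Qed.

Section inversion.
Variables (g q : R -> R) (g0 : R) (T : R).
Hypothesis T0 : 0 < T.
Hypothesis dg : forall t, 0 < t -> derivable g t 1 /\ {for t, continuous (derive1 g)}.
Hypothesis g0E : g t @[t --> (0 : R)^'+] --> (g0 : R).
Hypothesis ig : forall t, 0 < t -> igr `]0, t[%classic (caputo_integrand (2 / 3) g t).
Hypothesis cg : forall t, 0 < t -> caputo (2 / 3) g t = q t.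

Let D : set R := `]0, T[%classic.
Let DE x : D x = (0 < x < T) :> Prop. Proof. by rewrite /D ooE. Qed.
Let mD : measurable D. Proof. exact: measurable_itv. Qed.
Let m (t : R) : R := (cbrt (T - t))^-1.
Let g1 := derive1 g.

Let dv_g t : 0 < t -> dv g t (g1 t).
Proof. by move=> /dg[d _]; rewrite /g1 derive1E; exact: DeriveDef. Qed.

Let g1_ct t : D t -> {for t, continuous g1}.
Proof. by rewrite DE => /andP[/dg[]]. Qed.

Let m_gt0 t : D t -> 0 < m t.
Proof. by rewrite DE => /andP[_ tT]; rewrite invr_gt0 cbrt_gt0// subr_gt0. Qed.

Let m_ct t : D t -> {for t, continuous m}.
Proof.
rewrite DE => /andP[_ tT]; have h : 0 < T - t by lra.
apply: dv_ct; apply: dvV; first by rewrite gt_eqF// cbrt_gt0.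
by apply: (@dv_cbrt R (fun x => T - x)) => //; dvs; reflexivity.
Qed.

Let capE t s : 0 < s < t -> caputo_integrand (2 / 3) g t s = kk (t - s) * g1 s.
Proof.
move=> /andP[s0 st]; have ts : 0 < t - s by lra.
by rewrite /caputo_integrand powR23 ?(ltW ts)// kkE// mulrC.
Qed.

Let oD : open D. Proof. exact: open_oo. Qed.

Lemma inv_g1_igr : igr D g1.
Proof.
have iT := ig T0; have mg1 : measurable_fun D g1 by apply: meas_cont.
have iTn := igr_norm mD iT.
apply: (igr_le mD mg1 (igrZ (cbrt T ^+ 2) mD iTn)) => s; rewrite DE => hs.
have /andP[s0 sT] := hs; have ts : 0 < T - s by lra.
rewrite capE// kkE// normrM ger0_norm; last by rewrite invr_ge0 exprn_ge0// ltW// cbrt_gt0.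
have c1 := cbrt_gt0 ts; have c2 := cbrt_gt0 T0.
rewrite mulrA ler_peMl// ler_pdivlMr ?exprn_gt0// mul1r.
apply: lerXn2r; rewrite ?nnegrE ?(ltW c1) ?(ltW c2)//.
rewrite -(ler_pXn2r (_ : 0 < 3)%N) ?nnegrE ?(ltW c1) ?(ltW c2)// !cbrt_cube ?(ltW ts) ?(ltW T0)//.
lra.
Qed.

Let f s t : R := g1 s * (kk (t - s) * m t).

Let patch_meas h : measurable_fun D h -> measurable_fun setT (h \_ D).
Proof. by move=> mh; apply/(measurable_restrictT _ mD). Qed.

Lemma inv_meas : measurable_fun setT (patch2 D D f).
Proof.
have -> : patch2 D D f = fun z => (g1 \_ D) z.1 * (kk (z.2 - z.1) * (m \_ D) z.2).
  apply/funext => -[s t] /=.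
  have [hs|hs] := pselect (D s); last by rewrite patch2E1// [X in X * _]patchE1// mul0r.
  have [ht|ht] := pselect (D t); last by rewrite patch2E2// [X in _ * (_ * X)]patchE1// !mulr0.
  by rewrite patch2E0// !patchE0.
apply: measurable_funM.
  apply: (@measurableT_comp _ _ _ _ _ _ (g1 \_ D)); last exact: measurable_fst.
  by apply: patch_meas; apply: meas_cont.
apply: measurable_funM.
  apply: (@measurableT_comp _ _ _ _ _ _ kk); first exact: kk_meas.
  by apply: measurable_funB; [exact: measurable_snd|exact: measurable_fst].
apply: (@measurableT_comp _ _ _ _ _ _ (m \_ D)); last exact: measurable_snd.
by apply: patch_meas; apply: meas_cont.
Qed.

Lemma inv_inner s : D s -> igr D (fun t => kk (t - s) * m t) /\
  \int[mu]_(t in D) (kk (t - s) * m t) = Bc R.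
Proof.
rewrite DE => /andP[s0 sT]; have [i1 v1] := beta_kernel sT.
pose E : set R := `]s, T[%classic.
have EE x : E x = (s < x < T) :> Prop by rewrite /E ooE.
have mE : measurable E by exact: measurable_itv.
have ED : E `<=` D by move=> x; rewrite EE DE => /andP[h1 h2]; rewrite h2 andbT; lra.
pose k t : R := (cbrt (t - s) ^+ 2)^-1 * (cbrt (T - t))^-1.
have P t : D t -> (k \_ E) t = kk (t - s) * m t.
  rewrite DE => /andP[t0 tT]; have [st|st] := ltP s t.
    have Et : E t by rewrite EE st tT.
    have ts : 0 < t - s by rewrite subr_gt0.
    by rewrite (patchE0 _ Et) (kkE ts).
  have Et : ~ E t by rewrite EE => /andP[]; rewrite ltNge st.
  have nts : ~ 0 < t - s by rewrite subr_gt0 ltNge st.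
  by rewrite (patchE1 _ Et) (kk0 nts) mul0r.
split; last by rewrite -(Rint_eq P) Rint_patch.
apply: (igr_eq mD P); rewrite (_ : EFin \o _ = (EFin \o k) \_ E); last first.
  by apply/funext => x /=; rewrite !patchE; case: ifP.
apply/(@integrable_restrict _ _ R mu E mE D mD); rewrite setIidr//.
Qed.

(** Integrating the Caputo derivative against (T - t)^(-1/3) and exchanging
    the integrals over the triangle s < t < T leaves the beta integral times
    the integral of the derivative of g. *)
Lemma abel_inversion : igr D (fun t => m t * q t) /\
  Gamma (1 - 2 / 3 : R) * \int[mu]_(t in D) (m t * q t) = Bc R * (g T - g0).
Proof.
have i1 := inv_g1_igr.
have [Ga [Gp -> cgE]] : exists Ga, [/\ 0 < Ga, Gamma (1 - 2 / 3 : R) = Ga & forall t, 0 < t ->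
    \int[mu]_(s in `]0, t[) caputo_integrand (2 / 3) g t s = Ga * q t].
  have Gp : 0 < Gamma (1 - 2 / 3 : R).
    by rewrite Gamma13 mulr_gt0 ?I3_gt0// exprn_gt0// cbrt_gt0.
  exists (Gamma (1 - 2 / 3 : R)); split => // t t0.
  by rewrite -cg// /caputo mulrA divff ?mul1r// gt_eqF.
have Gnz : Ga != 0 by exact: lt0r_neq0.
have f1 s : D s -> igr D (f s) by move=> Ds; apply: igrZ => //; exact: (proj1 (inv_inner Ds)).
have f2 t : D t -> igr D (f ^~ t) /\ \int[mu]_(s in D) f s t = m t * (Ga * q t).
  move=> Dt; have := Dt; rewrite DE => /andP[t0 tT].
  pose E : set R := `]0, t[%classic.
  have EE x : E x = (0 < x < t) :> Prop by rewrite /E ooE.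
  have mE : measurable E by exact: measurable_itv.
  have ED : E `<=` D by move=> x; rewrite EE DE => /andP[h1 h2]; apply/andP; split; lra.
  pose k := caputo_integrand (2 / 3) g t.
  have P s : D s -> (fun s => m t * (k \_ E) s) s = f s t.
    rewrite DE => /andP[s0 sT] /=; have [st|st] := ltP s t.
      have st' : 0 < s < t by rewrite s0 st.
      by rewrite patchE0 ?EE// /k (capE st') /f; ring.
    have Es : ~ E s by rewrite EE => /andP[_]; rewrite ltNge st.
    have nts : ~ 0 < t - s by rewrite subr_gt0 ltNge st.
    by rewrite (patchE1 _ Es) /f (kk0 nts) mul0r !mulr0.
  have ik : igr D (k \_ E).
    rewrite (_ : EFin \o _ = (EFin \o k) \_ E); last first.
      by apply/funext => x /=; rewrite !patchE; case: ifP.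
    by apply/(@integrable_restrict _ _ R mu E mE D mD); rewrite setIidr//; exact: ig.
  split; first by apply: (igr_eq mD P); exact: igrZ.
  rewrite -(Rint_eq P) (RintZ _ mD ik) Rint_patch//; congr (_ * _).
  exact: cgE.
have [|||||h1 h2 h3] := @fubini_R R D D f (fun s => Bc R * `|g1 s|) mD mD.
- exact: inv_meas.
- exact: f1.
- by move=> t Dt; exact: (proj1 (f2 t Dt)).
- by apply: igrZ => //; exact: igr_norm.
- move=> s Ds; have [j1 j2] := inv_inner Ds.
  rewrite (@Rint_eq R D _ (fun t => `|g1 s| * (kk (t - s) * m t))); last first.
    move=> t Dt; rewrite /f normrM [X in _ * X]ger0_norm; first by [].
    by apply: mulr_ge0; [exact: kk_ge0|exact: ltW (m_gt0 Dt)].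
  by rewrite (RintZ _ mD j1) j2 mulrC.
have P2 t : D t -> \int[mu]_(s in D) f s t = Ga * (m t * q t).
  by move=> Dt; rewrite (proj2 (f2 t Dt)) mulrCA.
have iq : igr D (fun t => m t * q t).
  apply: (@igr_eq R D (fun t => Ga^-1 * \int[mu]_(s in D) f s t) _ mD).
    by move=> t Dt; rewrite (P2 t Dt) mulrA (mulVf Gnz) mul1r.
  exact: (igrZ Ga^-1 mD h2).
split; first exact: iq.
rewrite -(RintZ _ mD iq) -(Rint_eq P2) -h3.
rewrite (@Rint_eq R D _ (fun s => Bc R * g1 s)); last first.
  by move=> s Ds; have [j1 j2] := inv_inner Ds; rewrite /f (RintZ _ mD j1) j2 mulrC.
rewrite (RintZ _ mD i1); congr (_ * _).
apply: (@ftc_oo R g1 g 0 T g0 (g T) T0).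
- by move=> t /andP[t0 _]; exact: dv_g.
- by move=> t ht; apply: g1_ct; rewrite DE.
- exact: g0E.
- apply: cvg_at_left_filter; exact: dv_ct (dv_g T0).
- exact: i1.
Qed.

End inversion.
End abel.


(** * Taylor remainders and seminorms *)

Section second_order.
Variable R : realType.
Implicit Types (f g h F phi psi k q : R -> R) (x y z a b r v s t c d e : R) (T : (R -> R) -> R).

Lemma taylor2 F g k u v B z w : u <= z <= v -> u <= w <= v ->
  (forall x, u <= x <= v -> dv F x (g x)) -> (forall x, u <= x <= v -> dv g x (k x)) ->
  (forall x, u <= x <= v -> `|k x| <= B) ->
  `|F w - F z - (w - z) * g z| <= B * (w - z) ^+ 2.
Proof.
move=> /andP[uz zv] /andP[uw wv] dF dg kB.
have B0 : 0 <= B by apply: le_trans (kB z _) => //; rewrite uz.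
have g_lip x y : u <= x <= v -> u <= y <= v -> `|g y - g x| <= B * `|y - x|.
  wlog xy : x y / x <= y => [H hx hy|/andP[ux xv] /andP[uy yv]].
    by have [xy|yx] := leP x y; [exact: H|rewrite distrC [`|y - x|]distrC; apply: H => //; exact: ltW].
  rewrite (ger0_norm (_ : 0 <= y - x)) ?subr_ge0//.
  apply: (@mvt_le R g k) => // t /andP[xt ty]; [apply: dg|apply: kB];
    by rewrite (le_trans ux xt) (le_trans ty yv).
pose H x := F x - (x - z) * g z.
have dH x : u <= x <= v -> dv H x (g x - g z).
  by move=> hx; apply: dv_eq; [apply: dvB; [exact: dF|dvs; reflexivity]|rewrite /=; ring].
have -> : F w - F z - (w - z) * g z = H w - H z by rewrite /H; ring.
have hz : u <= z <= v by rewrite uz.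
have lip p p' : u <= p <= v -> u <= p' <= v -> p <= p' ->
    (forall x, p <= x <= p' -> `|x - z| <= `|w - z|) ->
    `|H p' - H p| <= B * `|w - z| * (p' - p).
  move=> /andP[up pv] /andP[up' p'v] pp near_z.
  have bd x : p <= x <= p' -> u <= x <= v.
    by move=> /andP[x1 x2]; rewrite (le_trans up x1) (le_trans x2 p'v).
  apply: (@mvt_le R H (fun x => g x - g z)) => // x hx; first by apply: dH; exact: bd.
  by apply: le_trans (g_lip z x hz (bd _ hx)) _; rewrite ler_wpM2l// near_z.
have [zw|wz] := leP z w.
  apply: le_trans (lip z w _ _ zw _) _; rewrite ?uz ?uw//.
    by move=> x /andP[x1 x2]; rewrite !ger0_norm ?subr_ge0//; lra.
  by rewrite ger0_norm ?subr_ge0// -mulrA -expr2.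
rewrite distrC; apply: le_trans (lip w z _ _ (ltW wz) _) _; rewrite ?uz ?uw//.
  move=> x /andP[x1 x2]; rewrite ![`|_ - z|]distrC !ger0_norm ?subr_ge0//; last exact: ltW.
  lra.
rewrite distrC ger0_norm ?subr_ge0; last exact: ltW.
by rewrite -mulrA -expr2 -[z - w]opprB sqrrN.
Qed.

(** A quadratic remainder gives the derivative; in this form Taylor estimates
    pass through continuous linear functionals and limits. *)
Lemma dv_quad f z d B e : 0 < e ->
  (forall w, `|w - z| < e -> `|f w - f z - (w - z) * d| <= B * (w - z) ^+ 2) -> dv f z d.
Proof.
move=> e0 H; rewrite /dv.
suff Hc : h^-1 *: ((f \o shift z) (h *: 1) - f z) @[h --> (0 : R)^'] --> d.
  apply: DeriveDef; first by apply/cvg_ex; exists d.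
  by apply/cvg_lim.
apply/cvgrPdist_le => eps eps0.
have B0 : 0 < `|B| + 1 by rewrite ltr_wpDl.
near=> h.
have hn : h != 0 by near: h; exact: nbhs_dnbhs_neq.
have h1 : `|h| < e.
  near: h; apply: (@dnbhs0_lt _ R); exact: e0.
have h2 : `|h| < eps / (`|B| + 1).
  near: h; apply: (@dnbhs0_lt _ R); exact: divr_gt0.
rewrite /= -[h *: 1]/(h * 1) mulr1 -[_ *: _]/(h^-1 * (f (h + z) - f z)).
have := H (h + z); rewrite addrK => /(_ h1) h3.
have -> : d - h^-1 * (f (h + z) - f z) = - (h^-1 * (f (h + z) - f z - h * d)).
  by field.
have hn0 : 0 < `|h| by rewrite normr_gt0.
rewrite normrN normrM normfV mulrC ler_pdivrMr//.
apply: (le_trans h3); rewrite -(real_normK (num_real h)) expr2 mulrA ler_wpM2r//.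
move: h2; rewrite ltr_pdivlMr// => h2; apply: le_trans (ltW h2).
by rewrite mulrC ler_wpM2l//; have := ler_norm B; lra.
Unshelve. all: by end_near. Qed.

Lemma schwartz_lin a phi psi : schwartz phi -> schwartz psi ->
  schwartz (fun x => a * phi x + psi x) /\ forall n,
  derive1n n (fun x => a * phi x + psi x) = fun x => a * derive1n n phi x + derive1n n psi x.
Proof.
move=> sp sq; pose fs n x := a * derive1n n phi x + derive1n n psi x.
have dfs n x : dv (fs n) x (fs n.+1 x).
  apply: dv_eq.
    by apply: dvD; [apply: dvM; [exact: dv_cst|exact: schwartz_dv]|exact: schwartz_dv].
  by rewrite /fs /=; ring.
split; last by move=> n; exact: (derive1n_seq dfs).
apply: (schwartz_seq dfs) => m n.
have [_ b] := sp; have [_ b'] := sq; have [C HC] := b m n; have [C' HC'] := b' m n.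
exists (`|a| * C + C') => x; rewrite /fs mulrDr; apply: le_trans (ler_normD _ _) _.
apply: lerD => //; rewrite mulrCA normrM ler_wpM2l//.
Qed.

Lemma schwartzB phi psi : schwartz phi -> schwartz psi ->
  schwartz (fun x => phi x - psi x) /\ forall n,
  derive1n n (fun x => phi x - psi x) = fun x => derive1n n phi x - derive1n n psi x.
Proof.
move=> sp sq; have [h1 h2] := schwartz_lin (- 1) sq sp.
rewrite (_ : (fun x => phi x - psi x) = fun x => -1 * psi x + phi x); last first.
  by apply/funext => x; ring.
by split=> // n; rewrite h2; apply/funext => x; ring.
Qed.

Lemma schwartzZ a phi : schwartz phi ->
  schwartz (fun x => a * phi x) /\ forall n,
  derive1n n (fun x => a * phi x) = fun x => a * derive1n n phi x.
Proof.
move=> sp; have [h1 h2] := schwartz_lin (a - 1) sp sp.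
rewrite (_ : (fun x => a * phi x) = fun x => (a - 1) * phi x + phi x); last first.
  by apply/funext => x; ring.
by split=> // n; rewrite h2; apply/funext => x; ring.
Qed.

(** One number bounding the first seminorms at once. Unlike a supremum it can
    be used without knowing that the seminorms are finite. *)
Definition sbound (N : nat) e phi := forall m n x, (m <= N)%N -> (n <= N)%N ->
  `|x ^+ m * derive1n n phi x| <= e.

Lemma sbound_ge0 N e phi : sbound N e phi -> 0 <= e.
Proof. by move=> /(_ 0 0 0 (leq0n _) (leq0n _)); apply: le_trans. Qed.

Lemma sbound_le N N' e e' phi : (N' <= N)%N -> e <= e' -> sbound N e phi -> sbound N' e' phi.
Proof.
move=> NN ee b m n x mN nN; apply: le_trans ee.
by apply: b; [exact: leq_trans mN NN|exact: leq_trans nN NN].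
Qed.

Lemma sbound_ex N phi : schwartz phi -> exists e, sbound N e phi.
Proof.
move=> sp; exists (\sum_(m < N.+1) \sum_(n < N.+1) schwartz_seminorm m n phi) => m n x mN nN.
exact: le_trans (seminorm_ge m n x sp) (seminorm_sum_ge sp mN nN).
Qed.

Lemma sboundZ N a e phi : schwartz phi -> sbound N e phi -> sbound N (`|a| * e) (fun x => a * phi x).
Proof.
move=> sp b m n x mN nN; have [_ ->] := schwartzZ a sp.
by rewrite mulrCA normrM ler_wpM2l// b.
Qed.

Section functional.
Variable T : (R -> R) -> R.
Hypothesis tT : tempered T.

Lemma tempered_lin a phi psi : schwartz phi -> schwartz psi ->
  T (fun x => a * phi x + psi x) = a * T phi + T psi.
Proof. by have [h _] := tT; exact: h. Qed.

Lemma temperedB phi psi : schwartz phi -> schwartz psi ->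
  T (fun x => phi x - psi x) = T phi - T psi.
Proof.
move=> sp sq; rewrite (_ : (fun x => phi x - psi x) = fun x => -1 * psi x + phi x); last first.
  by apply/funext => x; ring.
by rewrite tempered_lin//; ring.
Qed.

Lemma temperedZ a phi : schwartz phi -> T (fun x => a * phi x) = a * T phi.
Proof.
move=> sp; rewrite (_ : (fun x => a * phi x) = fun x => (a - 1) * phi x + phi x); last first.
  by apply/funext => x; ring.
by rewrite tempered_lin//; ring.
Qed.

Lemma tempered_sbound : exists2 C, 0 <= C & exists N, forall e phi,
  schwartz phi -> sbound N e phi -> `|T phi| <= C * e.
Proof.
have [_ [C [N H]]] := tT; exists (`|C| * N.+1%:R * N.+1%:R); first by rewrite !mulr_ge0.
exists N => e phi sp b; apply: le_trans (H phi sp) _.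
have S0 : \sum_(m < N.+1) \sum_(n < N.+1) schwartz_seminorm m n phi <= N.+1%:R * (N.+1%:R * e).
  have K (k : R) : \sum_(n < N.+1) k = N.+1%:R * k by rewrite sumr_const card_ord mulr_natl.
  rewrite -K; apply: ler_sum => m _; rewrite -K; apply: ler_sum => n _.
  apply: ge_sup; first by exists (`|0 ^+ m * derive1n n phi 0|); exists 0.
  by move=> _ [z _ <-]; apply: b; rewrite -ltnS.
apply: (@le_trans _ _ (`|C| * \sum_(m < N.+1) \sum_(n < N.+1) schwartz_seminorm m n phi)).
  rewrite ler_wpM2r ?ler_norm// sumr_ge0// => m _; apply: sumr_ge0 => n _.
  exact: seminorm_ge0.
by rewrite -!mulrA ler_wpM2l.
Qed.

End functional.

End second_order.


(** * Uniform boundedness on the Schwartz space *)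

Section banach_steinhaus.
Variable R : realType.
Implicit Types (f g h F phi psi q : R -> R) (x y z a b r v s t c d e : R) (T : (R -> R) -> R).

Lemma cvg_norm_le (u : nat -> R) l c k : u j @[j --> \oo] --> l ->
  (forall j, (k <= j)%N -> `|u j| <= c) -> `|l| <= c.
Proof.
move=> ul H; apply: (ler_cvg_to (cvg_norm ul) (cvg_cst c)).
by exists k => // j /= kj; exact: H.
Qed.

Section completeness.
Variables (xs : nat -> R -> R) (Ns : nat -> nat) (es : nat -> R).
Hypothesis sx : forall k, schwartz (xs k).
Hypothesis Nk : forall k, (k <= Ns k)%N.
Hypothesis e0 : forall k, 0 < es k.
Hypothesis eS : forall k, es k.+1 <= es k / 2.
Hypothesis bx : forall k, sbound (Ns k) (es k) (fun x => xs k.+1 x - xs k x).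
Hypothesis NS : forall k, (Ns k <= Ns k.+1)%N.

Let d n k z : R := derive1n n (xs k) z.

Lemma es_cvg : es k @[k --> \oo] --> (0 : R).
Proof.
apply: (@le_cvg0 R _ _ _ es (fun k => es 0 * 2^-1 ^+ k)).
  apply: nearW => k; rewrite ger0_norm ?(ltW (e0 k))//.
  elim: k => [|k IH]; first by rewrite expr0 mulr1.
  by rewrite exprSr mulrA; apply: le_trans (eS k) _; rewrite ler_pM2r.
rewrite -[X in _ --> X](mulr0 (es 0)); apply: cvgMr; apply: cvg_expr.
by rewrite ger0_norm ?invr_ge0// invf_lt1// ltr1n.
Qed.

Lemma Ns_mono k j : (Ns k <= Ns (k + j))%N.
Proof. by elim: j => [|j IH]; rewrite ?addn0// addnS (leq_trans IH). Qed.

Lemma partial_le k j m n z : (m <= Ns k)%N -> (n <= Ns k)%N ->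
  `|z ^+ m * (d n (k + j) z - d n k z)| <= 2 * es k.
Proof.
move=> mN nN; suff H : `|z ^+ m * (d n (k + j) z - d n k z)| <= 2 * (es k - es (k + j)%N).
  by apply: le_trans H _; rewrite ler_wpM2l// gerBl ltW.
elim: j => [|j IH]; first by rewrite addn0 !subrr !mulr0 normr0.
have := bx z (leq_trans mN (Ns_mono k j)) (leq_trans nN (Ns_mono k j)).
rewrite (proj2 (schwartzB (sx _) (sx _))) -!/(d _ _ _) -addnS => h.
have := eS (k + j); rewrite -addnS => h2.
rewrite (_ : _ * _ = z ^+ m * (d n (k + j.+1) z - d n (k + j) z) + z ^+ m * (d n (k + j) z - d n k z)); last by ring.
by apply: le_trans (ler_normD _ _) _; lra.
Qed.

Lemma d_cvg n z : cvg (d n k z @[k --> \oo]).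
Proof.
apply/cauchy_cvgP/cauchy_exP => eps eps0.
have h2 : 0 < eps / 2 by rewrite divr_gt0.
have /cvgrPdist_lt/(_ _ h2) [K _ HK] := es_cvg.
pose k := maxn K n; exists (d n k z).
exists k => // j /= kj; rewrite -(subnKC kj).
have := @partial_le k (j - k) 0 n z (leq0n _) (leq_trans (leq_maxr K n) (Nk k)).
rewrite expr0 mul1r => h; rewrite /ball/= distrC; apply: le_lt_trans h _.
have := HK k (leq_maxl K n); rewrite /= sub0r normrN gtr0_norm//; lra.
Qed.

Let l n z : R := lim (d n k z @[k --> \oo]).

Lemma l_le k m n z : (m <= Ns k)%N -> (n <= Ns k)%N -> `|z ^+ m * (l n z - d n k z)| <= 2 * es k.
Proof.
move=> mN nN; apply: (@cvg_norm_le (fun j => z ^+ m * (d n j z - d n k z)) _ _ k).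
  by apply: cvgMr; apply: cvgB; [exact: d_cvg|exact: cvg_cst].
by move=> j kj; rewrite -(subnKC kj); exact: partial_le.
Qed.

Lemma l_dv n z : dv (l n) z (l n.+1 z).
Proof.
pose K := n.+2; have [M HM] := sbound_ex n.+2 (sx K).
have dB k w : (K <= k)%N -> `|d n.+2 k w| <= M + 2 * es K.
  move=> Kk; have h1 := HM 0 n.+2 w (leq0n _) (leqnn _).
  have h2 := @partial_le K (k - K) 0 n.+2 w (leq0n _) (Nk K).
  move: h1 h2; rewrite expr0 !mul1r subnKC// -/(d n.+2 K w) => h1 h2.
  by rewrite -[d _ _ _](subrK (d n.+2 K w)) (le_trans (ler_normD _ _))// addrC lerD.
apply: (@dv_quad R _ _ _ (M + 2 * es K) 1) => // w _.
apply: (@cvg_norm_le (fun k => d n k w - d n k z - (w - z) * d n.+1 k z) _ _ K).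
  by apply: cvgB; [apply: cvgB; exact: d_cvg|apply: cvgMr; exact: d_cvg].
move=> k Kk; have mw := ler_norm w; have mz := ler_norm z.
have mw' := ler_norm (- w); have mz' := ler_norm (- z); rewrite !normrN in mw' mz'.
have nw := normr_ge0 w; have nz := normr_ge0 z.
apply: (@taylor2 R (d n k) (d n.+1 k) (d n.+2 k) (- (`|z| + `|w|)) (`|z| + `|w|)).
- by apply/andP; split; lra.
- by apply/andP; split; lra.
- by move=> x _; exact: (schwartz_dv n x (sx k)).
- by move=> x _; exact: (schwartz_dv n.+1 x (sx k)).
- by move=> x _; exact: dB.
Qed.

(** The sequences of derivatives converge uniformly with weights. The limits
    are derivatives of each other because second-order Taylor remainders are
    bounded uniformly along the sequence. *)
Lemma schwartz_complete : exists2 x, schwartz x &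
  forall k, sbound (Ns k) (2 * es k) (fun z => x z - xs k z).
Proof.
have sl : schwartz (l 0).
  apply: (schwartz_seq l_dv) => m n; pose k := maxn m n.
  have mN : (m <= Ns k)%N := leq_trans (leq_maxl m n) (Nk k).
  have nN : (n <= Ns k)%N := leq_trans (leq_maxr m n) (Nk k).
  have [_ b] := sx k; have [C HC] := b m n; exists (C + 2 * es k) => z.
  rewrite -[l n z](subrK (d n k z)) mulrDr addrC; apply: le_trans (ler_normD _ _) _.
  by apply: lerD; [exact: HC|exact: l_le].
exists (l 0) => // k m n z mN nN; rewrite (proj2 (schwartzB sl (sx k))).
by rewrite (derive1n_seq l_dv); exact: l_le.
Qed.

End completeness.

Section uniform_boundedness.
Variables (J : R -> Prop) (Ts : R -> (R -> R) -> R).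
Hypothesis tT : forall t, J t -> tempered (Ts t).
Hypothesis pb : forall phi, schwartz phi -> exists M, forall t, J t -> `|Ts t phi| <= M.

Definition ubound := exists2 C, 0 <= C & exists N, forall t e phi,
  J t -> schwartz phi -> sbound N e phi -> `|Ts t phi| <= C * e.

(** By homogeneity, failure of the bound produces arbitrarily small functions
    with large values. *)
Lemma not_ubound_large N eps A : ~ ubound -> 0 < eps -> exists t phi,
  [/\ J t, schwartz phi, sbound N eps phi & A < `|Ts t phi|].
Proof.
move=> nu e0; apply: contrapT => H; apply: nu.
exists ((`|A| + 1) / eps); first by rewrite divr_ge0 ?addr_ge0 ?(ltW e0).
exists N => t e phi Jt sp b; rewrite leNgt; apply/negP => lt.
have A0 : 0 < `|A| + 1 by rewrite ltr_wpDl.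
have ee := sbound_ge0 b; have t0 : 0 < `|Ts t phi|.
  by apply: le_lt_trans lt; rewrite mulr_ge0 ?divr_ge0 ?(ltW e0) ?(ltW A0).
pose a := (`|A| + 1) / `|Ts t phi|; have a0 : 0 < a by rewrite divr_gt0.
apply: H; exists t, (fun x => a * phi x); split => //.
- exact: (proj1 (schwartzZ a sp)).
- apply: sbound_le (sboundZ a sp b) => //; rewrite gtr0_norm// /a mulrAC ler_pdivrMr//.
  by move: lt; rewrite mulrAC ltr_pdivrMr// [eps * _]mulrC => /ltW.
- rewrite (temperedZ (tT Jt))// normrM gtr0_norm// /a divfK ?gt_eqF//.
  by have := ler_norm A; lra.
Qed.

Let state := ((R -> R) * nat * R)%type.
Let ok (s : state) := schwartz s.1.1 /\ 0 < s.2 <= 1.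
Let step (k : nat) (s s' : state) :=
  [/\ (s.1.2 < s'.1.2)%N, s'.2 <= s.2 / 2, sbound s.1.2 s.2 (fun x => s'.1.1 x - s.1.1 x) &
   exists t, [/\ J t, k%:R < `|Ts t s'.1.1| & forall phi, schwartz phi ->
     sbound s'.1.2 (2 * s'.2) phi -> `|Ts t phi| <= 1]].

(** One step of the gliding hump: add a small function on which some T_t is
    large, with the sign that keeps the value large, then shrink the allowed
    later perturbations so that this T_t moves by at most 1. *)
Lemma hump k (s : state) : ~ ubound -> ok s -> exists s' : state, ok s' /\ step k s s'.
Proof.
case: s => [[x N] e] nu [/= sx /andP[e0 e1]].
have [t [phi [Jt sp b kt]]] := not_ubound_large N k%:R nu e0.
have [C C0 [N' HC]] := tempered_sbound (tT Jt).
have C1 : 0 < 1 + C by lra.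
have [a a1 Ha] : exists2 a, `|a| = 1 & k%:R < `|Ts t (fun z => a * phi z + x z)|.
  have h1 := tempered_lin (tT Jt) 1 sp sx; have h2 := tempered_lin (tT Jt) (-1) sp sx.
  have [h|h] := ltP k%:R `|Ts t (fun z => 1 * phi z + x z)|; first by exists 1; rewrite ?normr1.
  exists (-1); first by rewrite normrN normr1.
  rewrite h2; rewrite h1 in h; have := ler_normB (1 * Ts t phi + Ts t x) (-1 * Ts t phi + Ts t x).
  have -> : 1 * Ts t phi + Ts t x - (-1 * Ts t phi + Ts t x) = 2 * Ts t phi by ring.
  rewrite normrM ger0_norm//; lra.
(* later perturbations add up to at most twice the new radius e / (2 (1 + C)),
   on which T_t is bounded by C e / (1 + C) <= 1 *)
exists ((fun z => a * phi z + x z), (maxn N N').+1, e / (2 * (1 + C))); split.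
  split=> /=; first exact: (proj1 (schwartz_lin a sp sx)).
  rewrite divr_gt0 ?mulr_gt0//= ler_pdivrMr ?mulr_gt0// mul1r; lra.
split=> /=.
- by rewrite ltnS leq_maxl.
- by rewrite ler_pM2l// lef_pV2 ?posrE ?mulr_gt0//; lra.
- rewrite (_ : (fun z => _) = fun z => a * phi z); last by apply/funext => z; ring.
  by have := sboundZ a sp b; rewrite a1 mul1r.
- exists t; split=> // psi sq bq; apply: (le_trans (HC _ _ sq (sbound_le _ (lexx _) bq))).
    by rewrite leqW// leq_maxr.
  have -> : C * (2 * (e / (2 * (1 + C)))) = (C * e) / (1 + C) by field; rewrite gt_eqF.
  rewrite ler_pdivrMr// mul1r; nra.
Qed.

(** The sum of all humps is a Schwartz function on which the family is
    unbounded. *)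
Lemma uniform_bound : ubound.
Proof.
apply: contrapT => nu.
have /choice [f Hf] : forall ks : nat * state, exists s' : state,
    ok ks.2 -> ok s' /\ step ks.1 ks.2 s'.
  move=> [k s].
  have [os|nos] := pselect (ok s); first by have [s' hs'] := hump k nu os; exists s'.
  by exists s => /nos.
pose fix S (k : nat) : state := if k is k'.+1 then f (k', S k') else ((fun=> 0), 0%N, 1).
have ok0 : ok (S 0).
  split=> /=; last by rewrite ltr01 lexx.
  by apply: (@schwartz_seq R (fun _ _ => 0)) => [n x|m n]; [exact: dv_cst|exists 0 => x; rewrite mulr0 normr0].
have okS k : ok (S k) by elim: k => // k IH; exact: (proj1 (Hf (k, S k) IH)).
have stS k : step k (S k) (S k.+1) by exact: (proj2 (Hf (k, S k) (okS k))).
have [x sx Hx] := @schwartz_complete (fun k => (S k).1.1) (fun k => (S k).1.2) (fun k => (S k).2)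
  (fun k => proj1 (okS k))
  (fun k => ltac:(elim: k => // k IH; have [h _ _ _] := stS k; exact: leq_ltn_trans IH h))
  (fun k => ltac:(by have [_ /andP[]] := okS k))
  (fun k => ltac:(by have [_ h _ _] := stS k))
  (fun k => ltac:(by have [_ _ h _] := stS k))
  (fun k => ltac:(by have [h _ _ _] := stS k; exact: ltnW)).
have [M HM] := pb sx.
pose k := (Num.bound (M + 1)).
have [_ _ _ [t [Jt kt Ht]]] := stS k.
have sk := proj1 (okS k.+1).
have := Ht _ (proj1 (schwartzB sx sk)) (Hx k.+1).
rewrite (temperedB (tT Jt) sx sk) => h1; have h2 := HM t Jt.
have := ler_normB (Ts t x) (Ts t x - Ts t (S k.+1).1.1).
rewrite opprB addrC subrK => h3.
have M0 : 0 <= M + 1 by have := le_trans (normr_ge0 _) h2; lra.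
have := archi_boundP M0; rewrite -/k; lra.
Qed.

End uniform_boundedness.
End banach_steinhaus.


(** * Distributions along the evolution *)

Section distributions_along.
Variable R : realType.
Implicit Types (f g h F phi psi q : R -> R) (x y z a b r v s t c d e : R) (T : (R -> R) -> R).

(** The weights in y cost powers of 1 + s only, so the constant is uniform in
    s. *)
Lemma GG_sbound N d phi : schwartz phi -> exists2 C, 0 <= C &
  forall s, 0 < s -> sbound N (C * (1 + s) ^+ N) (GG d phi s).
Proof.
move=> sp.
have H m n : exists C, 0 <= C /\ forall s y, 0 < s ->
    `|y ^+ m * GG d (derive1n n phi) s y| <= C * (1 + s) ^+ m.
  by have [C C0 HC] := GG_wbound m d (schwartz_derive1n n sp); exists C.
have /choice [f Hf] : forall mn : nat * nat, exists C, 0 <= C /\ forall s y, 0 < s ->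
    `|y ^+ mn.1 * GG d (derive1n mn.2 phi) s y| <= C * (1 + s) ^+ mn.1.
  by move=> [m n]; exact: H.
exists (\sum_(m < N.+1) \sum_(n < N.+1) f (m : nat, n : nat)).
  by apply: sumr_ge0 => m _; apply: sumr_ge0 => n _; have [] := Hf (m : nat, n : nat).
move=> s s0 m n y mN nN; rewrite GG_derive1n//.
have [f0 fb] := Hf (m, n); apply: le_trans (fb s y s0) _ => /=.
apply: ler_pM => //; first by rewrite exprn_ge0//; lra.
  rewrite (bigD1 (inord m : 'I_N.+1))//= (bigD1 (inord n : 'I_N.+1))//=.
  rewrite !inordK// -addrA lerDl addr_ge0//; apply: sumr_ge0 => i _.
    by have [] := Hf (m, i : nat).
  by apply: sumr_ge0 => j _; have [] := Hf (i : nat, j : nat).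
by apply: ler_weXn2l => //; lra.
Qed.

Section functional.
Variables (T : (R -> R) -> R) (C : R) (N : nat).
Hypothesis tT : tempered T.
Hypothesis HC : forall e phi, schwartz phi -> sbound N e phi -> `|T phi| <= C * e.

(** The Taylor remainder of the evolution in s is quadratic in every seminorm,
    by the equation GG_dvs applied twice; continuity of T transports it. *)
Lemma T_GG_dv d phi s : schwartz phi -> 0 < s ->
  dv (fun s => T (GG d phi s)) s (- 2^-1 * T (GG (d - pi / 2) (derive1n 2 phi) s)).
Proof.
move=> sp s0; have s2 := schwartz_derive1n 2 sp; have s4 := schwartz_derive1n 2 s2.
have h0 : 0 < s / 2 by rewrite divr_gt0.
pose d1 := d - pi / 2; pose d2 := d1 - pi / 2.
have [K K0 HK] := GG_sbound N d2 s4.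
pose B := 4^-1 * (K * (1 + 2 * s) ^+ N).
apply: (@dv_quad R _ _ _ (C * B) (s / 2) h0) => w ws.
have [w1 w2] : s / 2 < w /\ w < 2 * s.
  by move: ws; rewrite ltr_norml => /andP[]; lra.
have w0 : 0 < w by lra.
have sw := GG_schwartz d sp w0; have ss := GG_schwartz d sp s0.
have s1 := GG_schwartz d1 s2 s0.
have [s1' E1] := schwartzZ (- 2^-1 * (w - s)) s1.
have [sB EB] := schwartzB sw ss; have [sr Er] := schwartzB sB s1'.
have TE : T (fun y => GG d phi w y - GG d phi s y - - 2^-1 * (w - s) * GG d1 (derive1n 2 phi) s y) =
    T (GG d phi w) - T (GG d phi s) - (w - s) * (- 2^-1 * T (GG d1 (derive1n 2 phi) s)).
  by rewrite (temperedB tT sB s1') (temperedB tT sw ss) (temperedZ tT _ s1); ring.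
rewrite -/d1 -TE -mulrA; apply: HC => // m n y mN nN.
rewrite Er EB E1 !GG_derive1n//.
pose A (j : nat) d u := GG d (derive1n n (derive1n j phi)) u y.
have dA (j : nat) d' u : 0 < u -> dv (fun u => y ^+ m * GG d' (derive1n n (derive1n j phi)) u y) u
    (- 2^-1 * (y ^+ m * GG (d' - pi / 2) (derive1n n (derive1n j.+2 phi)) u y)).
  move=> u0; apply: dv_eq.
    by apply: dvM; [exact: dv_cst|exact: (GG_dvs d' n y (schwartz_derive1n j sp) u0)].
  have -> : derive1n n (derive1n j.+2 phi) = derive1n n.+2 (derive1n j phi).
    by rewrite /derive1n -!iterD; congr (iter _ _ _); rewrite !addnS !addSn.
  by rewrite mul0r add0r; move: (GG _ _ _ _) => g; ring.
have Q u : s / 2 <= u <= 2 * s -> `|4^-1 * (y ^+ m * GG d2 (derive1n n (derive1n 4 phi)) u y)| <= B.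
  move=> /andP[u1 u2]; have u0 : 0 < u by lra.
  rewrite normrM ger0_norm ?invr_ge0// ler_wpM2l ?invr_ge0//.
  have := HK u u0 m n y mN nN; rewrite GG_derive1n// => h; apply: le_trans h _.
  rewrite ler_wpM2l//; apply: lerXn2r; rewrite ?nnegrE; lra.
rewrite (_ : _ * _ = y ^+ m * GG d (derive1n n phi) w y - y ^+ m * GG d (derive1n n phi) s y -
   (w - s) * (- 2^-1 * (y ^+ m * GG d1 (derive1n n (derive1n 2 phi)) s y))); last by ring.
apply: (@taylor2 R (fun u => y ^+ m * GG d (derive1n n phi) u y)
  (fun u => - 2^-1 * (y ^+ m * GG d1 (derive1n n (derive1n 2 phi)) u y))
  (fun u => 4^-1 * (y ^+ m * GG d2 (derive1n n (derive1n 4 phi)) u y)) (s / 2) (2 * s)).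
- by apply/andP; split; lra.
- by apply/andP; split; lra.
- by move=> u /andP[u1 _]; apply: (dA 0 d); lra.
- move=> u /andP[u1 _]; apply: dv_eq.
    by apply: dvM; [exact: dv_cst|apply: (dA 2 d1); lra].
  by rewrite mul0r add0r -/d2; move: (_ * GG _ _ _ _) => g; field.
- exact: Q.
Qed.

End functional.

(** The s-derivative is bounded in each seminorm near 0, so the evolution
    converges at a linear rate in the Schwartz space and not only pointwise.
    *)
Lemma GG_near0 N d phi : schwartz phi -> exists2 K, 0 <= K &
  forall s, 0 < s <= 1 -> sbound N (K * s) (fun y => GG d phi s y - cos (d + pi / 4) * phi y).
Proof.
move=> sp; have s2 := schwartz_derive1n 2 sp.
have [K K0 HK] := GG_sbound N (d - pi / 2) s2.
pose M := K * 2 ^+ N; have M0 : 0 <= M by rewrite mulr_ge0// exprn_ge0.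
exists M => // s /andP[s0 s1] m n y mN nN.
have [sc Ec] := schwartzZ (cos (d + pi / 4)) sp.
have [_ ->] := schwartzB (GG_schwartz d sp s0) sc.
rewrite Ec GG_derive1n//.
pose f u := y ^+ m * GG d (derive1n n phi) u y.
have df u : 0 < u -> dv f u (- 2^-1 * (y ^+ m * GG (d - pi / 2) (derive1n n.+2 phi) u y)).
  move=> u0; apply: dv_eq.
    by apply: dvM; [exact: dv_cst|exact: (GG_dvs d n y sp u0)].
  by rewrite mul0r add0r; move: (GG _ _ _ _) => g; ring.
have bf u : 0 < u <= 1 -> `|- 2^-1 * (y ^+ m * GG (d - pi / 2) (derive1n n.+2 phi) u y)| <= M.
  move=> /andP[u0 u1]; have := HK u u0 m n y mN nN; rewrite GG_derive1n//.
  have -> : derive1n n (derive1n 2 phi) = derive1n n.+2 phi.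
    by rewrite /derive1n -iterD addn2.
  move=> h; rewrite normrM normrN (ger0_norm (_ : 0 <= 2^-1)) ?invr_ge0//.
  have : (1 + u) ^+ N <= 2 ^+ N by apply: lerXn2r; rewrite ?nnegrE; lra.
  move=> h2; have h3 : K * (1 + u) ^+ N <= M by rewrite ler_wpM2l.
  by apply: le_trans (le_trans h h3); rewrite ler_piMl// invf_le1// ler1n.
have lf : f u @[u --> (0 : R)^'+] --> y ^+ m * (cos (d + pi / 4) * derive1n n phi y).
  by apply: cvgMr; exact: (@GG_lim R d _ y (schwartz_derive1n n sp)).
have L : `|f s - f u| @[u --> (0 : R)^'+] --> `|f s - y ^+ m * (cos (d + pi / 4) * derive1n n phi y)|.
  by apply: cvg_norm; apply: cvgB => //; exact: cvg_cst.
rewrite mulrBr; apply: (ler_cvg_to L (cvg_cst (M * s))).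
near=> u; have u0 : 0 < u by near: u; exact: nbhs_right_gt.
have us : u <= s by near: u; exact: nbhs_right_le.
have : `|f s - f u| <= M * (s - u).
  apply: (@mvt_le R f _ u s M us) => z /andP[uz zs]; [apply: df; lra|].
  by apply: bf; apply/andP; split; lra.
by move/le_trans; apply; rewrite ler_wpM2l//; lra.
Unshelve. all: by end_near. Qed.

Lemma T_GG_lim T C N d phi : tempered T ->
  (forall e phi, schwartz phi -> sbound N e phi -> `|T phi| <= C * e) -> schwartz phi ->
  T (GG d phi s) @[s --> (0 : R)^'+] --> cos (d + pi / 4) * T phi.
Proof.
move=> tT HC sp; have [K K0 HK] := GG_near0 N d sp.
suff H : T (GG d phi s) - cos (d + pi / 4) * T phi @[s --> (0 : R)^'+] --> (0 : R).
  rewrite -[X in _ --> X]add0r; under eq_fun do rewrite -[T _](subrK (cos (d + pi / 4) * T phi)).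
  by apply: cvgD => //; exact: cvg_cst.
apply: (@le_cvg0 R _ _ _ _ (fun s => C * (K * s))).
  near=> s; have s0 : 0 < s by near: s; exact: nbhs_right_gt.
  have s1 : s <= 1 by near: s; exact: nbhs_right_le.
  have [sc _] := schwartzZ (cos (d + pi / 4)) sp; have sw := GG_schwartz d sp s0.
  rewrite -(temperedZ tT _ sp) -(temperedB tT sw sc); apply: HC.
    exact: (proj1 (schwartzB sw sc)).
  by apply: HK; rewrite s0.
rewrite -[X in _ --> X](mulr0 C); apply: cvgMr; rewrite -[X in _ --> X](mulr0 K); apply: cvgMr.
exact: cvg_at_right_filter.
Unshelve. all: by end_near. Qed.

End distributions_along.


(** * Bounded continuous functions on an interval *)

Section bounded_continuous.
Variable R : realType.
Implicit Types (f g h F phi psi q w : R -> R) (x y z a b r v s t c d e M X : R) (D : set R).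
Notation mu := (@lebesgue_measure R).
Notation igr D f := (mu.-integrable D (EFin \o f)).

Lemma ct_bounded g l X : 0 < X -> (forall t, 0 < t -> {for t, continuous g}) ->
  g t @[t --> (0 : R)^'+] --> (l : R) -> exists M, forall t, 0 < t <= X -> `|g t| <= M.
Proof.
move=> X0 cg gl.
have [del d0 Hd] : exists2 del, 0 < del & forall t, 0 < t < del -> `|g t| <= `|l| + 1.
  have /cvgrPdist_le/(_ 1 ltr01) H := gl.
  move: H; rewrite near_withinE => -[del /= d0 Hd]; exists del => // t /andP[t0 td].
  have : `|l - g t| <= 1.
    by apply: Hd => //=; rewrite sub0r normrN gtr0_norm.
  by have := ler_normB l (l - g t); rewrite opprB addrC subrK; lra.
pose a := Num.min del X / 2.
have m0 : 0 < Num.min del X by rewrite lt_min d0 X0.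
have a0 : 0 < a by rewrite divr_gt0.
have aX : a <= X by have := ge_min X del X; rewrite lexx orbT => h; rewrite /a; lra.
have ad : a < del by have := ge_min del del X; rewrite lexx => h; rewrite /a; lra.
have [|c _ Hc] := @EVT_max R (fun t => `|g t|) a X aX.
  apply: continuous_in_subspaceT => x; rewrite inE/= in_itv/= => /andP[ax _].
  by apply: ct_norm; apply: cg; exact: lt_le_trans ax.
exists (`|l| + 1 + `|g c|) => t /andP[t0 tX]; have [ta|at_] := ltP t a.
  have := Hd t; rewrite t0 (lt_trans ta ad) => /(_ isT); have := normr_ge0 (g c); lra.
have := Hc t; rewrite in_itv/= at_ tX => /(_ isT); have := normr_ge0 l; lra.
Qed.

Section on_interval.
Variables (f : R -> R) (X M : R).
Hypothesis X0 : 0 < X.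
Let D : set R := `]0, X[%classic.
Let DE x : D x = (0 < x < X) :> Prop. Proof. by rewrite /D ooE. Qed.
Hypothesis cf : forall x, 0 < x < X -> {for x, continuous f}.
Hypothesis bf : forall x, 0 < x < X -> `|f x| <= M.
Let mD : measurable D. Proof. exact: measurable_itv. Qed.

Lemma bounded_igr : igr D f.
Proof.
apply: (@igr_le R D f (fun=> M) mD).
- by apply: meas_cont; [exact: open_oo|exact: cf].
- exact: igr_cst_oo.
- exact: bf.
Qed.

Lemma ftc1 x : 0 < x < X -> dv (fun y => \int[mu]_(t in `]0, y]) f t) x (f x).
Proof.
move=> hx; have /andP[x0 xX] := hx.
pose u := (x + X) / 2; have xu : x < u by rewrite /u; lra.
have uX : u < X by rewrite /u; lra.
have iu : mu.-integrable [set` Interval (BRight 0) (BRight u)] (EFin \o f).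
  apply: (@igrS R D); [exact: mD|exact: measurable_itv| |exact: bounded_igr].
  by move=> y; rewrite /= in_itv/= DE => /andP[y0 yu]; rewrite y0 (le_lt_trans yu uX).
have [d1 d2] := @continuous_FTC1 R f (BRight 0) x u xu iu x0 (cf hx).
by rewrite /dv -d2 derive1E; exact: DeriveDef.
Qed.

(** Compared on the exhausting intervals, which are symmetric about X / 2. *)
Lemma reflect_int : \int[mu]_(t in D) f (X - t) = \int[mu]_(t in D) f t.
Proof.
pose P y := \int[mu]_(t in `]0, y]) f t.
have ex := @exh_oo R 0 X X0; have [e1 e2 e3] := ex.
set u := (fun n => 0 + _) in ex e1 e2 e3; set v := (fun n => X - _) in ex e1 e2 e3.
have uv n : X - v n = u n by rewrite /u /v; ring.
have vu n : X - u n = v n by rewrite -uv opprB addrC subrK.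
have ig : igr D (fun t => f (X - t)).
  apply: (@igr_le R D _ (fun=> M) mD).
  - apply: meas_cont; first exact: open_oo.
    move=> x; rewrite DE => /andP[x0 x1]; apply: (@ct_comp R f (fun t => X - t)).
      by apply: cf; apply/andP; split; lra.
    by apply: dv_ct; dvs; reflexivity.
  - exact: igr_cst_oo.
  - by move=> x; rewrite DE => /andP[x0 x1]; apply: bf; apply/andP; split; lra.
have c1 := exh_cvg mD ex bounded_igr; have c2 := exh_cvg mD ex ig.
apply: (@cvg_unique _ (@Rhausdorff R) _ _ _ _ c2).
apply: cvg_trans c1; apply: near_eq_cvg; apply: nearW => n.
have hn x : u n <= x <= v n -> 0 < x < X by move=> h; rewrite -DE; exact: e2 h.
have [_ ->] := @ftc_compact R f P (u n) (v n) (e1 n) (fun x p => ftc1 (hn x p)) (fun x p => cf (hn x p)).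
have hn' x : u n <= x <= v n -> 0 < X - x < X.
  by move=> /hn /andP[x0 x1]; apply/andP; split; lra.
have [||_ ->] := @ftc_compact R (fun t => f (X - t)) (fun t => - P (X - t)) (u n) (v n) (e1 n).
- move=> x h; apply: dv_eq.
    apply: dvN; apply: (@dv_comp R P (fun t => X - t)); first exact: ftc1 (hn' x h).
    by dvs; reflexivity.
  by rewrite /=; ring.
- move=> x h; apply: (@ct_comp R f (fun t => X - t)); first exact: cf (hn' x h).
  by apply: dv_ct; dvs; reflexivity.
- by rewrite uv vu; ring.
Qed.

End on_interval.

Lemma zero_of_integrals w l : (forall t, 0 < t -> {for t, continuous w}) ->
  w t @[t --> (0 : R)^'+] --> (l : R) -> (forall X, 0 < X -> \int[mu]_(t in `]0, X[) w t = 0) ->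
  forall t, 0 < t -> w t = 0.
Proof.
move=> cw wl H t t0; have X0 : 0 < t + 1 by lra.
have [M HM] := ct_bounded X0 cw wl.
have cw' x : 0 < x < t + 1 -> {for x, continuous w} by move=> /andP[x0 _]; exact: cw.
have bw x : 0 < x < t + 1 -> `|w x| <= M by move=> /andP[x0 x1]; apply: HM; rewrite x0 ltW.
have h := @ftc1 w (t + 1) M cw' bw t.
apply: (@dv_uniq R (fun y => \int[mu]_(t in `]0, y]) w t) t); first by apply: h; rewrite t0/=; lra.
apply: dv_near (dv_cst 0 t); near=> y.
have y0 : 0 < y by near: y; exact: lt_nbhsr.
have [M' HM'] := ct_bounded y0 cw wl.
transitivity (\int[mu]_(t in `]0, y[) w t); first by rewrite H.
apply: Rintegral_itv_bndo_bndc.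
apply: (@bounded_igr w y M') => x /andP[x0 x1]; first exact: cw.
by apply: HM'; rewrite x0 ltW.
Unshelve. all: by end_near. Qed.

Lemma cint t : 0 < t -> igr `]0, t[%classic (fun r => (cbrt (t - r))^-1) /\
  \int[mu]_(r in `]0, t[) (cbrt (t - r))^-1 = 3 / 2 * cbrt t ^+ 2.
Proof.
move=> t0; pose F r : R := - (3 / 2) * cbrt (t - r) ^+ 2.
rewrite (_ : 3 / 2 * cbrt t ^+ 2 = 0 - F 0); last by rewrite /F subr0; ring.
have dF r : r < t -> dv F r (cbrt (t - r))^-1.
  move=> rt; have tr : 0 < t - r by rewrite subr_gt0.
  have k0 := cbrt_gt0 tr; apply: dv_eq.
    apply: dvM; first exact: dv_cst.
    by apply: dvX; apply: (@dv_cbrt R (fun r => t - r) r _ tr); dvs; reflexivity.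
  by rewrite /=; field; rewrite gt_eqF.
apply: (@ftc_oo_ge0 R (fun r => (cbrt (t - r))^-1) F 0 t (F 0) 0 t0).
- by move=> r /andP[_ rt]; exact: dF.
- move=> r /andP[_ rt]; have tr : 0 < t - r by rewrite subr_gt0.
  apply: dv_ct; apply: dvV; first by rewrite gt_eqF// cbrt_gt0.
  by apply: (@dv_cbrt R (fun r => t - r)) => //; dvs; reflexivity.
- by move=> r /andP[_ rt]; rewrite invr_ge0 ltW// cbrt_gt0// subr_gt0.
- by apply: ct_right; exact: dv_ct (dF 0 t0).
- rewrite -[X in _ --> X](mulr0 (- (3 / 2) : R)); apply: cvgMr.
  rewrite -[X in _ --> X](mulr0 (0 : R)).
  suff H : cbrt (t - r) @[r --> t^'-] --> (0 : R) by exact: (cvgM H H).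
  apply: powR_cvg0' => //.
    by near=> r; rewrite subr_ge0; near: r; exact: nbhs_left_le.
  rewrite -[X in _ --> X](subrr t); apply: cvgB; first exact: cvg_cst.
  exact: cvg_at_left_filter.
Unshelve. all: by end_near. Qed.

End bounded_continuous.


(** * Uniqueness *)

Section uniqueness.
Variable R : realType.
Implicit Types (f g h F psi q w : R -> R) (x y z a b r v s t c d e M : R) (D : set R).
Notation mu := (@lebesgue_measure R).
Notation igr D f := (mu.-integrable D (EFin \o f)).
Notation pos := (`]0, +oo[%classic : set R).
Notation d0 := (ph0 R).

Variables (lambda : R) (Tt : R -> (R -> R) -> R).
Hypothesis l0 : 0 < lambda.
Hypothesis hT : cauchy_solution lambda Tt.

Lemma sol_tempered t : 0 < t -> tempered (Tt t).
Proof. by have [h _] := hT; exact: h. Qed.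

Lemma sol_ct psi t : schwartz psi -> 0 < t -> {for t, continuous (fun t => Tt t psi)}.
Proof.
move=> sq t0; have [_ /(_ psi sq)[h _ _ _]] := hT; have [d _] := h t t0.
by apply: dv_ct; exact: DeriveDef.
Qed.

Lemma sol_lim psi : schwartz psi -> Tt t psi @[t --> (0 : R)^'+] --> psi 0.
Proof. by move=> sq; have [_ /(_ psi sq)[_ h _ _]] := hT. Qed.

(** For each test function, t |-> T_t psi is continuous with a limit at 0+,
    hence bounded on ]0, X]. *)
Lemma sol_ubound X : 0 < X -> exists2 C, 0 <= C & exists N, forall t e psi,
  0 < t <= X -> schwartz psi -> sbound N e psi -> `|Tt t psi| <= C * e.
Proof.
move=> X0; apply: (@uniform_bound R (fun t => 0 < t <= X) Tt).
- by move=> t /andP[t0 _]; exact: sol_tempered.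
- move=> psi sq; apply: (@ct_bounded R (fun t => Tt t psi) (psi 0) X X0).
    by move=> t t0; exact: sol_ct.
  exact: sol_lim.
Qed.

Variable phi : R -> R.
Hypothesis sp : schwartz phi.
Let s2 : schwartz (derive1n 2 phi). Proof. exact: schwartz_derive1n. Qed.
Let s4 : schwartz (derive1n 4 phi). Proof. exact: schwartz_derive1n. Qed.

(** The solution tested against the evolution of phi; Tk1 and Tk2 are its
    derivatives in s. *)
Definition Tk t s : R := Tt t (GG d0 phi s).
Definition Tk1 t s : R := - 2^-1 * Tt t (GG (d0 - pi / 2) (derive1n 2 phi) s).
Definition Tk2 t s : R := - 4^-1 * Tt t (GG d0 (derive1n 4 phi) s).

Section horizon.
Variables (X C : R) (N : nat).
Hypothesis X0 : 0 < X.
Hypothesis C0 : 0 <= C.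
Hypothesis HC : forall t e psi, 0 < t <= X -> schwartz psi -> sbound N e psi -> `|Tt t psi| <= C * e.

Lemma Tk_grow : exists2 K, 0 <= K & forall t, 0 < t <= X ->
  [/\ grow K N (Tk t), grow K N (Tk1 t) & grow K N (Tk2 t)].
Proof.
have [K1 K10 H1] := GG_sbound N d0 sp.
have [K2 K20 H2] := GG_sbound N (d0 - pi / 2) s2.
have [K3 K30 H3] := GG_sbound N d0 s4.
have CK (K K' s : R) : 0 <= K -> K <= K' -> 0 < s -> C * (K * (1 + s) ^+ N) <= C * K' * (1 + s) ^+ N.
  move=> k0 kk s0; rewrite -mulrA ler_wpM2l// ler_wpM2r// exprn_ge0//; lra.
have B (a K : R) t psi d s : `|a| <= 1 -> 0 < t <= X -> schwartz psi -> 0 < s ->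
    sbound N (K * (1 + s) ^+ N) (GG d psi s) -> `|a * Tt t (GG d psi s)| <= C * (K * (1 + s) ^+ N).
  move=> a1 Jt sq s0 b; rewrite normrM; apply: le_trans (HC Jt (GG_schwartz d sq s0) b).
  by rewrite ler_piMl.
have half : `|- 2^-1 : R| <= 1 by rewrite normrN ger0_norm ?invr_ge0// invf_le1// ler1n.
have quart : `|- 4^-1 : R| <= 1 by rewrite normrN ger0_norm ?invr_ge0// invf_le1// ler1n.
exists (C * (K1 + K2 + K3)) => [|t Jt]; first by rewrite mulr_ge0// !addr_ge0.
split=> s s0.
- apply: le_trans (HC Jt (GG_schwartz d0 sp s0) (H1 s s0)) _; apply: CK => //; lra.
- apply: le_trans (B _ _ _ _ _ _ half Jt s2 s0 (H2 s s0)) _; apply: CK => //; lra.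
- apply: le_trans (B _ _ _ _ _ _ quart Jt s4 s0 (H3 s s0)) _; apply: CK => //; lra.
Qed.

Lemma Tk_dv t s : 0 < t <= X -> 0 < s -> dv (Tk t) s (Tk1 t s).
Proof.
move=> Jt s0; have /andP[t0 _] := Jt.
by apply: (T_GG_dv (sol_tempered t0) _ d0 sp s0) => e psi; exact: HC.
Qed.

Lemma Tk1_dv t s : 0 < t <= X -> 0 < s -> dv (Tk1 t) s (Tk2 t s).
Proof.
move=> Jt s0; have /andP[t0 _] := Jt; have tT := sol_tempered t0.
have h := @T_GG_dv R (Tt t) C N tT (fun e psi => @HC t e psi Jt) (d0 - pi / 2) _ s s2 s0.
apply: dv_eq; first by apply: dvM; [exact: dv_cst|exact: h].
have -> : GG (d0 - pi / 2 - pi / 2) (derive1n 2 (derive1n 2 phi)) s =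
    fun y => -1 * GG d0 (derive1n 4 phi) s y.
  by apply/funext => y; rewrite GG_pi// mulN1r.
rewrite (temperedZ tT _ (GG_schwartz d0 s4 s0)) /Tk2 mul0r add0r.
by move: (Tt t _) => g; field.
Qed.

Lemma Tk2_ct t : 0 < t <= X -> ctpos (Tk2 t).
Proof.
move=> Jt s s0; have /andP[t0 _] := Jt; have tT := sol_tempered t0.
apply: ctM; first exact: ct_cst.
exact: dv_ct (@T_GG_dv R (Tt t) C N tT (fun e psi => @HC t e psi Jt) d0 _ s s4 s0).
Qed.

Lemma Tk_lim t : 0 < t <= X -> Tk t s @[s --> (0 : R)^'+] --> Tt t phi.
Proof.
move=> Jt; have /andP[t0 _] := Jt; have tT := sol_tempered t0.
have := @T_GG_lim R (Tt t) C N d0 phi tT (fun e psi => @HC t e psi Jt) sp.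
by rewrite /Tk (_ : d0 + pi / 4 = 0) ?cos0 ?mul1r// /ph0 addNr.
Qed.

Lemma Tk1_lim t : 0 < t <= X -> Tk1 t s @[s --> (0 : R)^'+] --> (0 : R).
Proof.
move=> Jt; have /andP[t0 _] := Jt; have tT := sol_tempered t0.
have := @T_GG_lim R (Tt t) C N (d0 - pi / 2) _ tT (fun e psi => @HC t e psi Jt) s2.
rewrite (_ : d0 - pi / 2 + pi / 4 = - (pi / 2)); last by rewrite /ph0; move: (pi : R) => p; field.
rewrite cosN cos_pihalf mul0r => h.
by rewrite -[X in _ --> X](mulr0 (- 2^-1)); apply: cvgMr.
Qed.

Lemma Tk_ctt t s : 0 < t -> 0 < s -> {for t, continuous (fun t => Tk t s)}.
Proof. by move=> t0 s0; apply: sol_ct => //; exact: GG_schwartz. Qed.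

Lemma Tk2_ctt t s : 0 < t -> 0 < s -> {for t, continuous (fun t => Tk2 t s)}.
Proof.
move=> t0 s0; apply: ctM; first exact: ct_cst.
by apply: sol_ct => //; exact: GG_schwartz.
Qed.

(** The common order-2/3 derivative, in t and in tau, of the function h of the
    duality argument. *)
Definition TQ t tau : R := lambda ^+ 2 * UU lambda (Tk2 t) tau.

(** The intertwining property UU_caputo for G = Tk t, inverted in tau. *)
Lemma abel_tau t tau : 0 < t <= X -> 0 < tau ->
  igr `]0, tau[%classic (fun r => (cbrt (tau - r))^-1 * TQ t r) /\
  Gamma (1 - 2 / 3 : R) * \int[mu]_(r in `]0, tau[) ((cbrt (tau - r))^-1 * TQ t r) =
  Bc R * (UU lambda (Tk t) tau - Tt t phi).
Proof.
move=> Jt tau0; have [K K0 HK] := Tk_grow; have [g1 g2 g3] := HK t Jt.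
have dG s : 0 < s -> dv (Tk t) s (Tk1 t s) by exact: Tk_dv.
have dF s : 0 < s -> dv (Tk1 t) s (Tk2 t s) by exact: Tk1_dv.
have cH := Tk2_ct Jt; have F0 := Tk1_lim Jt.
have cG : ctpos (Tk t) by move=> s s0; exact: dv_ct (dG s s0).
apply: (@abel_inversion R (UU lambda (Tk t)) (TQ t) (Tt t phi) tau tau0).
- move=> r r0; have dU := UU_dv l0 cH g1 g2 g3 dG dF F0.
  split; first by have /dv_derive1[] := dU r r0.
  have d1 := UU_derive1 l0 cH g1 g2 g3 dG dF F0.
  apply: (@cvg_trans _ (UUd lambda (Tk2 t) z @[z --> r])); last first.
    by rewrite d1//; exact: (UUd_ct l0 cH g3 r0).
  by apply: near_eq_cvg; near=> z; rewrite d1//; near: z; exact: lt_nbhsr.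
- exact: (UU_lim l0 cG g1 (Tk_lim Jt)).
- by move=> r r0; have [h _] := UU_caputo l0 cH g1 g2 g3 dG dF F0 r0.
- by move=> r r0; have [_ h] := UU_caputo l0 cH g1 g2 g3 dG dF F0 r0.
Unshelve. all: by end_near. Qed.

(** The Cauchy problem for the test function GG d0 phi s, inverted in t; the
    initial datum gives the value at 0 of that function. *)
Lemma abel_t s t : 0 < s -> 0 < t ->
  igr `]0, t[%classic (fun r => (cbrt (t - r))^-1 * (lambda ^+ 2 * Tk2 r s)) /\
  Gamma (1 - 2 / 3 : R) * \int[mu]_(r in `]0, t[) ((cbrt (t - r))^-1 * (lambda ^+ 2 * Tk2 r s)) =
  Bc R * (Tk t s - G0 phi s).
Proof.
move=> s0 t0; have sT := GG_schwartz d0 sp s0.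
have [_ /(_ _ sT)[h1 h2 h3 h4]] := hT.
apply: (@abel_inversion R (fun t => Tk t s) (fun r => lambda ^+ 2 * Tk2 r s) (G0 phi s) t t0).
- exact: h1.
- exact: h2.
- exact: h3.
- move=> r r0; rewrite (h4 r r0) /dist_derive GG_derive1n// /Tk2.
  by rewrite -signr_odd expr0; move: (Tt r _) => g; field.
Qed.

Lemma pp_grow_igr tau : 0 < tau -> igr pos (fun s => `|pp lambda tau s| * (1 + s) ^+ N).
Proof.
move=> tau0; pose G s : R := (1 + s) ^+ N.
have cG : ctpos G by move=> s s0; apply: dv_ct; rewrite /G; dvs; reflexivity.
have gG : grow 1 N G by move=> s s0; rewrite mul1r ger0_norm// exprn_ge0//; lra.
have [iP _] := pp_int l0 cG gG tau0.
have mp := @mpos R; apply: (igr_eq mp _ (igr_norm mp iP)) => s; rewrite in_posE => s0.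
by rewrite normrM [X in _ * X]ger0_norm// exprn_ge0//; lra.
Qed.

(** abel_t integrated against the density pp; the uniform bound of Tk2 in t
    dominates the exchange of integrals. *)
Lemma abel_t_int t tau : 0 < t <= X -> 0 < tau ->
  igr `]0, t[%classic (fun r => (cbrt (t - r))^-1 * TQ r tau) /\
  Gamma (1 - 2 / 3 : R) * \int[mu]_(r in `]0, t[) ((cbrt (t - r))^-1 * TQ r tau) =
  Bc R * (UU lambda (Tk t) tau - UU lambda (G0 phi) tau).
Proof.
move=> Jt tau0; have [K K0 HK] := Tk_grow; have /andP[t0 tX] := Jt.
pose E : set R := `]0, t[%classic.
have EE x : E x = (0 < x < t) :> Prop by rewrite /E ooE.
have mE : measurable E by exact: measurable_itv.
have EJ r : E r -> 0 < r <= X.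
  by rewrite EE => /andP[r0 rt]; rewrite r0/= ltW// (lt_le_trans rt).
have mp := @mpos R; have [ic vc] := cint t0.
set cI := 3 / 2 * cbrt t ^+ 2 in vc.
have m_ge0 r : E r -> 0 <= (cbrt (t - r))^-1.
  by rewrite EE => /andP[r0 rt]; rewrite invr_ge0 ltW// cbrt_gt0// subr_gt0.
pose f s r : R := pp lambda tau s * ((cbrt (t - r))^-1 * (lambda ^+ 2 * Tk2 r s)).
pose L := lambda ^+ 2 * K; have L0 : 0 <= L by rewrite mulr_ge0// exprn_ge0// ltW.
have f1 s : pos s -> igr E (f s).
  by rewrite in_posE => s0; apply: (igrZ _ mE); exact: (proj1 (abel_t s0 t0)).
have f2 r : E r -> igr pos (f ^~ r) /\ \int[mu]_(s in pos) f s r = (cbrt (t - r))^-1 * TQ r tau.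
  move=> Er; have [g1 g2 g3] := HK r (EJ r Er).
  have [iP vP] := pp_int l0 (Tk2_ct (EJ r Er)) g3 tau0.
  have P s : pos s -> ((cbrt (t - r))^-1 * lambda ^+ 2) * (pp lambda tau s * Tk2 r s) = f s r.
    by move=> _; rewrite /f; ring.
  split; first by apply: (igr_eq mp P); exact: (igrZ _ mp iP).
  by rewrite -(Rint_eq P) (RintZ _ mp iP) vP /TQ [RHS]mulrA.
have fb s r : pos s -> E r -> `|f s r| <= (L * (`|pp lambda tau s| * (1 + s) ^+ N)) * (cbrt (t - r))^-1.
  rewrite in_posE => s0 Er; have [g1 g2 g3] := HK r (EJ r Er).
  rewrite /f normrM [X in _ * X]normrM [X in _ * (_ * X)]normrM (ger0_norm (m_ge0 r Er)) (ger0_norm (exprn_ge0 2 (ltW l0))).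
  have -> : L * (`|pp lambda tau s| * (1 + s) ^+ N) * (cbrt (t - r))^-1 =
    `|pp lambda tau s| * ((cbrt (t - r))^-1 * (lambda ^+ 2 * (K * (1 + s) ^+ N))).
    by rewrite /L; ring.
  rewrite ler_wpM2l// ler_wpM2l ?m_ge0// ler_wpM2l ?exprn_ge0 ?(ltW l0)//.
  exact: g3.
have [|||||h1 h2 h3] := @fubini_R R pos E f (fun s => (cI * L) * (`|pp lambda tau s| * (1 + s) ^+ N)) mp mE.
- apply: sepcont_meas; [exact: open_pos|exact: open_oo| |].
    move=> s r; rewrite in_posE => s0 Er; have := Er; rewrite EE => /andP[r0 rt].
    apply: ctM; first exact: ct_cst.
    apply: ctM; last by apply: ctM; [exact: ct_cst|exact: Tk2_ctt].
    have tr : 0 < t - r by rewrite subr_gt0.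
    apply: dv_ct; apply: dvV; first by rewrite gt_eqF// cbrt_gt0.
    by apply: (@dv_cbrt R (fun r => t - r) r _ tr); dvs; reflexivity.
  move=> s r; rewrite in_posE => s0 Er; apply: ctM; first exact: pp_ct.
  apply: ctM; first exact: ct_cst.
  by apply: ctM; [exact: ct_cst|apply: (Tk2_ct (EJ r Er))].
- exact: f1.
- by move=> r Er; exact: (proj1 (f2 r Er)).
- exact: (igrZ _ mp (pp_grow_igr tau0)).
- move=> s ps; apply: (@le_trans _ _ (\int[mu]_(r in E) ((L * (`|pp lambda tau s| * (1 + s) ^+ N)) * (cbrt (t - r))^-1))).
    apply: (Rint_le mE (igr_norm mE (f1 s ps)) (igrZ _ mE ic)) => r Er.
    exact: fb.
  by rewrite (RintZ _ mE ic) vc le_eqVlt; apply/orP; left; apply/eqP; ring.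
have P2 r : E r -> \int[mu]_(s in pos) f s r = (cbrt (t - r))^-1 * TQ r tau.
  by move=> Er; exact: (proj2 (f2 r Er)).
split; first exact: (igr_eq mE P2 h2).
rewrite -/E -(Rint_eq P2) -h3 -(RintZ _ mp h1).
have [g1 g2 g3] := HK t Jt.
have cG : ctpos (Tk t) by move=> s s0; exact: dv_ct (Tk_dv Jt s0).
have [iT vT] := pp_int l0 cG g1 tau0.
have [C' C'0 HC'] := GG_bound d0 0 sp.
have cG0 : ctpos (G0 phi) by move=> s s0; exact: dv_ct (G_dv 0 sp s0).
have gG0 : grow C' 0 (G0 phi) by move=> s s0; rewrite expr0 mulr1; exact: HC'.
have [iG vG] := pp_int l0 cG0 gG0 tau0.
rewrite -vT -vG -(RintB mp iT iG) -(RintZ _ mp (igrB mp iT iG)).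
apply: Rint_eq => s; rewrite in_posE => s0; have [j1 j2] := abel_t s0 t0.
rewrite /f (RintZ _ mE j1) -mulrBr [in RHS]mulrCA -j2.
by rewrite mulrCA.
Qed.

Lemma cbrt_le x y : 0 < x -> x <= y -> cbrt x <= cbrt y.
Proof.
move=> x0 xy; have y0 : 0 < y := lt_le_trans x0 xy.
have cx := cbrt_gt0 x0; have cy := cbrt_gt0 y0.
rewrite -(ler_pXn2r (_ : 0 < 3)%N) ?nnegrE ?(ltW cx) ?(ltW cy)//.
by rewrite !cbrt_cube ?(ltW x0) ?(ltW y0).
Qed.

Lemma cc_le x y : 0 < x -> x <= y -> cc lambda x <= cc lambda y.
Proof.
move=> x0 xy; rewrite /cc ler_wpM2l ?(ltW l0)//; apply: cbrt_le; lra.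
Qed.

Definition UUmax K : R := 3 * \int[mu]_(z in pos) (Vdom K N 0 (cc lambda X) z).

Lemma UU_le G K tau : ctpos G -> grow K N G -> 0 < tau <= X -> `|UU lambda G tau| <= UUmax K.
Proof.
move=> cG gG /andP[tau0 tauX]; rewrite /UU /UUmax normrM ger0_norm// ler_wpM2l//.
have c0 := cc_gt0 l0 tau0.
apply: (Rint_le_norm (@mpos R) (Vint_meas cG 0 c0) (Vdom_igr K N 0 (cc lambda X))) => z.
rewrite in_posE => z0; apply: le_trans (VV_le gG 0 c0 z0) _.
by apply: (Vdom_mono gG) => //; exact: cc_le.
Qed.

Lemma cc_ct tau : 0 < tau -> {for tau, continuous (cc lambda)}.
Proof. by move=> tau0; exact: dv_ct (cc_dv lambda tau0). Qed.

Lemma TQ_ct2 t tau : 0 < t <= X -> 0 < tau -> {for tau, continuous (TQ t)}.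
Proof.
move=> Jt tau0; have [K K0 HK] := Tk_grow; have [_ _ g3] := HK t Jt.
apply: ctM; first exact: ct_cst.
apply: ctM; first exact: ct_cst.
apply: (@ct_comp R (VV 0 (Tk2 t)) (cc lambda)); last exact: cc_ct.
by apply: (VV_ct (Tk2_ct Jt) g3); exact: cc_gt0.
Qed.

Lemma TQ_ct1 t tau : 0 < t < X -> 0 < tau -> {for t, continuous (TQ ^~ tau)}.
Proof.
move=> ht tau0; have [K K0 HK] := Tk_grow; have c0 := cc_gt0 l0 tau0.
apply: ctM; first exact: ct_cst.
apply: ctM; first exact: ct_cst.
have J x : 0 < x < X -> 0 < x <= X by move=> /andP[-> /ltW].
apply: (@int_ct R pos (fun t z => AA 0 z * Tk2 t (cc lambda tau * z)) (Vdom K N 0 (cc lambda tau)) 0 X t).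
- exact: mpos.
- exact: ht.
- by move=> x hx; exact: (Vint_meas (Tk2_ct (J x hx)) 0 c0).
- move=> x z /andP[x0 _]; rewrite in_posE => z0; apply: ctM; first exact: ct_cst.
  by apply: Tk2_ctt => //; exact: mulr_gt0.
- exact: Vdom_igr.
- move=> x z hx; rewrite in_posE => z0; have [_ _ g3] := HK x (J x hx).
  exact: (VV_le g3 0 c0 z0).
Qed.

(** Continuity in t for fixed s, and a Lipschitz bound in s uniform in t. *)
Lemma Tk_joint_ct (sg : R -> R) t : 0 < t < X -> 0 < sg t -> {for t, continuous sg} ->
  {for t, continuous (fun t => Tk t (sg t))}.
Proof.
move=> /andP[t0 tX] s0 csg; have [K K0 HK] := Tk_grow; set s := sg t in s0.
pose L := K * (1 + 2 * s) ^+ N.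
have L0 : 0 <= L by rewrite mulr_ge0// exprn_ge0//; lra.
have near_sg : \forall x \near t, s / 2 <= sg x <= 2 * s.
  have h2 : 0 < s / 2 by rewrite divr_gt0.
  have /cvgrPdist_le/(_ _ h2) := csg; rewrite -/s.
  by apply: filterS => x; rewrite ler_norml => /andP[h1 h3]; apply/andP; split; lra.
have near_t : \forall x \near t, 0 < x <= X.
  near=> x; apply/andP; split; first by near: x; exact: lt_nbhsr.
  by apply: ltW; near: x; exact: lt_nbhsl.
have H : (fun x => Tk x (sg x) - Tk x s) x @[x --> t] --> (0 : R).
  apply: (@le_cvg0 R _ _ _ _ (fun x => L * `|sg x - s|)).
    near=> x; have Jx : 0 < x <= X by near: x.
    have /andP[s1 s2'] : s / 2 <= sg x <= 2 * s by near: x.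
    have [_ g2 _] := HK x Jx.
    have dk u : s / 2 <= u <= 2 * s -> dv (Tk x) u (Tk1 x u).
      by move=> /andP[u1 _]; apply: (Tk_dv Jx); lra.
    have bk u : s / 2 <= u <= 2 * s -> `|Tk1 x u| <= L.
      move=> /andP[u1 u2]; have u0 : 0 < u by lra.
      apply: le_trans (g2 u u0) _; rewrite ler_wpM2l//; apply: lerXn2r; rewrite ?nnegrE; lra.
    have [sx|xs] := leP s (sg x).
      rewrite (ger0_norm (_ : 0 <= sg x - s)) ?subr_ge0//.
      apply: (@mvt_le R (Tk x) (Tk1 x)) => // u /andP[u1 u2]; [apply: dk|apply: bk]; apply/andP; split; lra.
    rewrite distrC [`|sg x - s|]distrC (ger0_norm (_ : 0 <= s - sg x)) ?subr_ge0 ?(ltW xs)//.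
    apply: (@mvt_le R (Tk x) (Tk1 x)); first exact: ltW.
      by move=> u /andP[u1 u2]; apply: dk; apply/andP; split; lra.
    by move=> u /andP[u1 u2]; apply: bk; apply/andP; split; lra.
  rewrite -[X in _ --> X](mulr0 L); apply: cvgMr; rewrite -[X in _ --> X](@normr0 _ R).
  apply: cvg_norm; rewrite -[X in _ --> X](subrr s); apply: cvgB; [exact: csg|exact: cvg_cst].
have E : (fun x => Tk x (sg x)) x @[x --> t] --> 0 + Tk t s.
  rewrite (_ : (fun x => Tk x (sg x)) = fun x => (Tk x (sg x) - Tk x s) + Tk x s); last first.
    by apply/funext => x; rewrite subrK.
  by apply: cvgD; [exact: H|exact: Tk_ctt].
by rewrite add0r in E; exact: E.
Unshelve. all: by end_near. Qed.

(** The function h on the segment t + tau = X. *)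
Definition TH t : R := UU lambda (Tk t) (X - t).

Lemma TH_ct t : 0 < t < X -> {for t, continuous TH}.
Proof.
move=> ht; have [K K0 HK] := Tk_grow.
apply: ctM; first exact: ct_cst.
have J x : 0 < x < X -> 0 < x <= X by move=> /andP[-> /ltW].
have cG x (hx : 0 < x < X) : ctpos (Tk x) by move=> s s0; exact: dv_ct (Tk_dv (J x hx) s0).
have Xx x : 0 < x < X -> 0 < X - x by move=> /andP[_]; rewrite subr_gt0.
apply: (@int_ct R pos (fun t z => AA 0 z * Tk t (cc lambda (X - t) * z)) (Vdom K N 0 (cc lambda X)) 0 X t).
- exact: mpos.
- exact: ht.
- by move=> x hx; apply: (Vint_meas (cG x hx)); apply: cc_gt0 => //; exact: Xx.
- move=> x z hx; rewrite in_posE => z0; apply: ctM; first exact: ct_cst.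
  apply: (@Tk_joint_ct (fun t => cc lambda (X - t) * z) x hx).
    by rewrite mulr_gt0// cc_gt0// Xx.
  apply: ctM; last exact: ct_cst.
  apply: (@ct_comp R (cc lambda) (fun t => X - t)); first by apply: cc_ct; exact: Xx.
  by apply: dv_ct; dvs; reflexivity.
- exact: Vdom_igr.
- move=> x z hx; rewrite in_posE => z0; have [g1 _ _] := HK x (J x hx).
  have c0 := cc_gt0 l0 (Xx x hx).
  apply: le_trans (VV_le g1 0 c0 z0) _; apply: (Vdom_mono g1) => //; apply: cc_le; first exact: Xx.
  by move: hx => /andP[x0 _]; lra.
Qed.

Let ck : R -> R := (fun u => (cbrt u)^-1) \_ pos.

Let ckE u : 0 < u -> ck u = (cbrt u)^-1.
Proof. by move=> u0; rewrite /ck patchE0// in_posE. Qed.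

Let ck0 u : ~ 0 < u -> ck u = 0.
Proof. by move=> u0; rewrite /ck patchE1// in_posE. Qed.

Let ck_ge0 u : 0 <= ck u.
Proof.
have [u0|/negP u0] := boolP (0 < u); last by rewrite ck0.
by rewrite ckE// invr_ge0 ltW// cbrt_gt0.
Qed.

Let ck_meas : measurable_fun setT ck.
Proof.
have mp := @mpos R; apply/(measurable_restrictT _ mp).
apply: meas_cont => [|x]; first exact: open_pos.
rewrite in_posE => x0; apply: dv_ct.
by apply: dvV; [rewrite gt_eqF// cbrt_gt0|exact: cbrt_dv].
Qed.

Let D : set R := `]0, X[%classic.
Let DE x : D x = (0 < x < X) :> Prop. Proof. by rewrite /D ooE. Qed.
Let mD : measurable D. Proof. exact: measurable_itv. Qed.

Let ck_int tau h : 0 < tau < X -> igr `]0, tau[%classic (fun r => (cbrt (tau - r))^-1 * h r) ->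
  igr D (fun r => ck (tau - r) * h r) /\
  \int[mu]_(r in D) (ck (tau - r) * h r) = \int[mu]_(r in `]0, tau[) ((cbrt (tau - r))^-1 * h r).
Proof.
move=> /andP[t0 tX] ih; pose E : set R := `]0, tau[%classic.
have EE x : E x = (0 < x < tau) :> Prop by rewrite /E ooE.
have mE : measurable E by exact: measurable_itv.
have ED : E `<=` D.
  by move=> x; rewrite EE DE => /andP[x0 xt]; rewrite x0 (lt_trans xt tX).
pose k r : R := (cbrt (tau - r))^-1 * h r.
have P r : D r -> (k \_ E) r = ck (tau - r) * h r.
  rewrite DE => /andP[r0 rX]; have [rt|tr] := ltP r tau.
    have Er : E r by rewrite EE r0.
    have d : 0 < tau - r by rewrite subr_gt0.
    by rewrite (patchE0 _ Er) (ckE d).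
  have Er : ~ E r by rewrite EE => /andP[_]; rewrite ltNge tr.
  have d : ~ 0 < tau - r by rewrite subr_gt0 ltNge tr.
  by rewrite (patchE1 _ Er) (ck0 d) mul0r.
split; last by rewrite -(Rint_eq P); exact: Rint_patch.
apply: (igr_eq mD P); rewrite (_ : EFin \o _ = (EFin \o k) \_ E); last first.
  by apply/funext => x /=; rewrite !patchE; case: ifP.
by apply/(@integrable_restrict _ _ R mu E mE D mD); rewrite setIidr.
Qed.

(** The double integral of Q over t + r < X with kernel (X - t - r)^(-1/3),
    computed in both orders: one order involves abel_tau and T_t phi, the
    other abel_t_int and the explicit solution. The terms in TH agree by
    reflection. *)
Lemma ints_eq : \int[mu]_(t in D) Tt t phi = \int[mu]_(t in D) UU lambda (G0 phi) t.
Proof.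
have [K K0 HK] := Tk_grow.
have [Ga GaE] : exists Ga : R, Ga = Gamma (1 - 2 / 3) by eexists.
have J x : 0 < x < X -> 0 < x <= X by move=> /andP[-> /ltW].
have R1 x : 0 < x < X -> 0 < X - x < X by move=> /andP[x0 xX]; apply/andP; split; lra.
pose f t r : R := ck (X - t - r) * TQ t r.
pose M := lambda ^+ 2 * UUmax K.
have TQ_le t r : D t -> D r -> `|TQ t r| <= M.
  rewrite !DE => ht hr; have [_ _ g3] := HK t (J t ht).
  rewrite /TQ normrM (ger0_norm (exprn_ge0 2 (ltW l0))).
  by apply: ler_wpM2l; [by rewrite exprn_ge0// ltW|exact: (UU_le (Tk2_ct (J t ht)) g3 (J r hr))].
have M0 : 0 <= M.
  have h2 : D (X / 2) by rewrite DE divr_gt0//= ltr_pdivrMr// ltr_pMr// ltr1n.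
  exact: le_trans (normr_ge0 _) (TQ_le _ _ h2 h2).
have a1 t : D t -> igr D (f t) /\ Ga * \int[mu]_(r in D) f t r =
    Bc R * (TH t - Tt t phi).
  rewrite DE => ht; have /andP[x0 x1] := R1 t ht.
  have [i1 v1] := abel_tau (J t ht) x0; have [i2 v2] := ck_int (R1 t ht) i1.
  by split; [exact: i2|rewrite v2 GaE; exact: v1].
have a2 r : D r -> igr D (f ^~ r) /\ Ga * \int[mu]_(t in D) f t r =
    Bc R * (TH (X - r) - UU lambda (G0 phi) r).
  rewrite DE => hr; have /andP[x0 x1] := R1 r hr; have /andP[r0 _] := hr.
  have [i1 v1] := abel_t_int (J _ (R1 r hr)) r0; have [i2 v2] := ck_int (R1 r hr) i1.
  have fE t : D t -> ck (X - r - t) * TQ t r = f t r by move=> _; rewrite /f addrAC.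
  split; first exact: (igr_eq mD fE i2).
  rewrite -(Rint_eq fE) v2 /TH (_ : X - (X - r) = r); last by ring.
  rewrite GaE; exact: v1.
have mf : measurable_fun setT (patch2 D D f).
  have mQ : measurable_fun setT (patch2 D D TQ).
    apply: sepcont_meas; [exact: open_oo|exact: open_oo| |].
      by move=> t r; rewrite !DE => ht /andP[r0 _]; exact: TQ_ct2 (J t ht) r0.
    by move=> t r; rewrite !DE => ht /andP[r0 _]; exact: TQ_ct1 ht r0.
  have -> : patch2 D D f = fun p : R * R => ck (X - p.1 - p.2) * patch2 D D TQ p.
    apply/funext => -[t r] /=.
    have [ht|ht] := pselect (D t); last by rewrite (patch2E1 _ _ _ ht) (patch2E1 _ _ _ ht) mulr0.
    have [hr|hr] := pselect (D r); last by rewrite (patch2E2 _ _ _ hr) (patch2E2 _ _ _ hr) mulr0.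
    by rewrite !patch2E0.
  apply: measurable_funM; last exact: mQ.
  apply: (@measurableT_comp _ _ _ _ _ _ ck); first exact: ck_meas.
  apply: measurable_funB; last exact: measurable_snd.
  by apply: measurable_funB; [exact: measurable_cst|exact: measurable_fst].
have [||||h1 h2 h3] := @fubini_R R D D f (fun=> M * (3 / 2 * cbrt X ^+ 2)) mD mD mf.
- by move=> t Dt; exact: (proj1 (a1 t Dt)).
- by move=> r Dr; exact: (proj1 (a2 r Dr)).
- exact: igr_cst_oo.
- move=> t Dt; have Dt' := Dt; rewrite DE in Dt'.
  have /andP[x0 x1] := R1 t Dt'; have [ic vc] := cint x0.
  have ic1 : igr `]0, X - t[%classic (fun r => (cbrt (X - t - r))^-1 * 1).
    by apply: (igr_eq (measurable_itv _) _ ic) => r _; rewrite mulr1.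
  have [j1 j2] := ck_int (R1 t Dt') ic1.
  apply: (@le_trans _ _ (\int[mu]_(r in D) (M * (ck (X - t - r) * 1)))).
    apply: (Rint_le mD (igr_norm mD (proj1 (a1 t Dt))) (igrZ M mD j1)) => r Dr.
    rewrite /f normrM (ger0_norm (ck_ge0 _)) mulr1 [leRHS]mulrC.
    by apply: ler_wpM2l; [exact: ck_ge0|exact: TQ_le].
  rewrite (RintZ _ mD j1) j2; apply: ler_wpM2l; first exact: M0.
  rewrite (@Rint_eq R _ _ (fun r => (cbrt (X - t - r))^-1)); last by move=> r _; rewrite mulr1.
  rewrite vc; apply: ler_wpM2l; first by rewrite divr_ge0.
  have c1 := cbrt_gt0 x0; have c2 := cbrt_gt0 X0.
  by apply: lerXn2r; rewrite ?nnegrE ?(ltW c1) ?(ltW c2)//; apply: cbrt_le => //; exact: ltW.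
have B0 := @Bc_gt0 R.
have TH_le t : 0 < t < X -> `|TH t| <= UUmax K.
  move=> ht; have [g1 _ _] := HK t (J t ht).
  have cG : ctpos (Tk t) by move=> s s0; exact: dv_ct (Tk_dv (J t ht) s0).
  exact: (UU_le cG g1 (J _ (R1 t ht))).
have iH := bounded_igr TH_ct TH_le.
have rH : \int[mu]_(t in D) TH (X - t) = \int[mu]_(t in D) TH t := reflect_int X0 TH_ct TH_le.
have TH_ct' t : 0 < t < X -> {for t, continuous (fun t => TH (X - t))}.
  move=> ht; apply: (@ct_comp R TH (fun t => X - t)); first exact: TH_ct (R1 t ht).
  by apply: dv_ct; dvs; reflexivity.
have iHr : igr D (fun t => TH (X - t)).
  by apply: (bounded_igr TH_ct') => t ht; exact: TH_le (R1 t ht).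
have iT : igr D (fun t => Tt t phi).
  have ctT t : 0 < t -> {for t, continuous (fun t => Tt t phi)} by exact: sol_ct.
  have [M1 HM1] := ct_bounded X0 ctT (sol_lim sp).
  apply: (@bounded_igr R _ X M1) => t ht; last exact: HM1 (J t ht).
  by apply: ctT; case/andP: ht.
have [C' C'0 HC'] := GG_bound d0 0 sp.
have iU : igr D (fun t => UU lambda (G0 phi) t).
  have cG0 : ctpos (G0 phi) by move=> s s0; exact: dv_ct (G_dv 0 sp s0).
  have gG0 : grow C' N (G0 phi).
    move=> s s0; apply: (le_trans (HC' s 0 s0)); rewrite -[leLHS]mulr1.
    apply: (ler_wpM2l C'0); apply: exprn_ege1; rewrite lerDl; exact: ltW.
  apply: (@bounded_igr R _ X (UUmax C')) => t ht; last exact: (UU_le cG0 gG0 (J t ht)).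
  have /andP[t0 _] := ht; apply: ctM; first exact: ct_cst.
  apply: (@ct_comp R (VV 0 (G0 phi)) (cc lambda)); last exact: cc_ct.
  by apply: (VV_ct cG0 gG0); exact: cc_gt0.
have e1 : Ga * \int[mu]_(t in D) \int[mu]_(r in D) f t r =
    Bc R * (\int[mu]_(t in D) TH t - \int[mu]_(t in D) Tt t phi).
  rewrite -(RintZ Ga mD h1) (Rint_eq (fun t Dt => proj2 (a1 t Dt))).
  by rewrite (RintZ _ mD (igrB mD iH iT)) (RintB mD iH iT).
have e2 : Ga * \int[mu]_(r in D) \int[mu]_(t in D) f t r =
    Bc R * (\int[mu]_(t in D) TH t - \int[mu]_(t in D) UU lambda (G0 phi) t).
  rewrite -(RintZ Ga mD h2) (Rint_eq (fun r Dr => proj2 (a2 r Dr))).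
  apply: (etrans (RintZ (Bc R) mD (igrB mD iHr iU))); congr (_ * _).
  exact: (etrans (RintB mD iHr iU)
    (congr1 (fun z => z - \int[mu]_(t in D) UU lambda (G0 phi) t) rH)).
rewrite h3 e2 in e1; move/(mulfI (lt0r_neq0 B0)) : e1 => /addrI/oppr_inj ->.
exact: erefl.
Qed.

End horizon.

(** Both sides are continuous and have the same integral over ]0, X[ for all
    X. *)
Lemma sol_unique t : 0 < t -> Tt t phi = UU lambda (G0 phi) t.
Proof.
have [C' C'0 HC'] := GG_bound d0 0 sp.
have cG0 : ctpos (G0 phi) by move=> s s0; exact: dv_ct (G_dv 0 sp s0).
have gG0 : grow C' 0 (G0 phi) by move=> s s0; rewrite expr0 mulr1; exact: HC'.
have lU := UU_lim l0 cG0 gG0 (@G_lim R phi 0 sp).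
have cU r : 0 < r -> {for r, continuous (UU lambda (G0 phi))}.
  move=> r0; apply: ctM; first exact: ct_cst.
  apply: (@ct_comp R (VV 0 (G0 phi)) (cc lambda)); last exact: cc_ct.
  by apply: (VV_ct cG0 gG0); exact: cc_gt0.
have cT r : 0 < r -> {for r, continuous (fun t => Tt t phi)} by exact: sol_ct.
move=> t0; apply/eqP; rewrite -subr_eq0; apply/eqP; move: t t0.
apply: (@zero_of_integrals R (fun t => Tt t phi - UU lambda (G0 phi) t) (phi 0 - phi 0)).
- move=> r r0; have h1 := cT r r0; have h2 := cU r r0; exact: cvgB h1 h2.
- by apply: cvgB; [exact: sol_lim|exact: lU].
move=> X X0; have [C C0 [N HC]] := sol_ubound X0.
have mD : measurable (`]0, X[%classic : set R) by exact: measurable_itv.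
have [M1 HM1] := ct_bounded X0 cT (sol_lim sp).
have [M2 HM2] := ct_bounded X0 cU lU.
have J x : 0 < x < X -> 0 < x <= X by move=> /andP[-> /ltW].
have iT : igr `]0, X[%classic (fun t => Tt t phi).
  by apply: (@bounded_igr R _ X M1) => r hr; [apply: cT; case/andP: hr|exact: HM1 (J r hr)].
have iU : igr `]0, X[%classic (UU lambda (G0 phi)).
  by apply: (@bounded_igr R _ X M2) => r hr; [apply: cU; case/andP: hr|exact: HM2 (J r hr)].
rewrite (RintB mD iT iU); apply/eqP; rewrite subr_eq0; apply/eqP.
exact: (ints_eq X0 C0 HC).
Qed.

End uniqueness.

Theorem mainTheorem7 (R : realType) (lambda : R) (hlambda : 0 < lambda) :
  [/\ (* the integral defining u converges absolutely *)
      (forall x t : R, 0 < t ->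
         (@lebesgue_measure R).-integrable `]0%R, +oo[
           (EFin \o u_integrand lambda x t)),
      (* u(., t) is a function that can be paired with test functions *)
      (forall (t : R) (phi : R -> R), 0 < t -> schwartz phi ->
         (@lebesgue_measure R).-integrable [set: R]
           (EFin \o (fun x : R => u_sol lambda x t * phi x))),
      (* u solves the Cauchy problem *)
      cauchy_solution lambda
        (fun t : R => function_dist (fun x : R => u_sol lambda x t)) &
      (* and it is the only solution *)
      (forall T : R -> (R -> R) -> R, cauchy_solution lambda T ->
         forall (t : R) (phi : R -> R), 0 < t -> schwartz phi ->
           T t phi = function_dist (fun x : R => u_sol lambda x t) phi)].
Proof.
split.
- by move=> x t; exact: u_integrand_igr.
- by move=> t phi; exact: u_sol_phi_igr.
- exact: u_cauchy.
- move=> T hT t phi t0 sp.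
  by rewrite (sol_unique hlambda hT sp t0) u_distE.
Qed.
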